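(* Let $K\ge1$ and $L\ge 2$. Assume that $(\mathbf{X}_i)_{1\le i\le n}$ are $\mathbb{R}^K$-valued i.i.d. random vectors, $\mathbf{X}_i=(X_{i,1},\dots,X_{i,K})'$, such that, for all $k\in\{1,\dots,K\}$, the c.d.f. $F_k$ of $X_{1,k}$ is continuous, and that the $K\times K$ matrix $\Sigma$ with entries $\Sigma_{kk'}=4\operatorname{Cov}(F_k(X_{1,k}),F_{k'}(X_{1,k'}))$ is positive definite. Let $0=n_0<n_1<\dots<n_{L-1}<n_L=n$ be integers (depending on $n$) such that for each $\ell=0,\dots,L-1$ there exists $t_{\ell+1}\in(0,1)$ with $(n_{\ell+1}-n_\ell)/n\to t_{\ell+1}$ as $n\to\infty$. Then the statistic $$T(n_1,\dots,n_{L-1})=\frac{4}{n^2}\sum_{\ell=0}^{L-1}(n_{\ell+1}-n_\ell)\,\bar{\mathbf{R}}_\ell'\,\hat\Sigma_n^{-1}\,\bar{\mathbf{R}}_\ell$$ converges in distribution, as $n\to\infty$, to the chi-square distribution with $(L-1)K$ degrees of freedom.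
   Context: The prime denotes transposition and $\mathbf 1(\cdot)$ the indicator function. For $j\in\{1,\dots,n\}$ and $k\in\{1,\dots,K\}$, $R_j^{(k)}=\sum_{i=1}^n\mathbf 1(X_{i,k}\le X_{j,k})$ is the rank of $X_{j,k}$ among $(X_{1,k},\dots,X_{n,k})$. For $\ell\in\{0,\dots,L-1\}$ the average rank in group $\ell$ (observations with indices $n_\ell+1,\dots,n_{\ell+1}$) for coordinate $k$ is $$\bar R_\ell^{(k)}=(n_{\ell+1}-n_\ell)^{-1}\sum_{j=n_\ell+1}^{n_{\ell+1}}R_j^{(k)},$$ and $\bar{\mathbf{R}}_\ell=\big(\bar R_\ell^{(1)}-(n+1)/2,\dots,\bar R_\ell^{(K)}-(n+1)/2\big)'$. With $\hat F_{n,k}(t)=n^{-1}\sum_{j=1}^n\mathbf 1(X_{j,k}\le t)$, the matrix $\hat\Sigma_n$ is the $K\times K$ matrix with entries $$\hat\Sigma_{n,kk'}=\frac4n\sum_{i=1}^n\{\hat F_{n,k}(X_{i,k})-1/2\}\{\hat F_{n,k'}(X_{i,k'})-1/2\}.$$ The statistic is defined by the displayed formula whenever $\hat\Sigma_n$ is invertible; its value when $\hat\Sigma_n$ is singular may be set arbitrarily. *)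

(* Defs.v *)
From HB Require Import structures.
From mathcomp Require Import all_boot all_order all_algebra.
From mathcomp Require Import all_classical all_reals all_analysis.
From mathcomp Require Import measurable_realfun.

Set Implicit Arguments.
Unset Strict Implicit.
Unset Printing Implicit Defensive.

Import Order.TTheory GRing.Theory Num.Theory.
Import numFieldNormedType.Exports.

Local Open Scope classical_set_scope.
Local Open Scope ring_scope.

Section iid.
Context d d' (T : measurableType d) (T' : measurableType d') (R : realType).
Variables (P : probability T R) (X : nat -> {RV P >-> T'}).

Definition mutually_independent : Prop :=
  forall (J : seq nat) (A : nat -> set T'), uniq J ->
    (forall i, measurable (A i)) ->
    P (\bigcap_(i in [set` J]) (X i @^-1` A i)) =
    (\prod_(i <- J) P (X i @^-1` A i))%E.

Definition identically_distributed : Prop :=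
  forall (i : nat) (A : set T'), measurable A ->
    distribution P (X i) A = distribution P (X 0%N) A.

Definition iid : Prop := mutually_independent /\ identically_distributed.

End iid.
Arguments mutually_independent {d d' T T' R} P X.
Arguments identically_distributed {d d' T T' R} P X.
Arguments iid {d d' T T' R} P X.

Section coordinate.
Context d (T : measurableType d) (R : realType) (K : nat).
Variables (X : {mfun T >-> K.-tuple R}) (k : 'I_K).

Definition coord (t : T) : R := tnth (X t) k.

Lemma measurable_coord : measurable_fun [set: T] coord.
Proof.
apply: (@measurableT_comp _ _ _ _ _ _ (fun x : K.-tuple R => tnth x k)) => //.
exact: measurable_tnth.
Qed.

HB.instance Definition _ := isMeasurableFun.Build _ _ _ _ coord measurable_coord.

End coordinate.

Section population.
Context d (T : measurableType d) (R : realType) (P : probability T R) (K : nat).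
Variable X : {RV P >-> K.-tuple R}.

Definition marginal_cdf (k : 'I_K) (x : R) : R :=
  fine (cdf (coord X k : {RV P >-> R}) x).

Definition grade_cov : 'M[R]_K :=
  \matrix_(k, k') (4 * fine (covariance P
     (marginal_cdf k \o coord X k) (marginal_cdf k' \o coord X k'))).

End population.
Arguments marginal_cdf {d T R} P {K} X k x.
Arguments grade_cov {d T R} P {K} X.

Definition positive_definite (R : numDomainType) (K : nat) (A : 'M[R]_K) : Prop :=
  A^T = A /\ forall v : 'cV[R]_K, v != 0 -> 0 < (v^T *m A *m v) 0 0.

(* Observations and groups are numbered from 0: x i is the (i+1)-th observation
   and, for breakpoints b 0 < ... < b L, group l consists of the x j with
   b l <= j < b l.+1. *)
Section statistic.
Context (R : realType) (K : nat) (n : nat) (x : nat -> K.-tuple R).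

Definition rank (j : nat) (k : 'I_K) : R :=
  \sum_(i < n) (tnth (x i) k <= tnth (x j) k)%R%:R.

Definition group_mean_rank (b : nat -> nat) (l : nat) (k : 'I_K) : R :=
  ((b l.+1)%:R - (b l)%:R)^-1 * \sum_(b l <= j < b l.+1) rank j k.

Definition centered_mean_rank (b : nat -> nat) (l : nat) : 'cV[R]_K :=
  \col_k (group_mean_rank b l k - (n%:R + 1) / 2).

Definition empirical_cdf (k : 'I_K) (s : R) : R :=
  n%:R^-1 * \sum_(j < n) (tnth (x j) k <= s)%R%:R.

Definition empirical_cov : 'M[R]_K :=
  \matrix_(k, k') (4 / n%:R * \sum_(i < n)
     (empirical_cdf k (tnth (x i) k) - 1 / 2) *
     (empirical_cdf k' (tnth (x i) k') - 1 / 2)).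

Definition rank_formula (L : nat) (b : nat -> nat) : R :=
  4 / n%:R ^+ 2 * \sum_(l < L) ((b l.+1)%:R - (b l)%:R) *
    ((centered_mean_rank b l)^T *m invmx empirical_cov
       *m centered_mean_rank b l) 0 0.

End statistic.

(* A map that only depends on finitely many measurable bits is measurable
   whatever the sigma-algebra on its codomain. *)
Lemma measurable_finite_factor d (T : measurableType d) (I : finType)
    (h : I -> T -> bool) (V : Type) (f : T -> V) :
  (forall i, measurable [set t | h i t]) ->
  (forall s t, (forall i, h i s = h i t) -> f s = f t) ->
  forall B : set V, measurable (f @^-1` B).
Proof.
move=> mh fE B.
have mhb i (c : bool) : measurable [set t | h i t = c].
  case: c; first exact: mh.
  rewrite (_ : [set t | h i t = false] = ~` [set t | h i t]).
    by apply: measurableC; exact: mh.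
  by apply/seteqP; split=> t /=; case: (h i t).
pose D := [set g : {ffun I -> bool} | exists2 t, B (f t) & forall i, h i t = g i].
have -> : f @^-1` B =
    \bigcup_(g in D) \bigcap_(i in [set: I]) [set t | h i t = g i].
  apply/seteqP; split=> t /=.
    move=> Bt; exists [ffun i => h i t]; last by move=> i _ /=; rewrite ffunE.
    by exists t => // i; rewrite ffunE.
  by move=> [g [s Bs hs] ht]; rewrite (fE t s) // => i; rewrite hs; exact: ht.
apply: fin_bigcup_measurable => [|g _]; first exact: finite_finset.
by apply: fin_bigcap_measurable => [|i _]; [exact: finite_finset|exact: mhb].
Qed.

Section random_statistic.
Context d (T : measurableType d) (R : realType) (K : nat).
Variables (X : nat -> {mfun T >-> K.-tuple R}) (C : {mfun T >-> R}).
Variables (L n : nat) (b : nat -> nat).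

(* C is the arbitrary value of the statistic where the empirical covariance
   matrix is singular. *)
Definition rank_statistic (t : T) : R :=
  if empirical_cov n (X ^~ t) \in unitmx then rank_formula n (X ^~ t) L b
  else C t.

Let m := (n + \sum_(l < L) b l.+1)%N.

Let bit (i : 'I_m * 'I_m * 'I_K) (t : T) : bool :=
  coord (X i.1.1) i.2 t <= coord (X i.1.2) i.2 t.

Let mbit i : measurable [set t | bit i t].
Proof.
by rewrite -[X in measurable X]setTI; apply: measurable_fun_le => //;
  exact: measurable_coord.
Qed.

Let le_coord s t (st : forall i, bit i s = bit i t) i j k : (i < m)%N ->
  (j < m)%N -> (tnth (X i s) k <= tnth (X j s) k) =
               (tnth (X i t) k <= tnth (X j t) k).
Proof. by move=> im jm; exact: (st (Ordinal im, Ordinal jm, k)). Qed.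

Let nm : (n <= m)%N. Proof. exact: leq_addr. Qed.

Let empirical_cov_bit s t : (forall i, bit i s = bit i t) ->
  empirical_cov n (X ^~ s) = empirical_cov n (X ^~ t).
Proof.
move=> st; apply/matrixP => k k'; rewrite !mxE; congr (_ * _).
have E k0 (i : 'I_n) : empirical_cdf n (X ^~ s) k0 (tnth (X i s) k0) =
                      empirical_cdf n (X ^~ t) k0 (tnth (X i t) k0).
  congr (_ * _); apply: eq_bigr => j _; congr (nat_of_bool _)%:R.
  by apply: le_coord => //; exact: leq_trans nm.
by apply: eq_bigr => i _; rewrite !E.
Qed.

Let rank_formula_bit s t : (forall i, bit i s = bit i t) ->
  rank_formula n (X ^~ s) L b = rank_formula n (X ^~ t) L b.
Proof.
move=> st; congr (_ * _); apply: eq_bigr => l _.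
rewrite (empirical_cov_bit st).
rewrite (_ : centered_mean_rank n (X ^~ s) b l =
             centered_mean_rank n (X ^~ t) b l) //.
apply/matrixP => k j0; rewrite !mxE; congr (_ * _ - _).
apply: eq_big_nat => j /andP[_ jb]; apply: eq_bigr => i _.
congr (nat_of_bool _)%:R; apply: le_coord => //; first exact: leq_trans nm.
by rewrite (leq_trans jb)// /m (bigD1 l)//= addnCA leq_addr.
Qed.

Lemma measurable_rank_statistic : measurable_fun [set: T] rank_statistic.
Proof.
apply: measurable_fun_ifT => //.
- move=> _ A _; rewrite setTI.
  by apply: (measurable_finite_factor mbit) => s t /empirical_cov_bit ->.
- move=> _ A _; rewrite setTI.
  by apply: (measurable_finite_factor mbit) => s t /rank_formula_bit.
Qed.

HB.instance Definition _ :=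
  isMeasurableFun.Build _ _ _ _ rank_statistic measurable_rank_statistic.

End random_statistic.

Section chi_square.
Context (R : realType).

Definition cons_tuple (m : nat) (p : measurableTypeR R * m.-tuple R) : m.+1.-tuple R :=
  [tuple of p.1 :: p.2].

Lemma measurable_cons_tuple m : measurable_fun [set: _] (@cons_tuple m).
Proof.
apply: measurable_cons; last exact: measurable_snd.
move=> mT A mA; exact: (@measurable_fst _ _ (measurableTypeR R)).
Qed.

HB.instance Definition _ m :=
  isMeasurableFun.Build _ _ _ _ (@cons_tuple m) (@measurable_cons_tuple m).

(* Joint law of m independent N(0, 1) variables, i.e. the m-fold product of
   normal_prob 0 1 built one coordinate at a time. *)
Fixpoint std_normal (m : nat) : probability (m.-tuple R) R :=
  if m is m'.+1 then
    distribution (normal_prob (0 : R) 1 \x std_normal m')%E (@cons_tuple m')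
  else \d_([tuple] : 0.-tuple R).

Definition sum_squares (m : nat) (z : m.-tuple R) : R :=
  \sum_(i < m) tnth z i ^+ 2.

Lemma measurable_sum_squares m : measurable_fun [set: _] (@sum_squares m).
Proof.
apply: measurable_sum => i; apply: measurable_funX; exact: measurable_tnth.
Qed.

HB.instance Definition _ m :=
  isMeasurableFun.Build _ _ _ _ (@sum_squares m) (@measurable_sum_squares m).

Definition chi_square (m : nat) : probability R R :=
  distribution (std_normal m) (@sum_squares m).

End chi_square.

Definition cvg_in_distribution d (T : measurableType d) (R : realType)
    (P : probability T R) (Y : nat -> {RV P >-> R}) (mu : probability R R) :=
  forall x : R, {for x, continuous (fun r : R => mu `]-oo, r]%classic)} ->
    cdf (Y n) x @[n --> \oo] --> mu `]-oo, x]%classic.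
Arguments cvg_in_distribution {d T R} P Y mu.

(* Main.v *)
Require Import Defs.
From HB Require Import structures.
From mathcomp Require Import all_boot all_order all_algebra.
From mathcomp Require Import all_classical all_reals all_analysis.
From mathcomp Require Import measurable_realfun ring lra.

Set Implicit Arguments.
Unset Strict Implicit.
Unset Printing Implicit Defensive.

Import Order.TTheory GRing.Theory Num.Theory.
Import numFieldNormedType.Exports.

Local Open Scope classical_set_scope.
Local Open Scope ring_scope.

(** Idea of the proof.

    Twice the centred grade F_k (X_(i,k)) is the k-th score of the i-th
    observation; the score vectors are bounded, independent, centred, with
    covariance matrix Sigma. Hajek's projection (centered_mean_rankE) splits each
    standardized mean rank into a contrast of scores and a sum of degenerate
    comparisons, whose second moment is O(1/n) because two comparisons are
    uncorrelated unless they involve the same two observations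
    (mean_sqr_degenerate). The empirical covariance matrix is close to Sigma in
    mean square (mean_sqr_empirical_cov), and inverting a positive definite form
    is continuous (inv_form_close). Hence the rank statistic differs by a term
    converging to 0 in probability (rank_statistic_close) from

      Z = sum_l w_l^T Sigma^-1 w_l,

    where w_l is the l-th row of the L x K matrix w = sum_j c_j score_j^T and
    c_j is the vector of contrasts of the j-th observation. The Gram matrix
    sum_j c_j c_j^T is 1 - u u^T for a unit vector u, a projection of rank L - 1
    (gram_contrast).

    The limit law is identified through the Laplace transform of Z. For
    independent centred Gaussian vectors g_j of covariance matrix Sigma and
    M = 1 + 2 lambda sum_j c_j c_j^T (sum over a set of indices j), the mean of
    exp (- lambda Z) for the state w + sum_j c_j g_j^T is explicit:

      det(M)^(-K/2) exp (- lambda tr (w^T M^-1 w Sigma^-1)).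

    This is the function heat, and Lindeberg's replacement of the Gaussian
    increments by the scores, one at a time, only compares values of this
    function: by the Sherman-Morrison formula and the matrix determinant lemma
    one step is a computation with scalars (heat_step_scalar, heat_step), whose
    terms of first and second order vanish in the mean because the current state
    is independent of the next observation (mean_deviation). A step costs
    O(|c_j|^3) = O(n^(-3/2)), so the n steps cost O(n^(-1/2))
    (mean_heat_state). Before the first step w = 0, and the flow has the value
    (1 + 2 lambda)^(-(L-1)K/2), which is the Laplace transform of the chi-square
    law (mean_std_normal_laplace).

    Convergence of the Laplace transforms at the natural numbers is convergence
    of the means of polynomials in exp (- Z), and such polynomials separate the
    half-lines (polynomial_cutoff, laplace_cvg_in_distribution). *)

(** * Bounded random variables and their expectations *)

(** Every random variable below belongs to this class, closed under the
    operations in use, so that integrability is never an issue. *)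
Definition bounded_measurable d (T : measurableType d) (R : realType)
    (f : T -> R) :=
  measurable_fun [set: T] f /\ exists M, forall t, `|f t| <= M.

Section bounded_measurable.
Context d (T : measurableType d) (R : realType).
Implicit Types f g : T -> R.

Lemma bounded_measurable_cst (a : R) : bounded_measurable (fun _ : T => a).
Proof. by split; [exact: measurable_cst|exists `|a|]. Qed.

Lemma bounded_measurableD f g : bounded_measurable f -> bounded_measurable g ->
  bounded_measurable (fun t => f t + g t).
Proof.
move=> [mf [M fM]] [mg [N gN]]; split; first exact: measurable_funD.
by exists (M + N) => t; rewrite (le_trans (ler_normD _ _))// lerD.
Qed.

Lemma bounded_measurableM f g : bounded_measurable f -> bounded_measurable g ->
  bounded_measurable (fun t => f t * g t).
Proof.
move=> [mf [M fM]] [mg [N gN]]; split; first exact: measurable_funM.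
by exists (M * N) => t; rewrite normrM ler_pM.
Qed.

Lemma bounded_measurableZ (a : R) f : bounded_measurable f ->
  bounded_measurable (fun t => a * f t).
Proof. by move=> hf; apply: bounded_measurableM => //; exact: bounded_measurable_cst. Qed.

Lemma bounded_measurableN f : bounded_measurable f ->
  bounded_measurable (fun t => - f t).
Proof.
move=> /(bounded_measurableZ (-1)); congr bounded_measurable.
by apply/funext => t; rewrite mulN1r.
Qed.

Lemma bounded_measurableB f g : bounded_measurable f -> bounded_measurable g ->
  bounded_measurable (fun t => f t - g t).
Proof. by move=> hf hg; apply: bounded_measurableD => //; exact: bounded_measurableN. Qed.

Lemma bounded_measurableX f n : bounded_measurable f ->
  bounded_measurable (fun t => f t ^+ n).
Proof.
move=> hf; elim: n => [|n IH]; first exact: bounded_measurable_cst.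
rewrite (_ : (fun _ => _) = (fun t => f t * f t ^+ n)).
  exact: bounded_measurableM.
by apply/funext => t; rewrite exprS.
Qed.

Lemma bounded_measurable_sum (I : Type) (r : seq I) (p : pred I) (F : I -> T -> R) :
  (forall i, p i -> bounded_measurable (F i)) ->
  bounded_measurable (fun t => \sum_(i <- r | p i) F i t).
Proof.
move=> hF; elim: r => [|i r IH].
  under eq_fun do rewrite big_nil; exact: bounded_measurable_cst.
under eq_fun do rewrite big_cons.
by case: (boolP (p i)) => // pi; apply: bounded_measurableD => //; exact: hF.
Qed.

Lemma bounded_measurable_expR f : bounded_measurable f ->
  bounded_measurable (fun t => expR (f t)).
Proof.
move=> [mf [M fM]]; split; first exact: measurableT_comp.
exists (expR M) => t; rewrite ger0_norm ?expR_ge0// ler_expR.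
exact: le_trans (ler_norm _) (fM t).
Qed.

Lemma bounded_measurable_bool (b : T -> bool) : measurable_fun [set: T] b ->
  bounded_measurable (fun t => (b t)%:R : R).
Proof.
move=> mb; split; last first.
  by exists 1 => t; case: (b t); rewrite ?normr1 ?normr0.
rewrite (_ : (fun _ => _) = (fun t => if b t then 1 else 0 : R)).
  by apply: measurable_fun_ifT => //; exact: measurable_cst.
by apply/funext => t; case: (b t).
Qed.

Lemma bounded_measurable_le f g : measurable_fun [set: T] f ->
  measurable_fun [set: T] g ->
  bounded_measurable (fun t => (f t <= g t)%R%:R : R).
Proof.
by move=> mf mg; apply: bounded_measurable_bool; exact: measurable_fun_ler.
Qed.

End bounded_measurable.

Section expectation.
Context d (T : measurableType d) (R : realType) (P : probability T R).
Implicit Types f g : T -> R.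

Definition mean f : R := \int[P]_t f t.

Lemma bounded_measurable_integrable f :
  bounded_measurable f -> P.-integrable [set: T] (EFin \o f).
Proof.
move=> [mf [M fM]]; apply: measurable_bounded_integrable => //.
  by rewrite [X in (X < _)%E]probability_setT ltry.
exists M; split; first exact: num_real.
by move=> x Mx t _ /=; apply: le_trans (fM t) (ltW Mx).
Qed.

Lemma eq_mean f g : f =1 g -> mean f = mean g.
Proof. by move=> fg; apply: eq_Rintegral => t _. Qed.

Lemma mean_EFin f : bounded_measurable f ->
  (\int[P]_t (f t)%:E = (mean f)%:E)%E.
Proof.
move=> hf; rewrite /mean /Rintegral fineK//.
by apply: integrable_fin_num => //; exact: bounded_measurable_integrable.
Qed.

Lemma mean_cst a : mean (fun _ => a) = a.
Proof. by rewrite /mean Rintegral_cst//= probability_setT mulr1. Qed.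

Lemma meanD f g : bounded_measurable f -> bounded_measurable g ->
  mean (fun t => f t + g t) = mean f + mean g.
Proof. by move=> hf hg; rewrite /mean RintegralD//; exact: bounded_measurable_integrable. Qed.

Lemma meanB f g : bounded_measurable f -> bounded_measurable g ->
  mean (fun t => f t - g t) = mean f - mean g.
Proof. by move=> hf hg; rewrite /mean RintegralB//; exact: bounded_measurable_integrable. Qed.

Lemma meanZ a f : bounded_measurable f -> mean (fun t => a * f t) = a * mean f.
Proof. by move=> hf; rewrite /mean RintegralZl//; exact: bounded_measurable_integrable. Qed.

Lemma mean_sum (I : Type) (r : seq I) (p : pred I) (F : I -> T -> R) :
  (forall i, p i -> bounded_measurable (F i)) ->
  mean (fun t => \sum_(i <- r | p i) F i t) = \sum_(i <- r | p i) mean (F i).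
Proof.
move=> hF; elim: r => [|i r IH].
  by rewrite big_nil; under eq_mean do rewrite big_nil; exact: mean_cst.
rewrite big_cons; under eq_mean do rewrite big_cons.
case: (boolP (p i)) => // pi; rewrite meanD ?IH//; first exact: hF.
exact: bounded_measurable_sum.
Qed.

Lemma le_mean f g : bounded_measurable f -> bounded_measurable g ->
  (forall t, f t <= g t) -> mean f <= mean g.
Proof. by move=> hf hg fg; apply: le_Rintegral => //; exact: bounded_measurable_integrable. Qed.

Lemma mean_ge0 f : (forall t, 0 <= f t) -> 0 <= mean f.
Proof. by move=> f0; exact: Rintegral_ge0. Qed.

Lemma normr_mean_le f M : bounded_measurable f -> (forall t, `|f t| <= M) ->
  `|mean f| <= M.
Proof.
move=> hf fM; rewrite ler_norml -[X in _ <= _ <= X](mean_cst M).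
rewrite -[X in X <= _](mean_cst (- M)); apply/andP; split;
  apply: le_mean => //; try exact: bounded_measurable_cst.
  by move=> t; have := fM t; rewrite ler_norml => /andP[].
by move=> t; have := fM t; rewrite ler_norml => /andP[].
Qed.

Lemma mean_bool (b : T -> bool) : measurable_fun [set: T] b ->
  ((mean (fun t => (b t)%:R))%:E = P [set t | b t])%E.
Proof.
move=> mb; rewrite -mean_EFin; last exact: bounded_measurable_bool.
have mB : measurable [set t | b t].
  by rewrite -[X in measurable X]setTI; exact: (mb measurableT [set true]).
rewrite -[RHS]mul1e -[RHS]integral_cst// integral_mkcond/=.
rewrite -[in RHS](setIT [set t | b t]) ?setIT; apply: eq_integral => t _.
rewrite patchE; case: ifPn.
  by rewrite inE /= => ->.
by rewrite notin_setE/= => /negP/negbTE ->.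
Qed.

(** The mean square of a sum is the sum of all mixed second moments, so it is
    small as soon as few pairs of summands are correlated. *)
Lemma mean_sqr_sum_le (I : Type) (r : seq I) (F : I -> T -> R) (c : I -> I -> R) :
  (forall i, bounded_measurable (F i)) ->
  (forall i j, mean (fun t => F i t * F j t) <= c i j) ->
  mean (fun t => (\sum_(i <- r) F i t) ^+ 2) <= \sum_(i <- r) \sum_(j <- r) c i j.
Proof.
move=> hF hc.
rewrite (@eq_mean _ (fun t => \sum_(i <- r) \sum_(j <- r) F i t * F j t)); last first.
  by move=> t; rewrite expr2 mulr_suml; apply: eq_bigr => i _; rewrite mulr_sumr.
rewrite mean_sum => [|i _]; last first.
  by apply: bounded_measurable_sum => j _; exact: bounded_measurableM.
apply: ler_sum => i _; rewrite mean_sum => [|j _]; last exact: bounded_measurableM.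
by apply: ler_sum => j _; exact: hc.
Qed.

End expectation.

(** * Integrating out one observation *)

Section integrate_out.
Context d d' (T : measurableType d) (T' : measurableType d') (R : realType).
Variables (P : probability T R) (X : nat -> {RV P >-> T'}).
Hypothesis X_indep : mutually_independent P X.
Variable i : nat.

(** A generating family that is closed under intersection and on which
    independence of X i is the product rule. *)
Definition cylinders_without : set (set T) :=
  [set B | exists2 JA : seq nat * (nat -> set T'),
     [/\ uniq JA.1, i \notin JA.1 & forall j, measurable (JA.2 j)] &
     B = \bigcap_(j in [set` JA.1]) (X j @^-1` JA.2 j)].

(** The sample space carrying the sigma-algebra of all observations but the
    i-th: a function measurable here is independent of X i. *)
Definition without : Type := g_sigma_algebraType cylinders_without.
HB.instance Definition _ := Measurable.on without.

Lemma cylinders_without_setI : setI_closed cylinders_without.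
Proof.
move=> _ _ [[J A] /= [uJ iJ mA] ->] [[J' A'] /= [uJ' iJ' mA'] ->].
exists (undup (J ++ J'), fun j => (if j \in J then A j else setT) `&`
                                  (if j \in J' then A' j else setT)) => /=.
  split; first exact: undup_uniq.
    by rewrite mem_undup mem_cat negb_or iJ.
  by move=> j; apply: measurableI; case: ifP.
apply/seteqP; split=> t /=.
  move=> [tJ tJ'] j /= _; split; case: ifPn => // jJ; [exact: tJ|exact: tJ'].
move=> tJJ'; split=> j /= jJ; have := tJJ' j; rewrite /= mem_undup mem_cat jJ ?orbT.
  by case=> // + _.
by case.
Qed.

Lemma cylinders_without_measurable (B : set T) :
  cylinders_without B -> measurable B.
Proof.
move=> [[J A] /= [uJ iJ mA] ->].
apply: fin_bigcap_measurable => [|j _]; first exact: finite_seq.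
exact: measurable_funPTI.
Qed.

Lemma without_measurable (B : set T) :
  measurable (B : set without) -> measurable B.
Proof.
move=> mB; apply: (@smallest_sub _ (sigma_algebra setT) cylinders_without _ _ _ B mB).
  exact: sigma_algebra_measurable.
by move=> C; exact: cylinders_without_measurable.
Qed.

Definition forget (t : T) : without := t.

Lemma measurable_forget : measurable_fun [set: T] forget.
Proof. by move=> _ B mB; rewrite setTI; exact: without_measurable. Qed.

HB.instance Definition _ := isMeasurableFun.Build _ _ _ _ forget measurable_forget.

Lemma measurable_without (j : nat) : j != i ->
  measurable_fun [set: without] (X j : without -> T').
Proof.
move=> ji _ A mA; rewrite setTI; apply: sub_sigma_algebra.
exists ([:: j], fun=> A) => /=; first by split => //; rewrite inE eq_sym.
apply/seteqP; split=> t /=; first by move=> tA k /=; rewrite inE => /eqP ->.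
by apply => /=; rewrite inE.
Qed.

Lemma bounded_measurable_without (f : T -> R) :
  bounded_measurable (f : without -> R) -> bounded_measurable f.
Proof.
move=> [mf bf]; split => // _ B mB; rewrite setTI.
by apply: without_measurable; rewrite -[X in measurable X]setTI; exact: mf.
Qed.

(** Both sides are finite measures of B that agree on the cylinders. *)
Lemma independent_without (A : set T') (B : set without) :
  measurable A -> measurable B ->
  P (X i @^-1` A `&` B) = (P (X i @^-1` A) * P B)%E.
Proof.
move=> mA mB.
have mXA : measurable (X i @^-1` A) by exact: measurable_funPTI.
pose m1h : {measure set without -> \bar R} :=
  pushforward (mrestr P mXA) forget.
pose m1 := m1h measurable_forget.
pose r := NngNum (fine_ge0 (measure_ge0 P (X i @^-1` A))).
pose m2h : {measure set without -> \bar R} :=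
  mscale r (pushforward P forget).
pose m2 := m2h measurable_forget.
have PXA : P (X i @^-1` A) = (r%:num)%:E.
  by rewrite /r/= fineK// fin_num_measure.
(* m1 and m2 are the two sides, as measures on the smaller sigma-algebra. *)
rewrite setIC PXA; transitivity (m1 B); first by [].
transitivity (m2 B); last by [].
apply: (@measure_unique _ R without cylinders_without (fun=> setT) erefl
  cylinders_without_setI _ _ m1 m2) => //.
- move=> _; exists ([::], fun=> setT) => /=; first by split.
  by apply/seteqP; split => t.
- by rewrite bigcup_const//; exists 0%N.
- move=> _ [[J F] /= [uJ iJ mF] ->].
  rewrite /m1 /m2 /= /mscale /pushforward /mrestr /= -PXA.
  have uiJ : uniq (i :: J) by rewrite /= iJ.
  pose G j := if j == i then A else F j.
  have GF j : j \in J -> G j = F j.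
    by rewrite /G; case: eqP => // -> jJ; rewrite jJ in iJ.
  have := X_indep (A := G) uiJ.
  have Gi : G i = A by rewrite /G eqxx.
  rewrite big_cons Gi.
  have -> : pushforward P forget (\bigcap_(j in [set` J]) X j @^-1` F j) =
    (\prod_(j <- J) P (X j @^-1` F j))%E by rewrite -X_indep.
  rewrite (_ : (\prod_(j <- J) P (X j @^-1` G j))%E =
               (\prod_(j <- J) P (X j @^-1` F j))%E); last first.
    by apply: eq_big_seq => j /GF ->.
  move=> <-; last by move=> j; rewrite /G; case: eqP.
  congr (P _); apply/seteqP; split => t /=.
    move=> [tJ tA] j /=; rewrite inE /G; case: eqP => [-> _ //|_ /= jJ].
    exact: tJ.
  move=> tJ; split; last by have := tJ i; rewrite /= inE /G eqxx; exact.
  by move=> j /= jJ; rewrite -GF//; apply: tJ; rewrite /= inE jJ orbT.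
- move=> _; rewrite /m1/= /pushforward /mrestr /=.
  by rewrite preimage_setT setTI (le_lt_trans (probability_le1 _ mXA))// ltry.
Qed.

Definition observe (t : T) : T' * without := (X i t, t).

Lemma measurable_observe : measurable_fun [set: T] observe.
Proof.
apply/measurable_fun_pairP; split; last exact: measurable_forget.
exact: (measurable_funP (X i)).
Qed.

HB.instance Definition _ := isMeasurableFun.Build _ _ _ _ observe measurable_observe.

(** Fubini for the product structure provided by independence. *)
Lemma mean_integrate_out (H : T' * without -> R) : bounded_measurable H ->
  mean P (fun t => H (X i t, t)) =
  mean P (fun t => mean (distribution P (X i)) (fun x => H (x, t))).
Proof.
move=> hH; rewrite {1}/mean /Rintegral.
pose m1 := distribution P (X i); pose m2 := distribution P forget.
have HE (m : probability (T' * without)%type R) :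
    m.-integrable setT (EFin \o H) by exact: bounded_measurable_integrable.
have mH : measurable_fun setT (EFin \o H).
  by apply/measurable_EFinP; case: hH.
have mHo : bounded_measurable (H \o observe).
  by case: hH => mH' [M HM]; split; [exact: measurableT_comp|exists M => t; exact: HM].
transitivity (fine (\int[distribution P observe]_z (EFin \o H) z)).
  by rewrite integral_distribution//; exact: bounded_measurable_integrable.
rewrite -(@eq_measure_integral _ _ _ _ _ (m1 \x m2)%E); last first.
  move=> A mA _.
  apply: (@product_measure_unique _ _ T' without R m1 m2 (distribution P observe)) => //.
  by move=> B C mB mC; exact: independent_without.
have i12 : (m1 \x m2)%E.-integrable setT (EFin \o H).
  exact: HE (m1 \x m2)%E.
rewrite -(integral21_prod_meas1 i12) /fubini_G.
rewrite /mean /Rintegral; congr fine.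
have hHt (t : without) : bounded_measurable (fun x => H (x, t)).
  case: hH => mH' [M HM]; split; last by exists M.
  exact: measurableT_comp mH' (pair2_measurable t).
have bG : bounded_measurable (fun t : without => mean m1 (fun x => H (x, t))).
  split; last first.
    by case: (hH) => _ [M HM]; exists M => t; apply: normr_mean_le.
  apply/measurable_EFinP.
  rewrite (_ : _ \o _ = fubini_G m1 (EFin \o H)).
    exact: measurable_fubini_G i12.
  by apply/funext => t; rewrite /= -mean_EFin.
transitivity (\int[m2]_t (mean m1 (fun x => H (x, t)))%:E)%E.
  by apply: eq_integral => t _; exact: mean_EFin (hHt t).
rewrite integral_distribution//.
- by case: bG => mG _; exact/measurable_EFinP.
- by apply: bounded_measurable_integrable; exact: bounded_measurable_without.
Qed.

End integrate_out.

(** * Grades: scores and pairwise comparisons *)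

Section grades.
Context d (T : measurableType d) (R : realType) (P : probability T R) (K : nat).
Variable X : nat -> {RV P >-> K.-tuple R}.
Hypothesis X_iid : iid P X.
Hypothesis F_continuous : forall k : 'I_K, continuous (marginal_cdf P (X 0%N) k).

Local Notation E := (mean P).
Local Notation F := (marginal_cdf P (X 0%N)).

Let X_indep : mutually_independent P X. Proof. by case: X_iid. Qed.

Lemma mean_distribution i (f : K.-tuple R -> R) : bounded_measurable f ->
  mean (distribution P (X i)) f = E (f \o X 0%N).
Proof.
move=> hf; have mf : measurable_fun setT (EFin \o f).
  by apply/measurable_EFinP; case: hf.
have hfX : bounded_measurable (f \o X 0%N).
  by case: hf => mf' [M fM]; split; [exact: measurableT_comp|exists M => t; exact: fM].
rewrite /mean /Rintegral; congr fine.
transitivity (\int[distribution P (X 0%N)]_x (f x)%:E)%E; last first.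
  by rewrite integral_distribution//; exact: bounded_measurable_integrable.
by apply: eq_measure_integral => A mA _; case: X_iid => _; exact.
Qed.

Lemma measurable_tnthk d0 (S : measurableType d0) (f : S -> K.-tuple R) k :
  measurable_fun setT f -> measurable_fun setT (fun s => tnth (f s) k).
Proof. by move=> mf; exact: measurableT_comp (measurable_tnth k) mf. Qed.

Lemma marginal_cdf_ge0 k c : 0 <= F k c.
Proof. by rewrite /marginal_cdf fine_ge0//; exact: cdf_ge0. Qed.

Lemma marginal_cdf_le1 k c : F k c <= 1.
Proof.
by rewrite /marginal_cdf -[leRHS]/(fine 1%E) fine_le ?cdf_le1// fin_num_measure.
Qed.

Lemma measurable_marginal_cdf k : measurable_fun setT (F k).
Proof. exact: measurableT_comp (cdf_measurable _). Qed.

Lemma mean_coord_le k c : E (fun t => (tnth (X 0%N t) k <= c)%R%:R) = F k c.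
Proof.
apply: EFin_inj; rewrite mean_bool; last first.
  by apply: measurable_fun_ler => //; apply: measurable_tnthk; exact: measurable_funP.
by rewrite /marginal_cdf fineK ?fin_num_measure// /cdf /distribution /pushforward.
Qed.

(** A continuous marginal has no atoms, so weak and strict comparisons have the
    same probability. *)
Lemma mean_coord_ge k c : E (fun t => (c <= tnth (X 0%N t) k)%R%:R) = 1 - F k c.
Proof.
have mX : measurable_fun setT (fun t => tnth (X 0%N t) k).
  by apply: measurable_tnthk; exact: measurable_funP.
have blt : bounded_measurable (fun t => (tnth (X 0%N t) k < c)%R%:R : R).
  by apply: bounded_measurable_bool; exact: measurable_fun_ltr.
have ble c' : bounded_measurable (fun t => (tnth (X 0%N t) k <= c')%R%:R : R).
  exact: bounded_measurable_le.
rewrite (@eq_mean _ _ _ _ _ (fun t => 1 - (tnth (X 0%N t) k < c)%R%:R)); last first.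
  by move=> t; rewrite leNgt; case: (_ < _); rewrite ?subrr ?subr0.
rewrite meanB//; last exact: bounded_measurable_cst.
rewrite mean_cst; congr (_ - _).
apply/eqP; rewrite eq_le; apply/andP; split.
  rewrite -mean_coord_le; apply: le_mean => // t.
  by rewrite ler_nat; case: ltP => // /ltW ->.
rewrite leNgt; apply/negP => Elt.
have : \forall y \near c, E (fun t => (tnth (X 0%N t) k < c)%R%:R) < F k y.
  by have := @F_continuous k c => /cvgr_gt; exact.
move=> /nbhs_ballP[e /= e0 /(_ (c - e / 2))]; rewrite /ball/= opprB addrC subrK.
rewrite gtr0_norm ?divr_gt0// ltr_pdivrMr// ltr_pMr// ltr1n => /(_ isT).
apply/negP; rewrite -leNgt -mean_coord_le; apply: le_mean => // t.
rewrite ler_nat; have [cX|cX] := ltP (tnth (X 0%N t) k) c; first exact: leq_b1.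
by rewrite leNgt (lt_le_trans _ cX)// gtrBl divr_gt0.
Qed.

Definition compare k i j t : R := (tnth (X i t) k <= tnth (X j t) k)%R%:R.

Definition grade k i t : R := F k (tnth (X i t) k).

Lemma grade_bounds k i t : 0 <= grade k i t <= 1.
Proof. by rewrite marginal_cdf_ge0 marginal_cdf_le1. Qed.

Lemma bounded_measurable_F k d0 (S : measurableType d0) (f : S -> K.-tuple R) :
  measurable_fun setT f -> bounded_measurable (fun s => F k (tnth (f s) k)).
Proof.
move=> mf; split.
  by apply: measurableT_comp (measurable_marginal_cdf k) _; exact: measurable_tnthk.
exists 1 => s; rewrite ger0_norm ?marginal_cdf_ge0//; exact: marginal_cdf_le1.
Qed.

Lemma bounded_measurable_grade k i : bounded_measurable (grade k i).
Proof. by apply: bounded_measurable_F; exact: measurable_funP. Qed.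

Lemma bounded_measurable_compare k i j : bounded_measurable (compare k i j).
Proof.
by apply: bounded_measurable_le; apply: measurable_tnthk; exact: measurable_funP.
Qed.

Section without.
Variables (i : nat) (g : T -> R).
Hypothesis hg : bounded_measurable (g : without X i -> R).

Let hg2 : bounded_measurable (fun z : K.-tuple R * without X i => g z.2).
Proof.
case: hg => mg [M gM]; split; last by exists M => z; exact: gM.
exact: measurableT_comp.
Qed.

Lemma mean_factor (f : K.-tuple R -> R) : bounded_measurable f ->
  E (fun t => f (X i t) * g t) = E (f \o X 0%N) * E g.
Proof.
move=> hf; have hf1 : bounded_measurable (fun z : K.-tuple R * without X i => f z.1).
  by case: hf => mf [M fM]; split; [exact: measurableT_comp|exists M => z; exact: fM].
have := mean_integrate_out X_indep (bounded_measurableM hf1 hg2).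
move=> /= ->; rewrite -meanZ; last exact: bounded_measurable_without hg.
apply: eq_mean => t; rewrite -(mean_distribution i hf) mulrC -meanZ//.
by apply: eq_mean => x; rewrite mulrC.
Qed.

(** The two projections of a comparison, obtained by integrating out the smaller
    or the larger observation; g is any function of the other observations. *)
Lemma mean_compare_lower k j : j != i ->
  E (fun t => compare k i j t * g t) = E (fun t => grade k j t * g t).
Proof.
move=> ji.
have mXj : measurable_fun setT (fun z : K.-tuple R * without X i => X j z.2).
  apply: (measurableT_comp (f := X j : without X i -> _)) => //.
  exact: measurable_without.
have h1 : bounded_measurable (fun z : K.-tuple R * without X i =>
    (tnth z.1 k <= tnth (X j z.2) k)%R%:R : R).
  by apply: bounded_measurable_le; exact: measurable_tnthk.
have := mean_integrate_out X_indep (bounded_measurableM h1 hg2).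
move=> /= ->; apply: eq_mean => t.
have h0 : bounded_measurable (fun x : K.-tuple R =>
    (tnth x k <= tnth (X j t) k)%R%:R : R).
  by apply: bounded_measurable_le => //; exact: measurable_tnthk.
rewrite /grade -mean_coord_le -(mean_distribution i h0) mulrC -meanZ//.
by apply: eq_mean => x; rewrite mulrC.
Qed.

Lemma mean_compare_upper k j : j != i ->
  E (fun t => compare k j i t * g t) = E (fun t => (1 - grade k j t) * g t).
Proof.
move=> ji.
have mXj : measurable_fun setT (fun z : K.-tuple R * without X i => X j z.2).
  apply: (measurableT_comp (f := X j : without X i -> _)) => //.
  exact: measurable_without.
have h1 : bounded_measurable (fun z : K.-tuple R * without X i =>
    (tnth (X j z.2) k <= tnth z.1 k)%R%:R : R).
  by apply: bounded_measurable_le; exact: measurable_tnthk.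
have := mean_integrate_out X_indep (bounded_measurableM h1 hg2).
move=> /= ->; apply: eq_mean => t.
have h0 : bounded_measurable (fun x : K.-tuple R =>
    (tnth (X j t) k <= tnth x k)%R%:R : R).
  by apply: bounded_measurable_le => //; exact: measurable_tnthk.
rewrite /grade -mean_coord_ge -(mean_distribution i h0) mulrC -meanZ//.
by apply: eq_mean => x; rewrite mulrC.
Qed.

End without.

Lemma bounded_measurable_without_grade k i j : j != i ->
  bounded_measurable (grade k j : without X i -> R).
Proof. by move=> ji; apply: bounded_measurable_F; exact: measurable_without. Qed.

Lemma bounded_measurable_without_compare k i j j' : j != i -> j' != i ->
  bounded_measurable (compare k j j' : without X i -> R).
Proof.
by move=> ji j'i; apply: bounded_measurable_le; apply: measurable_tnthk;
  exact: measurable_without.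
Qed.

Let bcst i (a : R) : bounded_measurable (fun _ : without X i => a).
Proof. exact: bounded_measurable_cst. Qed.

(** Integrating X 0 <= X 1 first over X 0 and then over X 1 gives the mean grade
    and its complement. *)
Lemma mean_grade0 k : E (grade k 0) = 1 / 2.
Proof.
have := mean_factor (bcst 1 1) (f := fun x => F k (tnth x k)).
move=> /(_ (bounded_measurable_F k (@measurable_id _ _ _))).
rewrite mean_cst mulr1 => E10.
have := @mean_compare_lower _ _ (bcst 0 1) k 1%N isT.
rewrite (mean_compare_upper (bcst 1 1))//.
under eq_mean do rewrite mulr1.
under [RHS]eq_mean do rewrite mulr1.
rewrite meanB ?mean_cst; [|exact: bounded_measurable_cst|exact: bounded_measurable_grade].
have -> : E (grade k 1) = E (grade k 0).
  by rewrite -[RHS]E10; apply: eq_mean => t; rewrite mulr1.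
lra.
Qed.

(** Normalized so that the covariance matrix of the scores is grade_cov. *)
Definition score k (x : K.-tuple R) : R := 2 * (F k (tnth x k) - 1 / 2).

Lemma normr_score k x : `|score k x| <= 1.
Proof.
have := marginal_cdf_ge0 k (tnth x k); have := marginal_cdf_le1 k (tnth x k).
by rewrite /score ler_norml => ? ?; apply/andP; split; lra.
Qed.

Lemma bounded_measurable_score_comp d0 (S : measurableType d0) k
    (f : S -> K.-tuple R) : measurable_fun setT f ->
  bounded_measurable (fun s => score k (f s)).
Proof.
move=> mf; apply: bounded_measurableZ; apply: bounded_measurableB.
  exact: bounded_measurable_F.
exact: bounded_measurable_cst.
Qed.

Lemma bounded_measurable_score k i : bounded_measurable (fun t => score k (X i t)).
Proof. by apply: bounded_measurable_score_comp; exact: measurable_funP. Qed.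

Lemma mean_score_factor i (g : T -> R) k :
  bounded_measurable (g : without X i -> R) ->
  E (fun t => score k (X i t) * g t) = 0.
Proof.
move=> hg; rewrite (mean_factor hg (f := score k)); last first.
  exact: bounded_measurable_score_comp.
rewrite /= (_ : E _ = 0) ?mul0r// /comp /score meanZ; last first.
  by apply: bounded_measurableB; [exact: bounded_measurable_grade|exact: bounded_measurable_cst].
rewrite meanB; [|exact: bounded_measurable_grade|exact: bounded_measurable_cst].
by rewrite mean_cst mean_grade0 subrr mulr0.
Qed.

Lemma mean_score2 k k' :
  E (fun t => score k (X 0%N t) * score k' (X 0%N t)) =
  grade_cov P (X 0%N) k k'.
Proof.
rewrite mxE covariance.unlock.
have Eg k0 : ('E_P[marginal_cdf P (X 0%N) k0 \o Defs.coord (X 0%N) k0] = (1 / 2)%:E)%E.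
  rewrite expectation.unlock -(mean_grade0 k0) -mean_EFin//; exact: bounded_measurable_grade.
rewrite (_ : fine _ = E (fun t => (grade k 0 t - 1 / 2) * (grade k' 0 t - 1 / 2))).
  rewrite -meanZ.
    by apply: eq_mean => t; rewrite /score /grade; ring.
  by apply: bounded_measurableM; apply: bounded_measurableB;
    [exact: bounded_measurable_grade|exact: bounded_measurable_cst|
     exact: bounded_measurable_grade|exact: bounded_measurable_cst].
by rewrite !Eg expectation.unlock.
Qed.

Lemma mean_score2_factor i (g : T -> R) k k' :
  bounded_measurable (g : without X i -> R) ->
  E (fun t => score k (X i t) * score k' (X i t) * g t) =
  grade_cov P (X 0%N) k k' * E g.
Proof.
move=> hg; rewrite (mean_factor hg (f := fun x => score k x * score k' x)); last first.
  by apply: bounded_measurableM; exact: bounded_measurable_score_comp.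
by rewrite -mean_score2.
Qed.

End grades.

(** * Second moments of sums of scores and comparisons *)

Lemma sum_pred1_uniq (R : realDomainType) (I : eqType) (r : seq I) (i : I) (c : R) :
  uniq r -> 0 <= c -> \sum_(j <- r) (if j == i then c else 0) <= c.
Proof.
move=> ur c0; case: (boolP (i \in r)) => ir.
  rewrite (bigD1_seq i)//= eqxx big1 ?addr0// => j /negbTE ->; exact: erefl.
rewrite big1_seq// => j /= jr; case: eqP => // ji; by rewrite -ji jr in ir.
Qed.

Lemma mean_sqr_sum_orthogonal d (T : measurableType d) (R : realType)
    (P : probability T R) (I : eqType) (r : seq I) (F : I -> T -> R) (c : I -> R) :
  uniq r -> (forall i, bounded_measurable (F i)) ->
  (forall i j, i != j -> mean P (fun t => F i t * F j t) = 0) ->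
  (forall i, mean P (fun t => F i t ^+ 2) <= c i) ->
  mean P (fun t => (\sum_(i <- r) F i t) ^+ 2) <= \sum_(i <- r) c i.
Proof.
move=> ur hF F0 Fc.
have c0 i : 0 <= c i by apply: le_trans (Fc i); apply: mean_ge0 => t; exact: sqr_ge0.
apply: (@le_trans _ _ (\sum_(i <- r) \sum_(j <- r) (if j == i then c i else 0))).
  apply: mean_sqr_sum_le => // i j; case: eqP => [->|/eqP ji].
    by apply: le_trans (Fc i); rewrite le_eqVlt; apply/orP; left; apply/eqP;
      apply: eq_mean => t; rewrite expr2.
  by rewrite F0// eq_sym.
by apply: ler_sum => i _; exact: sum_pred1_uniq.
Qed.

Section moments.
Context d (T : measurableType d) (R : realType) (P : probability T R) (K : nat).
Variable X : nat -> {RV P >-> K.-tuple R}.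
Hypothesis X_iid : iid P X.
Hypothesis F_continuous : forall k : 'I_K, continuous (marginal_cdf P (X 0%N) k).

Local Notation E := (mean P).
Local Notation Sigma := (grade_cov P (X 0%N)).
Local Notation score := (score X).
Local Notation grade := (grade X).

(** The remainder of the comparison of two observations once its projections on
    functions of a single observation are removed. *)
Definition degenerate k i j t : R :=
  if i == j then 0 else
  compare X k i j t - 1 / 2 - grade k j t + grade k i t.

Lemma bounded_measurable_degenerate k i j : bounded_measurable (degenerate k i j).
Proof.
rewrite /degenerate; case: eqP => _; first exact: bounded_measurable_cst.
apply: bounded_measurableD; last exact: bounded_measurable_grade.
apply: bounded_measurableB; last exact: bounded_measurable_grade.
apply: bounded_measurableB; last exact: bounded_measurable_cst.
exact: bounded_measurable_compare.
Qed.

Lemma bounded_measurable_without_degenerate l k i j : i != l -> j != l ->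
  bounded_measurable (degenerate k i j : without X l -> R).
Proof.
move=> il jl; rewrite /degenerate; case: eqP => _; first exact: bounded_measurable_cst.
apply: bounded_measurableD; last exact: bounded_measurable_without_grade.
apply: bounded_measurableB; last exact: bounded_measurable_without_grade.
apply: bounded_measurableB; last exact: bounded_measurable_cst.
exact: bounded_measurable_without_compare.
Qed.

Lemma bounded_measurable_without_score l k i : i != l ->
  bounded_measurable ((fun t => score k (X i t)) : without X l -> R).
Proof. by move=> il; apply: bounded_measurable_score_comp; exact: measurable_without. Qed.

Lemma normr_degenerate k i j t : `|degenerate k i j t| <= 3 / 2.
Proof.
rewrite /degenerate; case: eqP => _; first by rewrite normr0; lra.
have /andP[? ?] := grade_bounds X k i t; have /andP[? ?] := grade_bounds X k j t.
by rewrite /compare ler_norml; case: (tnth _ _ <= _) => /=; apply/andP; split; lra.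
Qed.

(** Degeneracy: integrating out either of the two observations gives zero. *)
Lemma mean_degenerate_lower k i j g : bounded_measurable (g : without X i -> R) ->
  E (fun t => degenerate k i j t * g t) = 0.
Proof.
move=> hg; have hgT := bounded_measurable_without hg.
case: (eqVneq i j) => [<-|ij].
  by rewrite (@eq_mean _ _ _ _ _ (fun=> 0)) ?mean_cst// => t; rewrite /degenerate eqxx mul0r.
rewrite (@eq_mean _ _ _ _ _ (fun t => compare X k i j t * g t - grade k j t * g t
    + 1 / 2 * (score k (X i t) * g t))); last first.
  by move=> t; rewrite /degenerate (negbTE ij) /score /grade; lra.
have h1 := bounded_measurableM (bounded_measurable_compare X k i j) hgT.
have h2 := bounded_measurableM (bounded_measurable_grade X k j) hgT.
have h3 := bounded_measurableM (bounded_measurable_score X k i) hgT.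
rewrite meanD; [|exact: bounded_measurableB|exact: bounded_measurableZ].
rewrite meanB// meanZ// mean_score_factor//.
by rewrite (mean_compare_lower X_iid hg) 1?eq_sym// subrr mulr0 addr0.
Qed.

Lemma mean_degenerate_upper k i j g : bounded_measurable (g : without X j -> R) ->
  E (fun t => degenerate k i j t * g t) = 0.
Proof.
move=> hg; have hgT := bounded_measurable_without hg.
case: (eqVneq i j) => [<-|ij].
  by rewrite (@eq_mean _ _ _ _ _ (fun=> 0)) ?mean_cst// => t; rewrite /degenerate eqxx mul0r.
rewrite (@eq_mean _ _ _ _ _ (fun t => compare X k i j t * g t - (1 - grade k i t) * g t
    - 1 / 2 * (score k (X j t) * g t))); last first.
  by move=> t; rewrite /degenerate (negbTE ij) /score /grade; lra.
have h1 := bounded_measurableM (bounded_measurable_compare X k i j) hgT.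
have h2 : bounded_measurable (fun t => (1 - grade k i t) * g t).
  apply: bounded_measurableM hgT; apply: bounded_measurableB.
    exact: bounded_measurable_cst.
  exact: bounded_measurable_grade.
have h3 := bounded_measurableM (bounded_measurable_score X k j) hgT.
rewrite meanB; [|exact: bounded_measurableB|exact: bounded_measurableZ].
rewrite meanB// meanZ// mean_score_factor//.
by rewrite (mean_compare_upper X_iid F_continuous hg)// subrr mulr0 subr0.
Qed.

(** Two terms are uncorrelated unless they involve the same two observations, in
    either order, so the mean square is of the order of the number of terms. *)
Lemma mean_sqr_degenerate k (r : seq (nat * nat)) : uniq r ->
  E (fun t => (\sum_(p <- r) degenerate k p.1 p.2 t) ^+ 2) <= 9 / 2 * (size r)%:R.
Proof.
move=> ur; pose c (p q : nat * nat) : R :=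
  (if q == p then 9 / 4 else 0) + (if q == (p.2, p.1) then 9 / 4 else 0).
have c0 p q : 0 <= c p q by rewrite /c; case: eqP; case: eqP => _ _; lra.
apply: (@le_trans _ _ (\sum_(p <- r) \sum_(q <- r) c p q)); last first.
  rewrite -[(size r)%:R]mulr1n -[leRHS]mulrA.
  apply: (@le_trans _ _ (\sum_(p <- r) (9 / 2))).
    apply: ler_sum => p _; rewrite big_split/=.
    by rewrite (_ : 9 / 2 = 9 / 4 + 9 / 4 :> R) ?lerD ?sum_pred1_uniq//; lra.
  by rewrite big_const_seq count_predT iter_addr_0 -mulr_natr; lra.
apply: mean_sqr_sum_le => [p|[i j] [a b]/=]; first exact: bounded_measurable_degenerate.
(* If one of i and j is not among a and b, it can be integrated out. *)
have [/eqP ia|ia] := boolP (i \in [:: a; b]); last first.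
  rewrite mean_degenerate_lower//; apply: bounded_measurable_without_degenerate.
    by move: ia; rewrite !inE negb_or => /andP[]; rewrite eq_sym.
  by move: ia; rewrite !inE negb_or => /andP[_]; rewrite eq_sym.
have [/eqP ja|ja] := boolP (j \in [:: a; b]); last first.
  rewrite mean_degenerate_upper//; apply: bounded_measurable_without_degenerate.
    by move: ja; rewrite !inE negb_or => /andP[]; rewrite eq_sym.
  by move: ja; rewrite !inE negb_or => /andP[_]; rewrite eq_sym.
have [ij|ij] := eqVneq i j.
  rewrite (@eq_mean _ _ _ _ _ (fun=> 0)) ?mean_cst// => t.
  by rewrite /degenerate ij eqxx mul0r.
have hM := bounded_measurableM (bounded_measurable_degenerate k i j)
  (bounded_measurable_degenerate k a b).
apply: (@le_trans _ _ (9 / 4)).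
  apply: le_trans (ler_norm _) _; apply: normr_mean_le => // t.
  rewrite normrM (_ : 9 / 4 = 3 / 2 * (3 / 2) :> R); last by lra.
  by apply: ler_pM => //; exact: normr_degenerate.
suff : ((a, b) == (i, j)) || ((a, b) == (j, i)).
  by rewrite /c /= => /orP[] ->; case: ifP => _; lra.
move: ia ja ij; rewrite !inE !xpair_eqE.
by move=> /eqP/orP[]/eqP -> /eqP/orP[]/eqP ->; rewrite ?eqxx//= ?orbT.
Qed.

Lemma normr_Sigma k k' : `|Sigma k k'| <= 1.
Proof.
rewrite -(mean_score2 X_iid F_continuous); apply: normr_mean_le.
  by apply: bounded_measurableM; exact: bounded_measurable_score.
by move=> t; rewrite normrM -[leRHS]mulr1 ler_pM// normr_score.
Qed.

Lemma mean_sqr_score k (r : seq nat) (a : nat -> R) : uniq r ->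
  E (fun t => (\sum_(j <- r) a j * score k (X j t)) ^+ 2) <= \sum_(j <- r) a j ^+ 2.
Proof.
move=> ur; apply: mean_sqr_sum_orthogonal => //.
- by move=> j; apply: bounded_measurableZ; exact: bounded_measurable_score.
- move=> i j ij.
  rewrite (@eq_mean _ _ _ _ _ (fun t => score k (X i t) * (a i * a j * score k (X j t)))).
    rewrite mean_score_factor//; apply: bounded_measurableZ.
    by apply: bounded_measurable_without_score; rewrite eq_sym.
  by move=> t; ring.
- move=> j; apply: le_trans (ler_norm _) _; apply: normr_mean_le.
    by apply: bounded_measurableX; apply: bounded_measurableZ; exact: bounded_measurable_score.
  move=> t /=; rewrite exprMn ger0_norm; last by apply: mulr_ge0; exact: sqr_ge0.
  rewrite ler_piMr ?sqr_ge0//.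
  by rewrite -[leRHS](expr1n _ 2) -real_normK ?num_real// lerXn2r ?nnegrE// normr_score.
Qed.

Lemma mean_sqr_score2 k k' n :
  E (fun t => (\sum_(j <- iota 0 n)
    (score k (X j t) * score k' (X j t) - Sigma k k')) ^+ 2) <= 4 * n%:R.
Proof.
have hF j : bounded_measurable (fun t => score k (X j t) * score k' (X j t) - Sigma k k').
  apply: bounded_measurableB; last exact: bounded_measurable_cst.
  by apply: bounded_measurableM; exact: bounded_measurable_score.
apply: (@le_trans _ _ (\sum_(j <- iota 0 n) 4)); last first.
  by rewrite big_const_seq count_predT size_iota iter_addr_0 mulr_natr.
apply: mean_sqr_sum_orthogonal => //; first exact: iota_uniq.
- move=> i j ij; pose g t := score k (X j t) * score k' (X j t) - Sigma k k'.
  have hg : bounded_measurable (g : without X i -> R).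
    apply: bounded_measurableB; last exact: bounded_measurable_cst.
    by apply: bounded_measurableM; apply: bounded_measurable_without_score; rewrite eq_sym.
  have hgT := bounded_measurable_without hg.
  rewrite (@eq_mean _ _ _ _ _ (fun t => score k (X i t) * score k' (X i t) * g t
      - Sigma k k' * g t)); last by move=> t; rewrite -/(g t); ring.
  rewrite meanB ?meanZ//.
  + by rewrite mean_score2_factor// subrr.
  + apply: bounded_measurableM => //.
    by apply: bounded_measurableM; exact: bounded_measurable_score.
  + exact: bounded_measurableZ.
- move=> j; apply: le_trans (ler_norm _) _; apply: normr_mean_le.
    exact: bounded_measurableX.
  move=> t; rewrite normrX (_ : 4 = 2 ^+ 2 :> R); last by ring.
  rewrite lerXn2r ?nnegrE// (le_trans (ler_normB _ _))// (_ : 2 = 1 * 1 + 1 :> R); last by ring.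
  by rewrite lerD ?normr_Sigma// normrM ler_pM// normr_score.
Qed.

(** Given X i, the summands are centred and independent. *)
Lemma mean_sqr_compare k i n :
  E (fun t => (\sum_(j <- iota 0 n) (compare X k j i t - grade k i t)) ^+ 2) <= n%:R.
Proof.
have hF j : bounded_measurable (fun t => compare X k j i t - grade k i t).
  by apply: bounded_measurableB;
    [exact: bounded_measurable_compare|exact: bounded_measurable_grade].
have F0 j j' : j != j' -> j != i ->
    E (fun t => (compare X k j i t - grade k i t) *
                (compare X k j' i t - grade k i t)) = 0.
  move=> jj' ji; pose g t := compare X k j' i t - grade k i t.
  have hg : bounded_measurable (g : without X j -> R).
    by apply: bounded_measurableB; [apply: bounded_measurable_without_compare|
      apply: bounded_measurable_without_grade]; rewrite eq_sym.
  have hgT := bounded_measurable_without hg.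
  rewrite (@eq_mean _ _ _ _ _ (fun t => compare X k j i t * g t - grade k i t * g t)).
    rewrite meanB; last 2 first.
    - by apply: bounded_measurableM => //; exact: bounded_measurable_compare.
    - by apply: bounded_measurableM => //; exact: bounded_measurable_grade.
    by rewrite (mean_compare_lower X_iid hg) 1?eq_sym// subrr.
  by move=> t; rewrite -/(g t); ring.
apply: (@le_trans _ _ (\sum_(j <- iota 0 n) 1)); last first.
  by rewrite big_const_seq count_predT size_iota iter_addr_0.
apply: mean_sqr_sum_orthogonal => //; first exact: iota_uniq.
- move=> j j' jj'; have [ji|] := eqVneq j i; last exact: F0.
  rewrite eq_sym in jj'; rewrite -[RHS](F0 j' j jj'); last by rewrite -ji.
  by apply: eq_mean => t; rewrite mulrC.
- move=> j; apply: le_trans (ler_norm _) _; apply: normr_mean_le.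
    exact: bounded_measurableX.
  move=> t; rewrite normrX -[leRHS](expr1n _ 2) lerXn2r ?nnegrE//.
  have /andP[? ?] := grade_bounds X k i t.
  by rewrite /compare ler_norml; case: (tnth _ _ <= _) => /=; apply/andP; split; lra.
Qed.

End moments.

(** * Taylor estimates *)

Section taylor.
Context (R : realType).
Implicit Types x y : R.

Lemma normr_expRB1 x : `|expR x - 1| <= `|x| * expR `|x|.
Proof.
have h1 := expR_ge1Dx x; have h2 := expR_ge1Dx (- x).
have e0 := expR_gt0 x; have h3 : expR x * (1 - x) <= 1.
  by rewrite -[leRHS](expRxMexpNx_1 x) ler_pM2l.
have [x0|x0] := leP 0 x.
  by rewrite (ger0_norm x0) ger0_norm; lra.
rewrite (ltr0_norm x0) ler0_norm; last by rewrite subr_le0 -[leRHS]expR0 ler_expR ltW.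
have h5 : 1 <= expR (- x) by rewrite -[leLHS]expR0 ler_expR; lra.
nra.
Qed.

Lemma normr_expRB1D x : `|expR x - 1 - x| <= `|x| ^+ 2 * expR `|x|.
Proof.
have h1 := expR_ge1Dx x; have h2 := expR_ge1Dx (- x).
have e0 := expR_gt0 x; have h3 : expR x * (1 - x) <= 1.
  by rewrite -[leRHS](expRxMexpNx_1 x) ler_pM2l.
have h4 := normr_expRB1 x.
rewrite ger0_norm; last by lra.
apply: (@le_trans _ _ (`|x| * `|expR x - 1|)).
  by rewrite -normrM; apply: le_trans _ (ler_norm _); lra.
by rewrite expr2 -mulrA ler_wpM2l.
Qed.

Lemma normr_expRB1D2 x :
  `|expR x - 1 - x - x ^+ 2 / 2| <= `|x| ^+ 3 * expR `|x|.
Proof.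
pose f y := expR y - 1 - y - y ^+ 2 / 2 : R.
pose f' y := expR y - 1 - y : R.
have df y : is_derive y 1 (f : R -> R) (f' y).
  pose p : {poly R} := 1%:P + 'X + 2^-1 *: 'X^2.
  have -> : f = expR - horner p.
    apply/funext => z; rewrite /f /p /= -[RHS]/(expR z - (1%:P + 'X + 2^-1 *: 'X^2).[z]).
    by rewrite hornerD hornerD hornerZ hornerX hornerC hornerXn; field.
  have := @is_deriveB R R^o R^o expR (horner p) y 1 _ _ (is_derive_expR y)
    (is_derive_poly p y).
  move=> /trigger_derive; apply.
  rewrite /f' /p !derivD derivC derivX derivZ derivXn/= expr1.
  by rewrite !hornerD hornerC hornerZ hornerMn hornerX hornerC; field.
have cf : continuous f.
  by move=> y; apply: differentiable_continuous; apply/derivable1_diffP; have [] := df y.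
have f0 : f 0 = 0 by rewrite /f expR0; lra.
have bnd y : `|y| <= `|x| -> `|f' y| <= `|x| ^+ 2 * expR `|x|.
  move=> yx; apply: le_trans (normr_expRB1D y) _.
  by rewrite ler_pM ?exprn_ge0 ?expR_ge0 ?ler_expR// lerXn2r ?nnegrE.
have -> : expR x - 1 - x - x ^+ 2 / 2 = f x by [].
have [x0|x0] := leP 0 x.
  have [c] := MVT_segment x0 (fun z _ => df z) (continuous_subspaceT cf).
  rewrite in_itv/= f0 !subr0 => /andP[c0 cx] ->.
  rewrite normrM exprSr mulrAC ler_wpM2r// bnd//.
  by rewrite !ger0_norm// (le_trans c0).
have [c] := MVT_segment (ltW x0) (fun z _ => df z) (continuous_subspaceT cf).
rewrite in_itv/= f0 !sub0r => /andP[cx c0] /eqP; rewrite eqr_oppLR => /eqP ->.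
rewrite normrN normrM normrN exprSr mulrAC ler_wpM2r// bnd//.
by rewrite !ler0_norm ?(ltW x0)// lerN2.
Qed.

Lemma normr_ln1DB x : 0 <= x -> `|ln (1 + x) - x| <= x ^+ 2.
Proof.
move=> x0; have h1 : ln (1 + x) <= x by apply: le_ln1Dx; lra.
rewrite ler0_norm ?subr_le0// opprB.
have x1 : 0 < 1 + x by lra.
have h : - ln (1 + x) <= - (x / (1 + x)).
  rewrite -lnV ?posrE// [X in ln X](_ : _ = 1 + - (x / (1 + x))); last by field; lra.
  by apply: le_ln1Dx; rewrite ltrN2 ltr_pdivrMr//; lra.
have : x - x ^+ 2 <= x / (1 + x) by rewrite ler_pdivlMr//; nra.
lra.
Qed.

End taylor.

(** The Gaussian factor absorbs every polynomial and exponential in the square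
    root of its argument. *)
Lemma expR_absorb (R : realType) (lambda A s : R) : 0 < lambda -> 0 <= s ->
  expR (- lambda * s ^+ 2) * (1 + s) ^+ 4 * expR (A * (1 + s)) <=
  expR (A + (A + 4) ^+ 2 / (4 * lambda)).
Proof.
move=> l0 s0; apply: (@le_trans _ _ (expR (- lambda * s ^+ 2 + 4%:R * s + A * (1 + s)))).
  rewrite !expRD ler_wpM2r ?expR_ge0// ler_wpM2l ?expR_ge0// expRM_natl.
  by rewrite lerXn2r ?nnegrE ?expR_ge0 ?expR_ge1Dx//; lra.
rewrite ler_expR -subr_ge0.
rewrite (_ : _ - _ = (2 * lambda * s - (A + 4)) ^+ 2 / (4 * lambda)).
  by rewrite divr_ge0 ?sqr_ge0//; lra.
by field; lra.
Qed.


Section heat_step_scalar.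
Context (R : realType) (lambda : R).
Hypothesis lambda_gt0 : 0 < lambda.

Let l0 : 0 <= lambda. Proof. exact: ltW. Qed.

(** What a random increment does to the heat flow. The statistics x and y of the
    increment are linear and quadratic in it, and q is the squared length of its
    direction. *)
Lemma heat_forward (B : R) : 0 <= B ->
  exists2 C, 0 <= C & forall r q N x y : R,
    0 <= r -> r <= 1 -> 0 <= q -> q <= r ^+ 2 -> 0 <= N ->
    x ^+ 2 <= q * N * y -> 0 <= y -> y <= B ->
  expR (- lambda * N) *
    `| expR (- (2 * lambda * x + lambda * q * y))
       - (1 - 2 * lambda * x - lambda * q * y + 2 * lambda ^+ 2 * x ^+ 2) |
  <= C * r ^+ 3.
Proof.
move=> B0; pose b0 := 1 + B; have b01 : 1 <= b0 by rewrite /b0; lra.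
have b00 : 0 <= b0 := le_trans ler01 b01.
(* With g = 1 + sqrt N, the exponent is at most A r g in absolute value, and M
   bounds exp(- lambda N) g ^+ 4 exp(A g). *)
pose A := 3 * lambda * b0; have A0 : 0 <= A by rewrite !mulr_ge0.
pose M := expR (A + (A + 4) ^+ 2 / (4 * lambda)).
pose c3 := 3 * lambda ^+ 2 * b0 ^+ 2.
have c30 : 0 <= c3 by rewrite !mulr_ge0 ?exprn_ge0.
have M0 : 0 <= M := expR_ge0 _.
exists ((A ^+ 3 + c3) * M); first by rewrite mulr_ge0// addr_ge0// exprn_ge0.
move=> r q N x y r0 r1 q0 qr N0 xQ y0 yB.
pose s := Num.sqrt N; have s0 : 0 <= s by exact: sqrtr_ge0.
have sN : s ^+ 2 = N by rewrite sqr_sqrtr.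
pose g := 1 + s; have g1 : 1 <= g by rewrite /g lerDl.
have g0 : 0 <= g := le_trans ler01 g1.
have yb : y <= b0 by rewrite (le_trans yB)// /b0 lerDr.
have rg0 : 0 <= r * g by exact: mulr_ge0.
have r21 : r ^+ 2 <= r by rewrite expr2 ler_piMr.
have q_rg : q <= r * g by rewrite (le_trans qr)// (le_trans r21)// ler_peMr.
have xg : `|x| <= r * g * b0.
  rewrite -ler_sqr ?nnegrE//; last exact: mulr_ge0.
  rewrite real_normK ?num_real// (le_trans xQ)// !exprMn.
  apply: ler_pM => //; first exact: mulr_ge0.
    apply: ler_pM => //; rewrite -sN lerXn2r ?nnegrE// /g lerDr; exact: ler01.
  by rewrite (le_trans yb)// expr2 ler_peMr.
pose a := 2 * lambda * x + lambda * q * y.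
have ag : `|a| <= A * (r * g).
  apply: (le_trans (ler_normD _ _)).
  have -> : A * (r * g) = 2 * lambda * (r * g * b0) + lambda * (r * g) * b0.
    by rewrite /A; ring.
  have l20 : 0 <= 2 * lambda by exact: mulr_ge0.
  apply: lerD; first by rewrite normrM (ger0_norm l20) ler_wpM2l.
  have lq : 0 <= lambda * q by exact: mulr_ge0.
  rewrite ger0_norm; last exact: mulr_ge0.
  by apply: ler_pM => //; rewrite ler_wpM2l.
have g4 : 1 <= g ^+ 4 by rewrite exprn_ege1.
have g40 : 0 <= g ^+ 4 := le_trans ler01 g4.
have g34 : g ^+ 3 <= g ^+ 4 by rewrite [leRHS]exprSr ler_peMr// exprn_ge0.
have r3 : 0 <= r ^+ 3 by exact: exprn_ge0.
have e0 : 0 <= expR (- lambda * N) := expR_ge0 _.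
have e1 : expR (- lambda * N) * g ^+ 4 * expR `|a| <= M.
  apply: le_trans (expR_absorb A lambda_gt0 s0); rewrite sN ler_wpM2l//.
    exact: mulr_ge0.
  rewrite ler_expR (le_trans ag)// ler_wpM2l// -/g ler_piMl//.
have e3 : expR (- lambda * N) * g ^+ 4 <= M.
  by apply: le_trans e1; rewrite ler_peMr ?mulr_ge0// -expR0 ler_expR.
have t1 := normr_expRB1D2 (- a); rewrite normrN sqrrN in t1.
have h1 : `|a| ^+ 3 <= A ^+ 3 * r ^+ 3 * g ^+ 4.
  apply: (@le_trans _ _ ((A * (r * g)) ^+ 3)).
    by rewrite lerXn2r ?nnegrE// mulr_ge0.
  have -> : (A * (r * g)) ^+ 3 = A ^+ 3 * r ^+ 3 * g ^+ 3 by ring.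
  by apply: ler_wpM2l => //; apply: mulr_ge0 => //; exact: exprn_ge0.
pose rest := 2 * lambda ^+ 2 * x * q * y + lambda ^+ 2 * q ^+ 2 * y ^+ 2 / 2.
have h3 : `|rest| <= c3 * r ^+ 3 * g ^+ 4.
  have u0 : `|x| * (q * y) <= r ^+ 3 * g ^+ 4 * b0 ^+ 2.
    apply: (@le_trans _ _ (r * g * b0 * (r ^+ 2 * b0))).
      by apply: ler_pM => //; [exact: mulr_ge0|exact: ler_pM].
    have -> : r * g * b0 * (r ^+ 2 * b0) = r ^+ 3 * g * b0 ^+ 2 by ring.
    rewrite ler_wpM2r ?sqr_ge0// ler_wpM2l//.
    by rewrite -[leLHS]expr1 ler_weXn2l.
  have u1 : (q * y) ^+ 2 <= r ^+ 3 * g ^+ 4 * b0 ^+ 2.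
    rewrite exprMn ler_pM ?sqr_ge0// ?lerXn2r ?nnegrE//.
    apply: (@le_trans _ _ (r ^+ 3)); last by rewrite ler_peMr.
    apply: (@le_trans _ _ ((r ^+ 2) ^+ 2)); first by rewrite lerXn2r ?nnegrE ?sqr_ge0.
    have -> : (r ^+ 2) ^+ 2 = r ^+ 3 * r by ring.
    by rewrite ler_piMr.
  have -> : rest = 2 * lambda ^+ 2 * (x * (q * y)) + lambda ^+ 2 / 2 * (q * y) ^+ 2.
    by rewrite /rest; field.
  have l2 : 0 <= lambda ^+ 2 := sqr_ge0 _.
  have c20 : 0 <= 2 * lambda ^+ 2 by exact: mulr_ge0.
  apply: (le_trans (ler_normD _ _)).
  have -> : c3 * r ^+ 3 * g ^+ 4 = 2 * lambda ^+ 2 * (r ^+ 3 * g ^+ 4 * b0 ^+ 2)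
    + lambda ^+ 2 * (r ^+ 3 * g ^+ 4 * b0 ^+ 2) by rewrite /c3; ring.
  apply: lerD.
    rewrite normrM (ger0_norm c20) ler_wpM2l// normrM (ger0_norm (mulr_ge0 q0 y0)).
    exact: u0.
  rewrite ger0_norm; last by rewrite mulr_ge0 ?sqr_ge0// divr_ge0.
  apply: ler_pM => //; [by rewrite divr_ge0|exact: sqr_ge0|].
  by rewrite ler_pdivrMr// ler_peMr// ler1n.
set LHS := (X in _ * `|X| <= _).
have -> : LHS = (expR (- a) - 1 - - a - a ^+ 2 / 2) + rest.
  by rewrite /LHS /rest -/a /a; field.
apply: (@le_trans _ _ (expR (- lambda * N) *
    (A ^+ 3 * r ^+ 3 * g ^+ 4 * expR `|a| + c3 * r ^+ 3 * g ^+ 4))).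
  rewrite ler_wpM2l// (le_trans (ler_normD _ _))// lerD//.
  by apply: (le_trans t1); rewrite ler_wpM2r ?expR_ge0.
have -> : (A ^+ 3 + c3) * M * r ^+ 3 = A ^+ 3 * M * r ^+ 3 + c3 * M * r ^+ 3 by ring.
rewrite mulrDr; apply: lerD.
  have -> : expR (- lambda * N) * (A ^+ 3 * r ^+ 3 * g ^+ 4 * expR `|a|) =
    A ^+ 3 * r ^+ 3 * (expR (- lambda * N) * g ^+ 4 * expR `|a|) by ring.
  by rewrite [leRHS]mulrAC; apply: ler_wpM2l => //; rewrite mulr_ge0 ?exprn_ge0.
have -> : expR (- lambda * N) * (c3 * r ^+ 3 * g ^+ 4) =
  c3 * r ^+ 3 * (expR (- lambda * N) * g ^+ 4) by ring.
by rewrite [leRHS]mulrAC; apply: ler_wpM2l => //; rewrite mulr_ge0.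
Qed.

(** What running the heat flow backwards does: K is the dimension and Q the
    decrease of the quadratic form N. *)
Lemma heat_backward (K : R) : 0 <= K ->
  exists2 C, 0 <= C & forall r q N Q : R,
    0 <= r -> r <= 1 -> 4 * lambda * r ^+ 2 <= 1 ->
    0 <= q -> q <= r ^+ 2 -> 0 <= N -> 0 <= Q -> Q <= q * N ->
  expR (- lambda * N) *
    `| expR (- (K / 2) * ln (1 + 2 * lambda * q)
             + lambda * (2 * lambda / (1 + 2 * lambda * q)) * Q)
       - (1 - lambda * q * K + 2 * lambda ^+ 2 * Q) |
  <= C * r ^+ 3.
Proof.
move=> K0; have Kl0 : 0 <= K * lambda by exact: mulr_ge0.
have l20 : 0 <= lambda ^+ 2 := sqr_ge0 _.
(* The exponent is at most K lambda + lambda N / 2: half of the Gaussian factor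
   is left to absorb the powers of g = 1 + sqrt N. *)
pose M := expR (K * lambda) * expR (0 + (0 + 4) ^+ 2 / (4 * (lambda / 2))).
pose c2 := K * lambda + 2 * lambda ^+ 2.
have c20 : 0 <= c2 by rewrite addr_ge0// mulr_ge0.
pose c3 := 2 * K * lambda ^+ 2 + 4 * lambda ^+ 3.
have c30 : 0 <= c3 by rewrite addr_ge0// !mulr_ge0// exprn_ge0.
have M0 : 0 <= M by rewrite mulr_ge0 ?expR_ge0.
exists ((c2 ^+ 2 + c3) * M); first by rewrite mulr_ge0// addr_ge0// exprn_ge0.
move=> r q N Q r0 r1 lr q0 qr N0 Q0 QN.
pose s := Num.sqrt N; have s0 : 0 <= s by exact: sqrtr_ge0.
have sN : s ^+ 2 = N by rewrite sqr_sqrtr.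
pose g := 1 + s; have g1 : 1 <= g by rewrite /g lerDl.
have g0 : 0 <= g := le_trans ler01 g1.
have Ng : N <= g ^+ 2 by rewrite -sN lerXn2r ?nnegrE// /g lerDr ler01.
have Qg : Q <= r ^+ 2 * g ^+ 2 by apply: (le_trans QN); exact: ler_pM.
have lq : 4 * lambda * q <= 1 by apply: le_trans lr; rewrite ler_wpM2l// mulr_ge0.
have q1 : q <= 1 by rewrite (le_trans qr)// exprn_ile1.
pose k := 2 * lambda / (1 + 2 * lambda * q).
have lq0 : 0 <= 2 * lambda * q by rewrite !mulr_ge0.
have d1 : 1 <= 1 + 2 * lambda * q by rewrite lerDl.
have d0 : 0 < 1 + 2 * lambda * q := lt_le_trans ltr01 d1.
have dN0 : 1 + 2 * lambda * q != 0 by rewrite gt_eqF.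
have ln0 : 0 <= ln (1 + 2 * lambda * q) by exact: ln_ge0.
have ln1 : ln (1 + 2 * lambda * q) <= 2 * lambda * q.
  by apply: le_ln1Dx; rewrite (lt_le_trans _ lq0)// ltrN10.
have ln2 := normr_ln1DB lq0.
have k0 : 0 <= k by rewrite divr_ge0// ?(ltW d0)// mulr_ge0.
have k1 : k <= 2 * lambda by rewrite ler_pdivrMr// ler_peMr// mulr_ge0.
have k2 : `|k - 2 * lambda| <= 4 * lambda ^+ 2 * q.
  have z0 : 0 <= 4 * lambda ^+ 2 * q by rewrite !mulr_ge0.
  rewrite (_ : k - 2 * lambda = - (4 * lambda ^+ 2 * q / (1 + 2 * lambda * q))).
    by rewrite normrN ger0_norm ?divr_ge0 ?(ltW d0)// ler_pdivrMr// ler_peMr.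
  by rewrite /k; field.
have lk0 : 0 <= lambda * k by exact: mulr_ge0.
have lk1 : lambda * k <= lambda * (2 * lambda) by rewrite ler_wpM2l.
pose b := - (K / 2) * ln (1 + 2 * lambda * q) + lambda * k * Q.
have kQ0 : 0 <= lambda * k * Q by exact: mulr_ge0.
have kQ : lambda * k * Q <= lambda * N / 2.
  apply: (@le_trans _ _ (lambda * (2 * lambda) * (q * N))); first exact: ler_pM.
  have -> : lambda * (2 * lambda) * (q * N) = (4 * lambda * q) * (lambda * N / 2).
    by field.
  by rewrite ler_piMl// divr_ge0// mulr_ge0.
have Kn0 : 0 <= K / 2 * ln (1 + 2 * lambda * q) by rewrite mulr_ge0// divr_ge0.
have Kn1 : K / 2 * ln (1 + 2 * lambda * q) <= K * lambda * q.
  have -> : K * lambda * q = K / 2 * (2 * lambda * q) by field.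
  by rewrite ler_wpM2l// divr_ge0.
have nb u v : K / 2 * ln (1 + 2 * lambda * q) <= u -> lambda * k * Q <= v ->
    `|b| <= u + v.
  move=> hu hv; rewrite /b mulNr (le_trans (ler_normD _ _))// normrN.
  by rewrite !ger0_norm// lerD.
have bexp : `|b| <= K * lambda + lambda * N / 2.
  by apply: nb => //; rewrite (le_trans Kn1)// ler_piMr.
have g2 : 1 <= g ^+ 2 by rewrite exprn_ege1.
have bg : `|b| <= c2 * (r ^+ 2 * g ^+ 2).
  rewrite /c2 mulrDl; apply: nb.
    by apply: (le_trans Kn1); rewrite ler_wpM2l// (le_trans qr)// ler_peMr// sqr_ge0.
  have -> : 2 * lambda ^+ 2 = lambda * (2 * lambda) by ring.
  exact: ler_pM.
have r3 : 0 <= r ^+ 3 by exact: exprn_ge0.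
have g4 : 1 <= g ^+ 4 by rewrite exprn_ege1.
have g40 : 0 <= g ^+ 4 := le_trans ler01 g4.
have r43 : r ^+ 4 <= r ^+ 3 by rewrite exprSr ler_piMr.
have e0 : 0 <= expR (- lambda * N) := expR_ge0 _.
have e2 : expR (- lambda * N) * g ^+ 4 * expR `|b| <= M.
  have := expR_absorb 0 (divr_gt0 lambda_gt0 (ltr0n _ 2)) s0.
  rewrite mul0r expR0 mulr1 sN => h.
  apply: (@le_trans _ _ (expR (- lambda * N) * g ^+ 4 *
      (expR (K * lambda) * expR (lambda * N / 2)))).
    by rewrite -expRD ler_wpM2l ?ler_expR// mulr_ge0.
  apply: le_trans (ler_wpM2l (expR_ge0 (K * lambda)) h).
  rewrite le_eqVlt; apply/orP; left; apply/eqP.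
  have -> : - (lambda / 2) * N = - lambda * N + lambda * N / 2 by field.
  by rewrite expRD /g; ring.
have e3 : expR (- lambda * N) * g ^+ 4 <= M.
  by apply: le_trans e2; rewrite ler_peMr ?mulr_ge0// -expR0 ler_expR.
have t2 := normr_expRB1D b.
have h2 : `|b| ^+ 2 <= c2 ^+ 2 * r ^+ 3 * g ^+ 4.
  apply: (@le_trans _ _ ((c2 * (r ^+ 2 * g ^+ 2)) ^+ 2)).
    by rewrite lerXn2r ?nnegrE// !mulr_ge0 ?sqr_ge0.
  have -> : (c2 * (r ^+ 2 * g ^+ 2)) ^+ 2 = c2 ^+ 2 * r ^+ 4 * g ^+ 4 by ring.
  by rewrite ler_wpM2r// ler_wpM2l// sqr_ge0.
pose rest := K / 2 * (ln (1 + 2 * lambda * q) - 2 * lambda * q)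
  - lambda * (k - 2 * lambda) * Q.
have h3 : `|rest| <= c3 * r ^+ 3 * g ^+ 4.
  have q2 : q ^+ 2 <= r ^+ 3 * g ^+ 4.
    apply: (@le_trans _ _ ((r ^+ 2) ^+ 2)); first by rewrite lerXn2r ?nnegrE ?sqr_ge0.
    have -> : (r ^+ 2) ^+ 2 = r ^+ 4 by ring.
    by rewrite (le_trans r43)// ler_peMr.
  have -> : c3 * r ^+ 3 * g ^+ 4 = 2 * K * lambda ^+ 2 * (r ^+ 3 * g ^+ 4)
      + 4 * lambda ^+ 3 * (r ^+ 3 * g ^+ 4) by rewrite /c3; ring.
  apply: (le_trans (ler_normB _ _)); apply: lerD.
    have K20 : 0 <= K / 2 by rewrite divr_ge0.
    rewrite normrM (ger0_norm K20).
    apply: (@le_trans _ _ (K / 2 * (2 * lambda * q) ^+ 2)); first by rewrite ler_wpM2l.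
    have -> : K / 2 * (2 * lambda * q) ^+ 2 = 2 * K * lambda ^+ 2 * q ^+ 2 by field.
    by rewrite ler_wpM2l// !mulr_ge0.
  rewrite !normrM (gtr0_norm lambda_gt0) (ger0_norm Q0).
  apply: (@le_trans _ _ (lambda * (4 * lambda ^+ 2 * q) * (r ^+ 2 * g ^+ 2))).
    by apply: ler_pM => //; [rewrite mulr_ge0|rewrite ler_wpM2l].
  have -> : lambda * (4 * lambda ^+ 2 * q) * (r ^+ 2 * g ^+ 2) =
    4 * lambda ^+ 3 * (q * (r ^+ 2 * g ^+ 2)) by ring.
  rewrite ler_wpM2l//; first by rewrite mulr_ge0// exprn_ge0.
  apply: (@le_trans _ _ (r ^+ 2 * (r ^+ 2 * g ^+ 4))).
    apply: ler_pM => //; first by rewrite mulr_ge0 ?sqr_ge0.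
    by rewrite ler_wpM2l ?sqr_ge0// ler_weXn2l.
  by rewrite mulrA -exprD ler_wpM2r.
set LHS := (X in _ * `|X| <= _).
have -> : LHS = (expR b - 1 - b) - rest.
  by rewrite /LHS /rest -/k -/b /b; field.
apply: (@le_trans _ _ (expR (- lambda * N) *
    (c2 ^+ 2 * r ^+ 3 * g ^+ 4 * expR `|b| + c3 * r ^+ 3 * g ^+ 4))).
  rewrite ler_wpM2l// (le_trans (ler_normB _ _))// lerD//.
  by apply: (le_trans t2); rewrite ler_wpM2r ?expR_ge0.
have -> : (c2 ^+ 2 + c3) * M * r ^+ 3 = c2 ^+ 2 * M * r ^+ 3 + c3 * M * r ^+ 3 by ring.
rewrite mulrDr; apply: lerD.
  have -> : expR (- lambda * N) * (c2 ^+ 2 * r ^+ 3 * g ^+ 4 * expR `|b|) =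
    c2 ^+ 2 * r ^+ 3 * (expR (- lambda * N) * g ^+ 4 * expR `|b|) by ring.
  by rewrite [leRHS]mulrAC; apply: ler_wpM2l => //; rewrite mulr_ge0 ?exprn_ge0.
have -> : expR (- lambda * N) * (c3 * r ^+ 3 * g ^+ 4) =
  c3 * r ^+ 3 * (expR (- lambda * N) * g ^+ 4) by ring.
by rewrite [leRHS]mulrAC; apply: ler_wpM2l => //; rewrite mulr_ge0.
Qed.

(** The two expansions agree up to a bracket that is linear in x and in the
    deviations of y and of x ^+ 2 from their means K and Q. *)
Lemma heat_step_scalar (K B : R) : 0 <= K -> 0 <= B ->
  exists2 C, 0 <= C & forall r q Q N x y : R,
    0 <= r -> r <= 1 -> 4 * lambda * r ^+ 2 <= 1 ->
    0 <= q -> q <= r ^+ 2 -> 0 <= Q -> Q <= q * N -> 0 <= N ->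
    x ^+ 2 <= Q * y -> 0 <= y -> y <= B ->
  expR (- lambda * N) *
    `| expR (- (2 * lambda * x + lambda * q * y))
       - expR (- (K / 2) * ln (1 + 2 * lambda * q)
               + lambda * (2 * lambda / (1 + 2 * lambda * q)) * Q)
       - (- 2 * lambda * x - lambda * q * (y - K)
          + 2 * lambda ^+ 2 * (x ^+ 2 - Q)) | <= C * r ^+ 3.
Proof.
move=> K0 B0; have [C1 C10 H1] := heat_forward B0; have [C2 C20 H2] := heat_backward K0.
exists (C1 + C2); first exact: addr_ge0.
move=> r q Q N x y r0 r1 lr q0 qr Q0 QN N0 xQ y0 yB.
have xQ' : x ^+ 2 <= q * N * y by rewrite (le_trans xQ)// ler_wpM2r.
have h1 := H1 r q N x y r0 r1 q0 qr N0 xQ' y0 yB.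
have h2 := H2 r q N Q r0 r1 lr q0 qr N0 Q0 QN.
rewrite [leRHS]mulrDl; apply: le_trans (lerD h1 h2); rewrite -mulrDr ler_wpM2l ?expR_ge0//.
apply: le_trans (ler_normB _ _); rewrite le_eqVlt; apply/orP; left; apply/eqP.
by congr (`|_|); ring.
Qed.

End heat_step_scalar.

(** * Quadratic forms *)

Lemma cauchy_schwarz (R : realFieldType) (V : lmodType R) (B : V -> V -> R) :
  (forall a u v w, B (a *: u + v) w = a * B u w + B v w) ->
  (forall u v, B u v = B v u) -> (forall v, 0 <= B v v) ->
  forall u v, B u v ^+ 2 <= B u u * B v v.
Proof.
move=> Bl Bs B0 u v.
have E a b : B (a *: u + b *: v) (a *: u + b *: v) =
    a ^+ 2 * B u u + 2 * a * b * B u v + b ^+ 2 * B v v.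
  have Bl0 w : B 0 w = 0.
    by have := Bl (-1) 0 0 w; rewrite scaler0 addr0 mulN1r addNr.
  have BZ c x w : B (c *: x) w = c * B x w.
    by rewrite -[c *: x]addr0 Bl Bl0 addr0.
  rewrite Bl BZ (Bs u) (Bs v) !Bl !BZ (Bs v u); ring.
have [Bv|Bv] := leP (B v v) 0.
  have Bv0 : B v v = 0 by apply/eqP; rewrite eq_le Bv B0.
  rewrite Bv0 mulr0; have [->|Buv] := eqVneq (B u v) 0; first by rewrite expr0n.
  have := B0 (1 *: u + (- (B u u + 1) / (2 * B u v)) *: v).
  rewrite E Bv0 (_ : _ + _ + _ = -1); last by field.
  by rewrite oppr_ge0 ler10.
have := B0 (B v v *: u + (- B u v) *: v); rewrite E.
rewrite (_ : _ + _ + _ = B v v * (B v v * B u u - B u v ^+ 2)); last by ring.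
by rewrite pmulr_rge0// subr_ge0 mulrC.
Qed.

Section form.
Context (R : realFieldType) (n : nat).
Implicit Types (A : 'M[R]_n) (u v : 'cV[R]_n).

Definition form A u v : R := (u^T *m A *m v) 0 0.

Lemma formE A u v : form A u v = \sum_i \sum_j u i 0 * A i j * v j 0.
Proof.
rewrite /form !mxE exchange_big/=; apply: eq_bigr => j _.
by rewrite !mxE mulr_suml; apply: eq_bigr => i _; rewrite !mxE.
Qed.

Lemma form_sym A u v : A^T = A -> form A u v = form A v u.
Proof.
move=> AT; rewrite /form -[u^T *m A *m v]trmxK mxE !trmx_mul AT trmxK.
by rewrite mulmxA.
Qed.

Lemma form_cauchy_schwarz A : A^T = A -> (forall v, 0 <= form A v v) ->
  forall u v, form A u v ^+ 2 <= form A u u * form A v v.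
Proof.
move=> AT A0; apply: cauchy_schwarz => // [a u v w|u v]; last exact: form_sym.
by rewrite /form linearP/= !mulmxDl -!scalemxAl !mxE.
Qed.

Lemma form1 v : form 1%:M v v = \sum_i v i 0 ^+ 2.
Proof.
rewrite formE; apply: eq_bigr => i _; rewrite (bigD1 i)//= mxE eqxx mulr1.
rewrite big1 ?addr0// => j ji.
by rewrite mxE eq_sym (negbTE ji) mulr0 mul0r.
Qed.

End form.

Lemma positive_definite_unit (R : realFieldType) n (A : 'M[R]_n) : positive_definite A -> A \in unitmx.
Proof.
move=> [_ Apos]; rewrite -unitmx_tr -row_free_unit; apply/inj_row_free => v vA.
apply/eqP; apply: contraT => v0.
have := Apos v^T; rewrite trmx_eq0 v0 => /(_ isT).
by rewrite -mulmxA (_ : A *m v^T = 0) ?mulmx0 ?mxE ?ltxx// -[A]trmxK -trmx_mul vA trmx0.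
Qed.

Lemma positive_definite_inv_sym (R : realFieldType) n (A : 'M[R]_n) : positive_definite A ->
  (invmx A)^T = invmx A.
Proof. by move=> [AT _]; rewrite trmx_inv AT. Qed.

Lemma positive_definite_inv_ge0 (R : realFieldType) n (A : 'M[R]_n) : positive_definite A ->
  forall v, 0 <= form (invmx A) v v.
Proof.
move=> Apd v; have Au := positive_definite_unit Apd.
have [_ Apos] := Apd.
have -> : form (invmx A) v v = form A (invmx A *m v) (invmx A *m v).
  rewrite /form trmx_mul positive_definite_inv_sym// !mulmxA.
  by rewrite -[v^T *m invmx A *m A]mulmxA mulVmx// mulmx1.
have [->|v0] := eqVneq (invmx A *m v) 0; first by rewrite /form mulmx0 mxE.
by rewrite ltW// Apos.
Qed.

(** Sylvester's identity, by two triangular factorizations of the same block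
    matrix. *)
Lemma det_1D_mulmx (R : comNzRingType) m n (u : 'M[R]_(m, n)) (v : 'M[R]_(n, m)) :
  \det (1%:M + u *m v) = \det (1%:M + v *m u).
Proof.
pose B := block_mx 1%:M (- v) u (1%:M : 'M[R]_m).
transitivity (\det B).
  have -> : B = block_mx 1%:M 0 u 1%:M *m block_mx 1%:M (- v) 0 (1%:M + u *m v).
    rewrite mulmx_block !mul0mx !mul1mx !mulmx1 !addr0 mulmxN.
    by rewrite [- (u *m v) + _]addrC addrK.
  by rewrite det_mulmx det_lblock det_ublock !det1 !mul1r.
have -> : B = block_mx 1%:M (- v) 0 1%:M *m block_mx (1%:M + v *m u) 0 u 1%:M.
  by rewrite mulmx_block !mul0mx !mul1mx !mulmx1 !add0r mulNmx addrK.
by rewrite det_mulmx det_lblock det_ublock !det1 !mul1r mulr1.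
Qed.

(** * The heat flow of a Gaussian function of a matrix *)

Section heat.
Context (R : realType) (lambda : R) (L K : nat) (S : 'M[R]_K).
Hypothesis lambda_gt0 : 0 < lambda.
Hypothesis S_sym : S^T = S.
Hypothesis S_ge0 : forall v, 0 <= form S v v.
Implicit Types (A : 'M[R]_L) (c : 'cV[R]_L) (w : 'M[R]_(L, K)) (xi : 'cV[R]_K).

Definition mxform A w w' : R := \tr (w^T *m A *m w' *m S).

Definition gram (cs : seq 'cV[R]_L) : 'M[R]_L := \sum_(c <- cs) c *m c^T.

(** The coefficient of the rank-one correction in the Sherman-Morrison formula. *)
Definition damping q : R := 2 * lambda / (1 + 2 * lambda * q).

(** The inverse of 1 + 2 lambda gram cs, by the Sherman-Morrison formula. *)
Fixpoint precision cs : 'M[R]_L :=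
  if cs is c :: cs' then
    let A := precision cs' in
    A - damping (form A c c) *: (A *m c *m (c^T *m A))
  else 1%:M.

Fixpoint logdet cs : R :=
  if cs is c :: cs' then
    logdet cs' + ln (1 + 2 * lambda * form (precision cs') c c)
  else 0.

Lemma mxform_sym A w w' : A^T = A -> mxform A w w' = mxform A w' w.
Proof.
by move=> AT; rewrite /mxform -mxtrace_tr !trmx_mul AT S_sym trmxK mxtrace_mulC !mulmxA.
Qed.

Lemma mxformDZl A (a : R) w1 w2 w : mxform A (a *: w1 + w2) w =
  a * mxform A w1 w + mxform A w2 w.
Proof. by rewrite /mxform linearP/= !mulmxDl -!scalemxAl linearP. Qed.

Lemma mxform_outer A w c xi : A^T = A ->
  mxform A w (c *m xi^T) = form S xi (w^T *m A *m c).
Proof.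
move=> AT; rewrite /mxform /form !mulmxA -(mulmxA (w^T *m A *m c)).
by rewrite mxtrace_mulC /mxtrace big_ord1 !mulmxA.
Qed.

Lemma mxform_outer2 A c xi : A^T = A ->
  mxform A (c *m xi^T) (c *m xi^T) = form A c c * form S xi xi.
Proof.
move=> AT; rewrite mxform_outer// trmx_mul trmxK /form.
rewrite -[xi *m c^T *m A]mulmxA -[xi *m _ *m c]mulmxA.
rewrite [c^T *m A *m c]mx11_scalar mul_mx_scalar -scalemxAr [in RHS]mxE eqxx mulr1n.
by rewrite mxE.
Qed.

Lemma mxform_shift A w c xi : A^T = A ->
  mxform A (w + c *m xi^T) (w + c *m xi^T) =
  mxform A w w + 2 * form S xi (w^T *m A *m c) + form A c c * form S xi xi.
Proof.
move=> AT; set u := c *m xi^T.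
have D w1 w2 w3 : mxform A (w1 + w2) w3 = mxform A w1 w3 + mxform A w2 w3.
  by rewrite -[w1]scale1r mxformDZl scale1r mul1r.
rewrite D (mxform_sym w _ AT) (mxform_sym u _ AT) !D (mxform_sym u w AT).
by rewrite (mxform_outer2 _ _ AT) (mxform_outer w c xi AT); ring.
Qed.

Lemma form_downdate A (a : R) c v : A^T = A ->
  form (A - a *: (A *m c *m (c^T *m A))) v v = form A v v - a * form A v c ^+ 2.
Proof.
move=> AT; rewrite /form mulmxBr mulmxBl -scalemxAr -scalemxAl.
rewrite [LHS]mxE [X in _ + X]mxE [X in - X]mxE; congr (_ - _ * _).
have -> : v^T *m (A *m c *m (c^T *m A)) *m v = (v^T *m A *m c) *m (c^T *m A *m v).
  by rewrite !mulmxA.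
rewrite mxE big_ord1 expr2; congr (_ * _); exact: form_sym.
Qed.

Lemma mxform_downdate A (a : R) c w : A^T = A ->
  mxform (A - a *: (A *m c *m (c^T *m A))) w w =
  mxform A w w - a * form S (w^T *m A *m c) (w^T *m A *m c).
Proof.
move=> AT; rewrite /mxform mulmxBr !mulmxBl linearB/= -scalemxAr -!scalemxAl linearZ/=.
congr (_ - _ * _).
rewrite /form [in RHS]trmx_mul [in RHS]trmx_mul trmxK AT.
have -> : w^T *m (A *m c *m (c^T *m A)) *m w *m S =
  (w^T *m A *m c) *m (c^T *m (A *m w) *m S) by rewrite !mulmxA.
by rewrite mxtrace_mulC /mxtrace big_ord1.
Qed.

Lemma damping_ge0 q : 0 <= q -> 0 <= damping q.
Proof.
move=> q0; have l0 := ltW lambda_gt0.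
by rewrite /damping divr_ge0 ?mulr_ge0// addr_ge0// !mulr_ge0.
Qed.

Lemma damping_le1 q : 0 <= q -> damping q * q <= 1.
Proof.
move=> q0; have l0 := ltW lambda_gt0.
have lq : 0 <= 2 * lambda * q by rewrite !mulr_ge0.
rewrite /damping mulrAC ler_pdivrMr ?mul1r; first by rewrite lerDr ler01.
by rewrite (lt_le_trans ltr01)// lerDl.
Qed.

(** The Cauchy-Schwarz inequality for w and the outer product c z^T, where
    z = w^T A c. *)
Lemma mxform_decrease A c w : A^T = A -> (forall w, 0 <= mxform A w w) ->
  0 <= form A c c ->
  form S (w^T *m A *m c) (w^T *m A *m c) <= form A c c * mxform A w w.
Proof.
move=> AT A0 q0; set z := w^T *m A *m c; set q := form A c c.
have := @cauchy_schwarz _ _ (mxform A) (mxformDZl A) (fun w w' => mxform_sym w w' AT) A0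
  w (c *m z^T).
rewrite mxform_outer// mxform_outer2// -/z -/q.
have [/eqP ->|z0] := boolP (form S z z == 0); first by move=> _; rewrite mulr_ge0.
have {}z0 : 0 < form S z z by rewrite lt_neqAle eq_sym z0 S_ge0.
by rewrite expr2 mulrA ler_pM2r// mulrC.
Qed.

Lemma mxform1E w : mxform 1%:M w w = \sum_i form S (row i w)^T (row i w)^T.
Proof.
rewrite /mxform mulmx1 -mulmxA mxtrace_mulC /mxtrace; apply: eq_bigr => i _.
rewrite /form trmxK !mxE; apply: eq_bigr => j _; rewrite !mxE; congr (_ * _).
by apply: eq_bigr => k _; rewrite !mxE.
Qed.

(** Each downdate subtracts at most the fraction damping q * q <= 1 of the two
    forms, by the Cauchy-Schwarz inequality, hence they stay nonnegative. *)
Lemma precision_spec cs :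
  [/\ (precision cs)^T = precision cs,
      forall v, 0 <= form (precision cs) v v,
      forall v, form (precision cs) v v <= form 1%:M v v &
      forall w, 0 <= mxform (precision cs) w w].
Proof.
elim: cs => [|c cs [AT A0 A1 AS]] /=.
  split => //; first exact: trmx1.
    by move=> v; rewrite form1 sumr_ge0// => i _; exact: sqr_ge0.
  move=> w; rewrite mxform1E.
  by rewrite sumr_ge0.
set A := precision cs in AT A0 A1 AS *.
set a := damping _; have q0 := A0 c.
have a0 : 0 <= a by exact: damping_ge0.
have aq : a * form A c c <= 1 by exact: damping_le1.
split.
- by rewrite linearB/= linearZ/= !trmx_mul trmxK AT.
- move=> v; rewrite form_downdate// subr_ge0.
  apply: (@le_trans _ _ (a * (form A v v * form A c c))).
    by rewrite ler_wpM2l// form_cauchy_schwarz.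
  by rewrite [form A v v * _]mulrC mulrA ler_piMl.
- move=> v; rewrite form_downdate// (le_trans _ (A1 v))// gerBl mulr_ge0//.
  exact: sqr_ge0.
- move=> w; rewrite mxform_downdate// subr_ge0.
  apply: (@le_trans _ _ (a * (form A c c * mxform A w w))).
    by rewrite ler_wpM2l// mxform_decrease.
  by rewrite mulrA ler_piMl.
Qed.

Lemma logdet_ge0 cs : 0 <= logdet cs.
Proof.
elim: cs => [|c cs IH] //=; rewrite addr_ge0//; apply: ln_ge0.
have [_ A0 _ _] := precision_spec cs.
by rewrite lerDl !mulr_ge0// ltW.
Qed.

Lemma precisionK cs : precision cs *m (1%:M + 2 * lambda *: gram cs) = 1%:M.
Proof.
elim: cs => [|c cs IH]; first by rewrite /= /gram big_nil scaler0 addr0 mulmx1.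
have [AT A0 _ _] := precision_spec cs.
rewrite /gram big_cons /= -/(gram cs) scalerDr addrCA.
set A := precision cs in IH AT A0 *; set M := 1%:M + _ in IH *.
have q0 := A0 c; set q := form A c c in q0 *.
have lq : 0 <= 2 * lambda * q by rewrite !mulr_ge0// ltW.
have dN0 : 1 + 2 * lambda * q != 0 by rewrite gt_eqF// (lt_le_trans ltr01)// lerDl.
rewrite mulmxDr !mulmxBl IH -!scalemxAl.
rewrite -[A *m c *m (c^T *m A) *m M]mulmxA -[c^T *m A *m M]mulmxA IH mulmx1.
rewrite -!scalemxAr [A *m (c *m c^T)]mulmxA.
have -> : A *m c *m (c^T *m A) *m (c *m c^T) = q *: (A *m c *m c^T).
  rewrite [c *m c^T]/(c *m c^T) !mulmxA -[A *m c *m c^T *m A *m c]mulmxA.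
  rewrite -[A *m c *m c^T *m (A *m c)]mulmxA.
  rewrite [c^T *m (A *m c)]mx11_scalar mul_mx_scalar -scalemxAl /q /form.
  by rewrite !mulmxA.
rewrite !scalerA addrCA -[RHS]addr0; congr (_ + _).
rewrite -!scalerBl (_ : _ - _ = 0) ?scale0r//.
by rewrite /damping; field.
Qed.

(** The matrix determinant lemma, step by step. *)
Lemma expR_logdet cs : expR (logdet cs) = \det (1%:M + 2 * lambda *: gram cs).
Proof.
elim: cs => [|c cs IH]; first by rewrite /= /gram big_nil scaler0 addr0 det1 expR0.
have [_ A0 _ _] := precision_spec cs; have AM := precisionK cs.
rewrite /gram big_cons /= -/(gram cs) scalerDr addrCA expRD IH.
set A := precision cs in AM A0 *; set M := 1%:M + _ in AM *.
have q0 := A0 c; set q := form A c c in q0 *.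
have lq : 0 <= 2 * lambda * q by rewrite !mulr_ge0// ltW.
rewrite lnK ?posrE; last by rewrite (lt_le_trans ltr01)// lerDl.
have MA := mulmx1C AM.
have -> : 2 * lambda *: (c *m c^T) + M = M *m (1%:M + (2 * lambda *: (A *m c)) *m c^T).
  rewrite mulmxDr mulmx1 addrC -scalemxAl -scalemxAr; congr (_ + _ *: _).
  by rewrite !mulmxA MA mul1mx.
rewrite det_mulmx det_1D_mulmx -scalemxAr; congr (_ * _).
have -> : q = (c^T *m (A *m c)) 0 0 by rewrite mulmxA.
by move: (c^T *m (A *m c)) => y; rewrite det_mx11 !mxE eqxx.
Qed.

(** The closed form of the mean of exp(- lambda mxform 1 v v), where v is w plus
    the sum over c in cs of c *m g^T with independent centred Gaussian vectors g
    of covariance matrix the inverse of S. *)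
Definition heat cs w : R :=
  expR (- (K%:R / 2) * logdet cs - lambda * mxform (precision cs) w w).

(** The linear and quadratic deviations of the increment that the comparison of
    two steps leaves behind; its mean vanishes when xi has mean zero and
    covariance matrix the inverse of S. *)
Definition deviation A c w xi : R :=
  let z := w^T *m A *m c in
  - 2 * lambda * form S xi z - lambda * form A c c * (form S xi xi - K%:R)
  + 2 * lambda ^+ 2 * (form S xi z ^+ 2 - form S z z).

(** One step is exact to third order, uniformly in the state and in the
    remaining directions: the Gaussian factor of heat absorbs the growth in
    the state of the scalar estimates. *)
Lemma heat_step (B : R) : 0 <= B -> exists2 C, 0 <= C & forall cs c w xi r,
  0 <= r -> r <= 1 -> 4 * lambda * r ^+ 2 <= 1 -> form 1%:M c c <= r ^+ 2 ->
  form S xi xi <= B ->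
  `| heat cs (w + c *m xi^T) - heat (c :: cs) w
     - heat cs w * deviation (precision cs) c w xi | <= C * r ^+ 3.
Proof.
move=> B0; have [C C0 H] := heat_step_scalar lambda_gt0 (ler0n R K) B0.
exists C => // cs c w xi r r0 r1 lr cr xiB.
have [AT A0 A1 AS] := precision_spec cs.
rewrite /heat /= mxform_shift// mxform_downdate// /deviation /=.
set A := precision cs in AT A0 A1 AS *; set z := w^T *m A *m c.
set N := mxform A w w; set x := form S xi z; set y := form S xi xi.
set q := form A c c; set Q := form S z z; set ld := logdet cs.
have h := H r q Q N x y r0 r1 lr (A0 c) (le_trans (A1 c) cr) (S_ge0 z)
  (mxform_decrease w AT AS (A0 c)) (AS w).
have xQ : x ^+ 2 <= Q * y.
  by rewrite mulrC; exact: form_cauchy_schwarz.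
move: h => /(_ xQ (S_ge0 xi) xiB); apply: le_trans.
rewrite -[leRHS]mul1r; set rhs := (X in 1 * X).
(* The determinant of 1 + 2 lambda gram cs is at least 1. *)
apply: (@le_trans _ _ (expR (- (K%:R / 2) * ld) * rhs)); last first.
  rewrite ler_wpM2r ?mulr_ge0 ?expR_ge0// -[leRHS]expR0 ler_expR.
  by rewrite mulNr oppr_le0 mulr_ge0 ?logdet_ge0// divr_ge0.
rewrite /rhs mulrA -expRD.
rewrite -[X in X * `|_|]ger0_norm ?expR_ge0// -normrM le_eqVlt; apply/orP; left; apply/eqP.
congr (`|_|); rewrite !mulrBr -!expRD; congr (expR _ - expR _ - _ * _).
- by ring.
- by rewrite /damping; ring.
- by congr expR; ring.
Qed.

End heat.

(** * The Laplace transform of the linear statistic *)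

Section bounded_measurable_mx.
Context d (T : measurableType d) (R : realType).

Definition bounded_measurable_mx m n (f : T -> 'M[R]_(m, n)) :=
  forall i j, bounded_measurable (fun t => f t i j).

Lemma bounded_measurable_mx_cst m n (A : 'M[R]_(m, n)) :
  bounded_measurable_mx (fun=> A).
Proof. by move=> i j; exact: bounded_measurable_cst. Qed.

Lemma bounded_measurable_mulmx m n p (f : T -> 'M[R]_(m, n)) (g : T -> 'M[R]_(n, p)) :
  bounded_measurable_mx f -> bounded_measurable_mx g ->
  bounded_measurable_mx (fun t => f t *m g t).
Proof.
move=> hf hg i j; under eq_fun do rewrite mxE.
by apply: bounded_measurable_sum => k _; exact: bounded_measurableM.
Qed.

Lemma bounded_measurable_trmx m n (f : T -> 'M[R]_(m, n)) :
  bounded_measurable_mx f -> bounded_measurable_mx (fun t => (f t)^T).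
Proof. by move=> hf i j; under eq_fun do rewrite mxE; exact: hf. Qed.

Lemma bounded_measurable_mx_sum m n (I : Type) (r : seq I) (F : I -> T -> 'M[R]_(m, n)) :
  (forall i, bounded_measurable_mx (F i)) ->
  bounded_measurable_mx (fun t => \sum_(i <- r) F i t).
Proof.
move=> hF i j; under eq_fun do rewrite summxE.
by apply: bounded_measurable_sum => k _; exact: hF.
Qed.

Lemma bounded_measurable_form n (A : 'M[R]_n) (f g : T -> 'cV[R]_n) :
  bounded_measurable_mx f -> bounded_measurable_mx g ->
  bounded_measurable (fun t => form A (f t) (g t)).
Proof.
move=> hf hg; apply: (bounded_measurable_mulmx _ hg); apply: bounded_measurable_mulmx.
  exact: bounded_measurable_trmx.
exact: bounded_measurable_mx_cst.
Qed.

Lemma bounded_measurable_mxform L K (S : 'M[R]_K) (A : 'M[R]_L) (f : T -> 'M[R]_(L, K)) :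
  bounded_measurable_mx f -> bounded_measurable (fun t => mxform S A (f t) (f t)).
Proof.
move=> hf.
have hM : bounded_measurable_mx (fun t => (f t)^T *m A *m f t *m S).
  apply: bounded_measurable_mulmx (bounded_measurable_mx_cst S).
  apply: (bounded_measurable_mulmx _ hf).
  apply: bounded_measurable_mulmx (bounded_measurable_mx_cst A).
  exact: bounded_measurable_trmx.
by apply: bounded_measurable_sum => k _; exact: hM.
Qed.

Lemma bounded_measurable_heat lambda L K (S : 'M[R]_K) cs (f : T -> 'M[R]_(L, K)) :
  bounded_measurable_mx f ->
  bounded_measurable (fun t => heat lambda S cs (f t)).
Proof.
move=> hf; apply: bounded_measurable_expR; apply: bounded_measurableB.
  exact: bounded_measurable_cst.
by apply: bounded_measurableZ; exact: bounded_measurable_mxform.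
Qed.

End bounded_measurable_mx.

Section laplace.
Context d (T : measurableType d) (R : realType) (P : probability T R) (K L : nat).
Variable X : nat -> {RV P >-> K.-tuple R}.
Hypothesis X_iid : iid P X.
Hypothesis F_continuous : forall k : 'I_K, continuous (marginal_cdf P (X 0%N) k).
Local Notation Sigma := (grade_cov P (X 0%N)).
Hypothesis Sigma_pd : positive_definite Sigma.

Local Notation E := (mean P).
Local Notation score := (score X).
Local Notation S := (invmx Sigma).

Definition scores i t : 'cV[R]_K := \col_k score k (X i t).

Lemma bounded_measurable_scores i : bounded_measurable_mx (scores i).
Proof. by move=> k j; under eq_fun do rewrite mxE; exact: bounded_measurable_score. Qed.

Lemma bounded_measurable_without_scores i j : i != j ->
  bounded_measurable_mx (scores i : without X j -> _).
Proof.
by move=> ij k l; under eq_fun do rewrite mxE; exact: bounded_measurable_without_score.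
Qed.

Definition score_bound : R := \sum_i \sum_j `|S i j|.

Lemma score_bound_ge0 : 0 <= score_bound.
Proof. by rewrite sumr_ge0// => i _; rewrite sumr_ge0. Qed.

Lemma form_scores_le i t : form S (scores i t) (scores i t) <= score_bound.
Proof.
rewrite formE; apply: ler_sum => k _; apply: ler_sum => k' _.
rewrite !mxE; move: (normr_score X k (X i t)) (normr_score X k' (X i t)).
move: (score k _) (score k' _) => x y hx hy.
by rewrite (le_trans (ler_norm _))// !normrM mulrAC ler_piMl// mulr_ile1.
Qed.

(** Independence factors every mean into a mean of the state and either
    E xi = 0 or E (xi *m xi^T) = Sigma. *)
Lemma mean_deviation lambda j (A : 'M[R]_L) (c : 'cV[R]_L) (h : T -> R)
    (w : T -> 'M[R]_(L, K)) :
  bounded_measurable (h : without X j -> R) ->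
  bounded_measurable_mx (w : without X j -> _) ->
  E (fun t => h t * deviation lambda S A c (w t) (scores j t)) = 0.
Proof.
move=> hh hw.
have Su := positive_definite_unit Sigma_pd; have ST := positive_definite_inv_sym Sigma_pd.
pose z t := (w t)^T *m A *m c; pose u t := S *m z t.
have cstw m n (M : 'M[R]_(m, n)) : bounded_measurable_mx (fun _ : without X j => M).
  exact: bounded_measurable_mx_cst.
have hz : bounded_measurable_mx (z : without X j -> _).
  have h1 := bounded_measurable_mulmx (bounded_measurable_trmx hw) (cstw _ _ A).
  exact: (bounded_measurable_mulmx h1 (cstw _ _ c)).
have hu : bounded_measurable_mx (u : without X j -> _).
  exact: (bounded_measurable_mulmx (cstw _ _ S) hz).
have hzz : bounded_measurable ((fun t => h t * form S (z t) (z t)) : without X j -> R).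
  by apply: bounded_measurableM => //; exact: bounded_measurable_form.
have huh k : bounded_measurable ((fun t => u t k 0 * h t) : without X j -> R).
  by apply: bounded_measurableM => //; exact: hu.
have huuh k k' : bounded_measurable
    ((fun t => u t k 0 * u t k' 0 * h t) : without X j -> R).
  by apply: bounded_measurableM => //; apply: bounded_measurableM; exact: hu.
have hhT := bounded_measurable_without hh.
have hzzT := bounded_measurable_without hzz.
have hs k := bounded_measurable_score X k j.
have hss k k' : bounded_measurable (fun t => score k (X j t) * score k' (X j t)).
  by apply: bounded_measurableM; exact: hs.
pose f1 t := \sum_k score k (X j t) * (u t k 0 * h t).
pose f2 t := \sum_k \sum_k' S k k' * (score k (X j t) * score k' (X j t) * h t).
pose f3 t := \sum_k \sum_k'
  score k (X j t) * score k' (X j t) * (u t k 0 * u t k' 0 * h t).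
have b1 : bounded_measurable f1.
  apply: bounded_measurable_sum => k _; apply: bounded_measurableM => //.
  exact: bounded_measurable_without (huh k).
have b2' k k' : bounded_measurable (fun t => score k (X j t) * score k' (X j t) * h t).
  exact: bounded_measurableM.
have b2 : bounded_measurable f2.
  apply: bounded_measurable_sum => k _; apply: bounded_measurable_sum => k' _.
  exact: bounded_measurableZ.
have b3' k k' : bounded_measurable (fun t => score k (X j t) * score k' (X j t) *
    (u t k 0 * u t k' 0 * h t)).
  by apply: bounded_measurableM => //; exact: bounded_measurable_without (huuh k k').
have b3 : bounded_measurable f3.
  by apply: bounded_measurable_sum => k _; apply: bounded_measurable_sum.
have E1 : E f1 = 0.
  rewrite mean_sum => [|k _]; last first.
    by apply: bounded_measurableM => //; exact: bounded_measurable_without (huh k).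
  by rewrite big1// => k _; rewrite mean_score_factor.
have E2 : E f2 = K%:R * E h.
  rewrite mean_sum => [|k _]; last first.
    by apply: bounded_measurable_sum => k' _; exact: bounded_measurableZ.
  transitivity (\sum_k \sum_k' S k k' * Sigma k' k * E h).
    apply: eq_bigr => k _; rewrite mean_sum => [|k' _]; last exact: bounded_measurableZ.
    apply: eq_bigr => k' _; rewrite meanZ// mean_score2_factor// mulrA.
    by have [<- _] := Sigma_pd; rewrite mxE; have [-> _] := Sigma_pd.
  rewrite -[K%:R](mxtrace1 R K) -(mulVmx Su) /mxtrace mulr_suml; apply: eq_bigr => k _.
  by rewrite mxE mulr_suml.
have E3 : E f3 = E (fun t => h t * form S (z t) (z t)).
  have uE t : h t * form S (z t) (z t) =
      \sum_k \sum_k' Sigma k k' * (u t k 0 * u t k' 0 * h t).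
    have -> : form S (z t) (z t) = form Sigma (u t) (u t).
      rewrite /form /u [(S *m _)^T]trmx_mul ST !mulmxA.
      by rewrite -[(z t)^T *m S *m Sigma]mulmxA mulVmx// mulmx1.
    rewrite formE mulr_sumr; apply: eq_bigr => k _; rewrite mulr_sumr.
    by apply: eq_bigr => k' _; ring.
  rewrite (eq_mean _ uE) !mean_sum => [|k _|k _].
  - apply: eq_bigr => k _; rewrite !mean_sum => [|k' _|k' _] //.
    + by apply: eq_bigr => k' _; rewrite mean_score2_factor// meanZ//;
        exact: bounded_measurable_without (huuh k k').
    + by apply: bounded_measurableZ; exact: bounded_measurable_without (huuh k k').
  - apply: bounded_measurable_sum => k' _; apply: bounded_measurableZ.
    exact: bounded_measurable_without (huuh k k').
  - exact: bounded_measurable_sum.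
rewrite (@eq_mean _ _ _ _ _ (fun t => - 2 * lambda * f1 t +
   (- (lambda * form A c c)) * (f2 t - K%:R * h t) +
   2 * lambda ^+ 2 * (f3 t - h t * form S (z t) (z t)))).
  have b2h : bounded_measurable (fun t => f2 t - K%:R * h t).
    by apply: bounded_measurableB => //; exact: bounded_measurableZ.
  have b3h : bounded_measurable (fun t => f3 t - h t * form S (z t) (z t)).
    exact: bounded_measurableB.
  rewrite !meanD ?meanZ//; try exact: bounded_measurableZ.
    rewrite !meanB// ?meanZ//; last exact: bounded_measurableZ.
    by rewrite E1 E2 E3 !subrr !mulr0 !addr0.
  by apply: bounded_measurableD; exact: bounded_measurableZ.
move=> t; rewrite /deviation -/(z t).
have xE : form S (scores j t) (z t) = \sum_k score k (X j t) * u t k 0.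
  rewrite /form -mulmxA mxE; apply: eq_bigr => k _.
  by rewrite !mxE.
have -> : f1 t = h t * form S (scores j t) (z t).
  by rewrite xE mulr_sumr; apply: eq_bigr => k _; ring.
have -> : f2 t = h t * form S (scores j t) (scores j t).
  rewrite formE mulr_sumr; apply: eq_bigr => k _; rewrite mulr_sumr.
  by apply: eq_bigr => k' _; rewrite !mxE; ring.
have -> : f3 t = h t * form S (scores j t) (z t) ^+ 2.
  rewrite xE expr2 mulr_suml mulr_sumr; apply: eq_bigr => k _.
  by rewrite !mulr_sumr; apply: eq_bigr => k' _; ring.
ring.
Qed.

Definition state (c : nat -> 'cV[R]_L) n t : 'M[R]_(L, K) :=
  \sum_(i <- iota 0 n) c i *m (scores i t)^T.

Lemma bounded_measurable_state c n : bounded_measurable_mx (state c n).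
Proof.
apply: bounded_measurable_mx_sum => i.
apply: (bounded_measurable_mulmx (@bounded_measurable_mx_cst _ T R _ _ (c i))).
by apply: bounded_measurable_trmx; exact: bounded_measurable_scores.
Qed.

Lemma bounded_measurable_without_state c n :
  bounded_measurable_mx (state c n : without X n -> _).
Proof.
move=> k l; rewrite /state; under eq_fun do rewrite summxE big_seq.
apply: bounded_measurable_sum => i; rewrite mem_iota /= add0n => lt_in.
apply: (bounded_measurable_mulmx (@bounded_measurable_mx_cst _ (without X n) R _ _ (c i))).
apply: bounded_measurable_trmx; apply: bounded_measurable_without_scores.
by rewrite neq_ltn lt_in.
Qed.

(** Replacing the observations one at a time by a step of the heat flow, from
    the last to the first, turns the Laplace transform of the squared norm of
    the state into the initial value of the flow, with a third-order error at
    each step. *)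
Lemma mean_heat_state (lambda : R) : 0 < lambda ->
  exists2 C, 0 <= C & forall (c : nat -> 'cV[R]_L) n r,
    0 <= r -> r <= 1 -> 4 * lambda * r ^+ 2 <= 1 ->
    (forall i, (i < n)%N -> form 1%:M (c i) (c i) <= r ^+ 2) ->
  `| E (fun t => heat lambda S [::] (state c n t)) -
     heat lambda S [seq c i | i <- iota 0 n] 0 | <= n%:R * (C * r ^+ 3).
Proof.
move=> l0.
have ST := positive_definite_inv_sym Sigma_pd.
have S0 := positive_definite_inv_ge0 Sigma_pd.
have [C C0 H] := @heat_step _ _ L _ _ l0 ST S0 _ score_bound_ge0.
exists C => // c n r r0 r1 lr cr.
(* cs j lists the directions of the increments still to be added to state j. *)
pose cs j := [seq c i | i <- iota j (n - j)].
suff : forall j, (j <= n)%N ->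
    `| E (fun t => heat lambda S (cs j) (state c j t)) -
       heat lambda S (cs 0%N) 0 | <= j%:R * (C * r ^+ 3).
  by move=> /(_ n (leqnn n)); rewrite /cs subnn subn0.
elim=> [_|j IH jn].
  rewrite mul0r (_ : E _ = heat lambda S (cs 0%N) 0) ?subrr ?normr0//.
  rewrite -[RHS](mean_cst P); apply: eq_mean => t.
  by rewrite /state big_nil.
have csE : cs j = c j :: cs j.+1 by rewrite /cs -[(n - j)%N](@subnSK) //.
have stE t : state c j.+1 t = state c j t + c j *m (scores j t)^T.
  by rewrite /state -addn1 iotaD big_cat/= big_seq1.
pose f t := heat lambda S (cs j.+1) (state c j.+1 t).
pose g t := heat lambda S (cs j) (state c j t).
pose h t := heat lambda S (cs j.+1) (state c j t).
pose D t := deviation lambda S (precision lambda (cs j.+1)) (c j) (state c j t) (scores j t).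
have hf : bounded_measurable f.
  by apply: bounded_measurable_heat; exact: bounded_measurable_state.
have hg : bounded_measurable g.
  by apply: bounded_measurable_heat; exact: bounded_measurable_state.
have hh : bounded_measurable h.
  by apply: bounded_measurable_heat; exact: bounded_measurable_state.
have hD : bounded_measurable D.
  have hst := bounded_measurable_state c j; have hsc := bounded_measurable_scores j.
  have hz : bounded_measurable_mx (fun t => (state c j t)^T *m precision lambda (cs j.+1) *m c j).
    apply: (bounded_measurable_mulmx _ (@bounded_measurable_mx_cst _ T R _ _ _)).
    apply: (bounded_measurable_mulmx _ (@bounded_measurable_mx_cst _ T R _ _ _)).
    exact: bounded_measurable_trmx.
  apply: bounded_measurableD; first apply: bounded_measurableB.
  - by apply: bounded_measurableZ; exact: bounded_measurable_form.
  - apply: bounded_measurableZ; apply: bounded_measurableB.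
      exact: bounded_measurable_form.
    exact: bounded_measurable_cst.
  - apply: bounded_measurableZ; apply: bounded_measurableB.
      by apply: bounded_measurableX; exact: bounded_measurable_form.
    exact: bounded_measurable_form.
have hhD : bounded_measurable (fun t => h t * D t) by exact: bounded_measurableM.
have ED : E (fun t => h t * D t) = 0.
  apply: mean_deviation; last exact: bounded_measurable_without_state.
  by apply: bounded_measurable_heat; exact: bounded_measurable_without_state.
have step : `|E f - E g| <= C * r ^+ 3.
  have hfg : bounded_measurable (fun t => f t - g t) by exact: bounded_measurableB.
  rewrite -[E f - E g]subr0 -{1}ED -meanB// -meanB//.
  apply: normr_mean_le => [|t]; first exact: bounded_measurableB.
  rewrite /f stE /g csE; apply: H => //; first exact: cr.
  exact: form_scores_le.
have {}IH := IH (ltnW jn).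
rewrite -natr1 mulrDl mul1r [leRHS]addrC.
exact: (le_trans (ler_distD (E g) (E f) _) (lerD step IH)).
Qed.

End laplace.

(** * From Laplace transforms to distribution functions *)

Lemma bounded_measurable_expRN d (U : measurableType d) (R : realType) (f : U -> R) :
  measurable_fun [set: U] f -> (forall u, 0 <= f u) ->
  bounded_measurable (fun u => expR (- f u)).
Proof.
move=> mf f0; split; last first.
  by exists 1 => u; rewrite ger0_norm ?expR_ge0// -[leRHS]expR0 ler_expR oppr_le0.
by apply: measurableT_comp => //; exact: measurable_funN.
Qed.

(** The polynomial 1 - (1 - y ^+ m) ^+ M in y = exp(- s) is close to 1 for s at
    most a and close to 0 for s at least b, when M is about exp(m a) and m is
    large. *)
Lemma polynomial_cutoff (R : realType) (a b e : R) : a < b -> 0 < e -> e < 1 ->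
  exists p : {poly R}, forall s, 0 <= s ->
    [/\ 0 <= p.[expR (- s)] <= 1,
        s <= a -> 1 - e <= p.[expR (- s)] & b <= s -> p.[expR (- s)] <= e].
Proof.
move=> ab e0 elt1; have [a0|a0] := ltP a 0.
  exists 0 => s s0; rewrite horner0 lexx ler01; split => // [sa|_]; last exact: ltW.
  by move: (le_lt_trans s0 (le_lt_trans sa a0)); rewrite ltxx.
pose m := (Num.truncn (2 / (e ^+ 2 * (b - a)))).+1.
have ba : 0 < b - a by rewrite subr_gt0.
have m0 : 0 < m%:R :> R by rewrite ltr0n.
have hm : 2 / e ^+ 2 <= expR (m%:R * (b - a)).
  apply: le_trans (expR_ge1Dx _).
  have : 2 / (e ^+ 2 * (b - a)) < m%:R by exact: truncnS_gt.
  rewrite ltr_pdivrMr; last by rewrite mulr_gt0// exprn_gt0.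
  rewrite ler_pdivrMr ?exprn_gt0// => h; have : 0 < e ^+ 2 by rewrite exprn_gt0.
  nra.
pose t := expR (m%:R * a) / e.
have t0 : 0 <= t by rewrite divr_ge0 ?expR_ge0// ltW.
pose M := (Num.truncn t).+1.
have tM : t <= M%:R by rewrite ltW// truncnS_gt.
have Mt : M%:R <= t + 1 by rewrite /M -natr1 lerD2r truncn_le.
exists (1 - (1 - 'X^m) ^+ M) => s s0.
rewrite !(hornerD, hornerN, horner_exp, hornerXn, hornerX, hornerC).
rewrite -[expR (- s) ^+ m]expRM_natl mulrN.
set y := expR _; have y0 : 0 < y by exact: expR_gt0.
have y1 : y <= 1 by rewrite -[leRHS]expR0 ler_expR oppr_le0 mulr_ge0// ltW.
have z0 : 0 <= 1 - y by rewrite subr_ge0.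
have z1 : 1 - y <= 1 by rewrite lerBlDr lerDl ltW.
split.
- by rewrite subr_ge0 exprn_ile1//= lerBlDr lerDl exprn_ge0.
- move=> sa; rewrite lerB//.
  have yt : e^-1 <= M%:R * y.
    apply: (@le_trans _ _ (t * y)); last by rewrite ler_wpM2r// ltW.
    rewrite /t mulrAC ler_peMl ?invr_ge0 ?(ltW e0)//.
    by rewrite -expRD -[leLHS]expR0 ler_expR subr_ge0 ler_wpM2l// ltW.
  apply: (@le_trans _ _ (expR (- y) ^+ M)).
    by rewrite lerXn2r ?nnegrE ?expR_ge0// expR_ge1Dx.
  rewrite -expRM_natl mulrN expRN invf_ple ?posrE ?expR_gt0//.
  by rewrite (le_trans yt)// (le_trans _ (expR_ge1Dx _))// lerDr.
- move=> bs.
  have bern n : 1 - n%:R * y <= (1 - y) ^+ n.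
    elim: n => [|n IH]; first by rewrite mul0r subr0 expr0.
    rewrite exprS; apply: (@le_trans _ _ ((1 - y) * (1 - n%:R * y))).
      have : 0 <= n%:R * y ^+ 2 by rewrite mulr_ge0// sqr_ge0.
      by rewrite -natr1; nra.
    by rewrite ler_wpM2l.
  rewrite lerBlDr -lerBlDl (le_trans _ (bern M))// lerD2l lerN2.
  have yb : y <= expR (- (m%:R * b)) by rewrite ler_expR lerN2 ler_wpM2l// ltW.
  apply: (@le_trans _ _ ((t + 1) * expR (- (m%:R * b)))).
    by rewrite ler_pM// ltW.
  have e1 : 1 <= expR (m%:R * a) by rewrite -[leLHS]expR0 ler_expR mulr_ge0// ltW.
  apply: (@le_trans _ _ (2 * t * expR (- (m%:R * b)))).
    rewrite ler_wpM2r ?expR_ge0// mulr2n mulrDl mul1r lerD2l.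
    by rewrite /t ler_pdivlMr// mul1r (le_trans _ e1)// ltW.
  rewrite /t; have -> : 2 * (expR (m%:R * a) / e) * expR (- (m%:R * b)) =
      2 / e * expR (- (m%:R * (b - a))).
    by rewrite mulrBr opprB expRD; ring.
  rewrite expRN ler_pdivrMr ?expR_gt0// -ler_pdivrMl// mulrC.
  apply: le_trans hm; rewrite le_eqVlt; apply/orP; left; apply/eqP.
  by field; rewrite gt_eqF.
Qed.

Lemma mean_distribution_comp d d' (T : measurableType d) (T' : measurableType d')
    (R : realType) (P : probability T R) (X : {RV P >-> T'}) (f : T' -> R) :
  bounded_measurable f -> mean (distribution P X) f = mean P (f \o X).
Proof.
move=> hf; rewrite /mean /Rintegral; congr fine; rewrite integral_distribution//.
  by apply/measurable_EFinP; case: hf.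
apply: (@bounded_measurable_integrable _ _ _ P (f \o X)).
by case: hf => mf [M fM]; split; [exact: measurableT_comp|exists M => t; exact: fM].
Qed.

Lemma cvgr_sum (R : realType) (I : Type) (r : seq I) (f : I -> nat -> R) (l : I -> R) :
  (forall i, f i n @[n --> \oo] --> l i) ->
  \sum_(i <- r) f i n @[n --> \oo] --> \sum_(i <- r) l i.
Proof.
move=> fl; elim: r => [|i r IH].
  by rewrite big_nil; under eq_fun do rewrite big_nil; exact: cvg_cst.
rewrite big_cons; under eq_fun do rewrite big_cons.
by apply: cvgD; [exact: fl|exact: IH].
Qed.

Section laplace_continuity.
Context d d' (T : measurableType d) (T' : measurableType d') (R : realType).
Variables (P : probability T R) (Q : probability T' R) (W : {RV Q >-> R}).
Variables (Y : nat -> {RV P >-> R}) (Z : nat -> T -> R).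
Hypothesis mZ : forall n, measurable_fun [set: T] (Z n).
Hypothesis Z_ge0 : forall n t, 0 <= Z n t.
Hypothesis W_ge0 : forall w, 0 <= W w.
Hypothesis laplace : forall i : nat,
  mean P (fun t => expR (- (i%:R * Z n t))) @[n --> \oo] -->
  mean Q (fun w => expR (- (i%:R * W w))).
Hypothesis YZ : forall e, 0 < e ->
  mean P (fun t => (e < `|Y n t - Z n t|)%R%:R) @[n --> \oo] --> (0 : R).

Let expRN_coef (p : {poly R}) (s : R) :
  p.[expR (- s)] = \sum_(i < size p) p`_i * expR (- (i%:R * s)).
Proof.
by rewrite horner_coef; apply: eq_bigr => i _; rewrite -expRM_natl mulrN.
Qed.

Let bounded_measurable_horner d0 (U : measurableType d0) (f : U -> R) (p : {poly R}) :
  measurable_fun [set: U] f -> (forall u, 0 <= f u) ->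
  bounded_measurable (fun u => p.[expR (- f u)]).
Proof.
move=> mf f0; under eq_fun do rewrite expRN_coef.
apply: bounded_measurable_sum => i _; apply: bounded_measurableZ.
apply: bounded_measurable_expRN => [|u]; last by rewrite mulr_ge0.
by apply: measurable_funM => //; exact: measurable_cst.
Qed.

Lemma cvg_mean_horner (p : {poly R}) :
  mean P (fun t => p.[expR (- Z n t)]) @[n --> \oo] -->
  mean Q (fun w => p.[expR (- W w)]).
Proof.
have mW : measurable_fun [set: T'] W by exact: measurable_funP.
have bm d0 (U : measurableType d0) (f : U -> R) (i : nat) :
    measurable_fun [set: U] f -> (forall u, 0 <= f u) ->
    bounded_measurable (fun u => expR (- (i%:R * f u))).
  move=> mf f0; apply: bounded_measurable_expRN => [|u]; last by rewrite mulr_ge0.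
  by apply: measurable_funM => //; exact: measurable_cst.
have E d0 (U : measurableType d0) (m : probability U R) (f : U -> R) :
    measurable_fun [set: U] f -> (forall u, 0 <= f u) ->
    mean m (fun u => p.[expR (- f u)]) =
    \sum_(i < size p) p`_i * mean m (fun u => expR (- (i%:R * f u))).
  move=> mf f0; under eq_mean do rewrite expRN_coef.
  rewrite mean_sum => [|i _]; last by apply: bounded_measurableZ; exact: bm.
  by apply: eq_bigr => i _; rewrite meanZ//; exact: bm.
rewrite E//; under eq_fun do rewrite E//.
apply: cvgr_sum => i; apply: cvgM; [exact: cvg_cst|exact: laplace].
Qed.

Lemma cdf_mean d0 (U : measurableType d0) (m : probability U R) (f : {RV m >-> R}) x :
  (distribution m f `]-oo, x]%classic = (mean m (fun u => (f u <= x)%R%:R))%:E)%E.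
Proof.
rewrite mean_bool; last by apply: measurable_fun_ler => //; exact: measurable_cst.
by rewrite /distribution /pushforward; congr (m _); apply/seteqP; split => u /=; rewrite in_itv.
Qed.

(** Integer Laplace exponents suffice, since they generate the polynomials in
    exp(- s). *)
Theorem laplace_cvg_in_distribution : cvg_in_distribution P Y (distribution Q W).
Proof.
move=> x; pose G r := mean Q (fun w => (W w <= r)%R%:R).
have GE r : (distribution Q W `]-oo, r]%classic = (G r)%:E)%E by exact: cdf_mean.
have FE : (fun r => distribution Q W `]-oo, r]%classic) = (fun r => (G r)%:E).
  by apply/funext => r; exact: GE.
move=> Gx0; have Gx : G r @[r --> x] --> G x.
  suff : (fun r => (G r)%:E) r @[r --> x] --> (G x)%:E by case/fine_cvgP.
  by rewrite -GE -FE; exact: Gx0.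
have cE : (fun n => cdf (Y n) x) =
    (fun n => (mean P (fun t => (Y n t <= x)%R%:R))%:E).
  by apply/funext => n; exact: cdf_mean.
suff H : (fun n => (mean P (fun t => (Y n t <= x)%R%:R))%:E) n @[n --> \oo]
    --> (G x)%:E.
  by rewrite -GE -cE in H; exact: H.
apply: cvg_EFin; first exact: nearW.
rewrite /comp /=.
apply/cvgrPdist_le => e e0.
(* Each of the two bounds below loses at most five times e5. *)
pose e5 := Num.min (e / 6) (1 / 2).
have e50 : 0 < e5 by rewrite lt_min !divr_gt0.
have e51 : e5 < 1 by rewrite gt_min; apply/orP; right; lra.
have e5e : 5 * e5 <= e.
  have : e5 <= e / 6 by rewrite ge_min lexx.
  lra.
have [h h0 Gh] : exists2 h, 0 < h & forall r, `|r - x| <= 2 * h -> `|G x - G r| <= e5.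
  move/cvgrPdist_le : Gx => /(_ e5 e50) /nbhs_ballP[r /= r0 rG].
  exists (r / 4); first by rewrite divr_gt0.
  move=> y xy; apply: rG; rewrite /ball/= distrC (le_lt_trans xy)//; lra.
have xh : x + h < x + 2 * h by lra.
(* p lies above the indicator of Z <= x + h and below that of W <= x + 2 h, up
   to e5; q is its counterpart on the left of x. *)
have [p hp] := polynomial_cutoff xh e50 e51.
have xh' : x - 2 * h < x - h by lra.
have [q hq] := polynomial_cutoff xh' e50 e51.
have mW : measurable_fun [set: T'] W by exact: measurable_funP.
have mY n : measurable_fun [set: T] (Y n) by exact: measurable_funP.
have ble d0 (U : measurableType d0) (f : U -> R) r : measurable_fun [set: U] f ->
    bounded_measurable (fun u => (f u <= r)%R%:R : R).
  by move=> mf; apply: bounded_measurable_le => //; exact: measurable_cst.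
have bdist n : bounded_measurable (fun t => (h < `|Y n t - Z n t|)%R%:R : R).
  apply: bounded_measurable_bool; apply: measurable_fun_ltr; first exact: measurable_cst.
  by apply: measurableT_comp => //; exact: measurable_funB.
have pW : mean Q (fun w => p.[expR (- W w)]) <= G (x + 2 * h) + e5.
  rewrite -[X in _ + X](mean_cst Q) -meanD; [|exact: ble|exact: bounded_measurable_cst].
  apply: le_mean => [||w].
  - exact: bounded_measurable_horner.
  - by apply: bounded_measurableD; [exact: ble|exact: bounded_measurable_cst].
  - have [/andP[_ p1] _ pb] := hp _ (W_ge0 w).
    have [wx|/ltW wx] := leP (W w) (x + 2 * h).
      by rewrite (le_trans p1)// lerDl ltW.
    by rewrite add0r pb.
have qW : G (x - 2 * h) - e5 <= mean Q (fun w => q.[expR (- W w)]).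
  rewrite -[X in _ - X](mean_cst Q) -meanB; [|exact: ble|exact: bounded_measurable_cst].
  apply: le_mean => [||w].
  - by apply: bounded_measurableB; [exact: ble|exact: bounded_measurable_cst].
  - exact: bounded_measurable_horner.
  - have [/andP[q0 _] qa _] := hq _ (W_ge0 w).
    have [wx|/ltW wx] := leP (W w) (x - 2 * h); first exact: qa.
    by rewrite sub0r (le_trans _ q0)// oppr_le0 ltW.
have up n : mean P (fun t => (Y n t <= x)%R%:R) <=
    mean P (fun t => p.[expR (- Z n t)]) + e5 + mean P (fun t => (h < `|Y n t - Z n t|)%R%:R).
  have bp : bounded_measurable (fun t => p.[expR (- Z n t)] + e5).
    by apply: bounded_measurableD; [exact: bounded_measurable_horner|exact: bounded_measurable_cst].
  rewrite -[X in _ + X + _](mean_cst P) -!meanD//; last 2 first.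
  - exact: bounded_measurable_horner.
  - exact: bounded_measurable_cst.
  apply: le_mean => [||t]; [exact: ble|exact: bounded_measurableD|].
  have [/andP[p0 _] pa _] := hp _ (Z_ge0 n t).
  have [Yx|_] := leP (Y n t) x; last by rewrite !addr_ge0// ltW.
  have [YZh|_] := leP `|Y n t - Z n t| h; last by rewrite lerDr addr_ge0// ltW.
  rewrite addr0 -lerBlDr pa//; move: YZh; rewrite ler_norml => /andP[? _]; lra.
have low n : mean P (fun t => q.[expR (- Z n t)]) - e5
    - mean P (fun t => (h < `|Y n t - Z n t|)%R%:R) <= mean P (fun t => (Y n t <= x)%R%:R).
  have bq : bounded_measurable (fun t => q.[expR (- Z n t)] - e5).
    by apply: bounded_measurableB; [exact: bounded_measurable_horner|exact: bounded_measurable_cst].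
  rewrite -[X in _ - X - _](mean_cst P) -!meanB//; last 2 first.
  - exact: bounded_measurable_horner.
  - exact: bounded_measurable_cst.
  apply: le_mean => [||t]; [exact: bounded_measurableB|exact: ble|].
  have [/andP[_ q1] _ qb] := hq _ (Z_ge0 n t).
  have [_|Yx] := leP (Y n t) x.
    have b0 : 0 <= (h < `|Y n t - Z n t|)%R%:R :> R by [].
    rewrite /=; lra.
  have [YZh|_] := leP `|Y n t - Z n t| h; last by rewrite /= in q1 *; lra.
  rewrite subr0 subr_le0 qb//; move: YZh; rewrite ler_norml => /andP[_ ?]; lra.
have Gp : `|G x - G (x + 2 * h)| <= e5.
  by apply: Gh; rewrite addrC addKr ger0_norm// mulr_ge0// ltW.
have Gq : `|G x - G (x - 2 * h)| <= e5.
  by apply: Gh; rewrite addrC addKr normrN ger0_norm// mulr_ge0// ltW.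
have cp := @cvg_mean_horner p; move/cvgrPdist_le : cp => /(_ e5 e50) cp.
have cq := @cvg_mean_horner q; move/cvgrPdist_le : cq => /(_ e5 e50) cq.
have cd := YZ h0; move/cvgrPdist_le : cd => /(_ e5 e50) cd.
near=> n.
have np : `|mean Q (fun w => p.[expR (- W w)]) - mean P (fun t => p.[expR (- Z n t)])| <= e5.
  by near: n.
have nq : `|mean Q (fun w => q.[expR (- W w)]) - mean P (fun t => q.[expR (- Z n t)])| <= e5.
  by near: n.
have nd : `|0 - mean P (fun t => (h < `|Y n t - Z n t|)%R%:R)| <= e5 by near: n.
move: (up n) (low n) np nq nd Gp Gq; rewrite !ler_norml.
move=> ? ? /andP[? ?] /andP[? ?] /andP[? ?] /andP[? ?] /andP[? ?].
apply/andP; split; lra.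
Unshelve. all: by end_near.
Qed.

End laplace_continuity.

(** * The Laplace transform of the chi-square distribution *)

Section chi_square_laplace.
Context (R : realType).
Local Notation mu := (@lebesgue_measure R).

(** By uniqueness of the Radon-Nikodym derivative. *)
Lemma integral_normal_prob (m s : R) (f : R -> \bar R) : s != 0 ->
  measurable_fun [set: R] f -> (\int[normal_prob m s]_x `|f x| < +oo)%E ->
  (\int[normal_prob m s]_x f x = \int[mu]_x (f x * (normal_pdf m s x)%:E))%E.
Proof.
move=> s0 mf finf.
have dom := normal_prob_dominates m s.
rewrite -(Radon_Nikodym_change_of_variables dom)//=; last by apply/integrableP; split.
apply: ae_eq_integral => //.
- exact: emeasurable_funM.
- apply: emeasurable_funM => //; apply/measurable_EFinP.
  exact: measurable_normal_pdf.
- apply: ae_eqe_mul2l => /=.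
  rewrite Radon_NikodymE//=; case: cid => /= h [h1 h2 h3].
  apply: integral_ae_eq => //=.
  + by apply/measurable_EFinP; exact: measurable_normal_pdf.
  + by move=> E _ mE; rewrite -h3.
Qed.

(** Up to the normalizing constant, exp(- lambda x ^+ 2) times the standard
    normal density is a centred normal density of variance
    (1 + 2 lambda)^-1. *)
Lemma mean_normal_laplace (lambda : R) : 0 <= lambda ->
  mean (normal_prob (0 : R) 1) (fun x => expR (- (lambda * x ^+ 2))) =
  expR (- (1 / 2) * ln (1 + 2 * lambda)).
Proof.
move=> l0; have d0 : 0 < 1 + 2 * lambda by lra.
pose s := (Num.sqrt (1 + 2 * lambda))^-1 : R.
have s0 : 0 < s by rewrite invr_gt0 sqrtr_gt0.
have s2 : s ^+ 2 = (1 + 2 * lambda)^-1 by rewrite exprVn sqr_sqrtr// ltW.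
have bf : bounded_measurable (fun x : measurableTypeR R => expR (- (lambda * x ^+ 2)) : R).
  apply: bounded_measurable_expRN => [|x]; last by rewrite mulr_ge0// sqr_ge0.
  by apply: measurable_funM; [exact: measurable_cst|exact: exprn_measurable].
apply: EFin_inj; rewrite -mean_EFin//.
rewrite integral_normal_prob ?oner_eq0//; last 2 first.
- by apply/measurable_EFinP; case: bf.
- by have /integrableP[] := bounded_measurable_integrable (normal_prob (0 : R) 1) bf.
transitivity (\int[mu]_x (s%:E * (normal_pdf 0 s x)%:E))%E.
  apply: eq_integral => x _; rewrite -EFinM -EFinM; congr EFin.
  rewrite !normal_pdfE ?oner_eq0 ?gt_eqF// /normal_peak /normal_fun.
  rewrite mulrCA -expRD [RHS]mulrA; congr (_ * expR _).
    rewrite expr1n mul1r -mulrnAr sqrtrM ?sqr_ge0// sqrtr_sqr gtr0_norm//.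
    by rewrite invfM mulrA divff ?mul1r// gt_eqF.
  by rewrite s2 expr1n subr0; field; rewrite gt_eqF.
rewrite ge0_integralZl//; last 3 first.
- by apply/measurable_EFinP; exact: measurable_normal_pdf.
- by move=> x _; rewrite lee_fin normal_pdf_ge0.
- by rewrite lee_fin ltW.
rewrite integral_normal_pdf mule1; congr EFin; rewrite /s.
rewrite -powR12_sqrt ?ltW// -powRN /powR gt_eqF//.
by rewrite div1r.
Qed.

Lemma sum_squares_ge0 m (z : m.-tuple R) : 0 <= sum_squares z.
Proof. by rewrite sumr_ge0// => i _; exact: sqr_ge0. Qed.

Lemma mean_std_normal_laplace (lambda : R) m : 0 <= lambda ->
  mean (std_normal R m) (fun z => expR (- (lambda * sum_squares z))) =
  expR (- (m%:R / 2) * ln (1 + 2 * lambda)).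
Proof.
move=> l0.
have bs n : bounded_measurable (fun z : n.-tuple R => expR (- (lambda * sum_squares z)) : R).
  apply: bounded_measurable_expRN => [|z]; last by rewrite mulr_ge0// sum_squares_ge0.
  by apply: measurable_funM; [exact: measurable_cst|exact: measurable_sum_squares].
have bq : bounded_measurable (fun x : measurableTypeR R => expR (- (lambda * x ^+ 2)) : R).
  apply: bounded_measurable_expRN => [|x]; last by rewrite mulr_ge0// sqr_ge0.
  by apply: measurable_funM; [exact: measurable_cst|exact: exprn_measurable].
elim: m => [|m IH] /=.
  rewrite mul0r oppr0 mul0r expR0 /mean /Rintegral integral_dirac//.
    by rewrite diracT mul1e /sum_squares big_ord0 mulr0 oppr0 expR0.
  by apply/measurable_EFinP; have [] := bs 0%N.
rewrite mean_distribution_comp; last exact: bs.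
pose f (p : measurableTypeR R * m.-tuple R) :=
  expR (- (lambda * p.1 ^+ 2)) * expR (- (lambda * sum_squares p.2)) : R.
rewrite (@eq_mean _ _ _ _ _ f); last first.
  move=> [x z]; rewrite /f /= -expRD; congr expR.
  rewrite /sum_squares big_ord_recl /= -opprD -mulrDr; congr (- (_ * (_ + _))).
  by apply: eq_bigr => i _; rewrite !(tnth_nth 0).
have mf : measurable_fun setT (EFin \o f).
  apply/measurable_EFinP; apply: measurable_funM.
    case: bq => mq _; exact: (measurableT_comp mq (@measurable_fst _ _ _ _)).
  by case: (bs m) => mq _; exact: (measurableT_comp mq (@measurable_snd _ _ _ _)).
rewrite {1}/mean /Rintegral.
rewrite (fubini_tonelli1 (EFin \o f))//; last first.
  by move=> p; rewrite lee_fin mulr_ge0// expR_ge0.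
rewrite /fubini_F.
under eq_integral => x _.
  rewrite (_ : (\int[_]_y _)%E =
    (expR (- (m%:R / 2) * ln (1 + 2 * lambda)) * expR (- (lambda * x ^+ 2)))%:E); last first.
    rewrite [X in _ = X%:E]mulrC -IH -(meanZ _ _ (bs m)).
    by rewrite -mean_EFin//; exact: bounded_measurableZ.
  over.
rewrite mean_EFin; last exact: bounded_measurableZ.
rewrite /= meanZ// mean_normal_laplace// -expRD; congr expR.
by rewrite -natr1; field.
Qed.

End chi_square_laplace.

(** * Stability of the quadratic statistic *)

Section form_perturbation.
Context (R : realFieldType) (n : nat).
Implicit Types (A B : 'M[R]_n) (v x y : 'cV[R]_n).

Lemma formDD A x y : A^T = A ->
  form A (x + y) (x + y) = form A x x + 2 * form A x y + form A y y.
Proof.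
move=> AT; have := form_sym y x AT; rewrite /form.
have -> : (x + y)^T = x^T + y^T by exact: linearD.
have addE (M N : 'M[R]_1) : (M + N) 0 0 = M 0 0 + N 0 0 by rewrite mxE.
by rewrite mulmxDr !mulmxDl !addE => ->; ring.
Qed.

Lemma formZZ A (a : R) x y : form A (a *: x) y = a * form A x y.
Proof.
rewrite /form; have -> : (a *: x)^T = a *: x^T by exact: linearZ.
by rewrite -!scalemxAl mxE.
Qed.

Lemma formZ2 A (a : R) x y : A^T = A -> form A x (a *: y) = a * form A x y.
Proof. by move=> AT; rewrite form_sym// formZZ form_sym. Qed.

Lemma form_young A (e : R) x y : A^T = A -> (forall v, 0 <= form A v v) -> 0 < e ->
  `|2 * form A x y| <= e * form A x x + e^-1 * form A y y.
Proof.
move=> AT A0 e0.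
have E s : form A (e *: x + s *: y) (e *: x + s *: y) =
    e ^+ 2 * form A x x + 2 * e * s * form A x y + s ^+ 2 * form A y y.
  by rewrite formDD// !(formZZ, formZ2)//; ring.
have h1 := A0 (e *: x + 1 *: y); have h2 := A0 (e *: x + (- 1) *: y).
rewrite !E in h1 h2.
have -> : e * form A x x + e^-1 * form A y y =
    (e ^+ 2 * form A x x + form A y y) / e by field; rewrite gt_eqF.
by rewrite ler_pdivlMr// -[X in _ * X](gtr0_norm e0) -normrM ler_norml; apply/andP; split; lra.
Qed.

(** The bilinear form at the solution of A y = v is the linear form of v. *)
Lemma form_normal_equation A v : A \in unitmx -> A^T = A -> forall x,
  form A (invmx A *m v) x = (v^T *m x) 0 0.
Proof.
move=> Au AT x; rewrite /form trmx_mul trmx_inv AT.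
by rewrite -[v^T *m _ *m A]mulmxA mulVmx// mulmx1.
Qed.

(** Inversion reverses the order of positive definite forms; a form within a
    factor 1 + e of another one keeps this property, up to a factor two in e,
    after inversion. *)
Lemma inv_form_close A B e : positive_definite A -> B^T = B -> 0 < e -> e <= 1 / 2 ->
  (forall x, `|form B x x - form A x x| <= e * form A x x) ->
  B \in unitmx /\
  forall v, `|form (invmx B) v v - form (invmx A) v v| <= 2 * e * form (invmx A) v v.
Proof.
move=> Apd BT e0 e12 AB; have [AT Apos] := Apd.
have Au := positive_definite_unit Apd.
have A0 x : 0 <= form A x x.
  by have [->|x0] := eqVneq x 0; [rewrite /form mulmx0 mxE|rewrite ltW// Apos].
have AB' x : (1 - e) * form A x x <= form B x x <= (1 + e) * form A x x.
  by have := AB x; rewrite ler_norml => /andP[? ?]; apply/andP; split; lra.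
have Bpd : positive_definite B.
  split => // x x0; have /andP[h _] := AB' x; apply: lt_le_trans h.
  by rewrite mulr_gt0 ?Apos//; lra.
have Bu := positive_definite_unit Bpd.
have B0 x : 0 <= form B x x.
  by have /andP[h _] := AB' x; apply: le_trans h; rewrite mulr_ge0//; lra.
split => // v; pose x := invmx A *m v; pose y := invmx B *m v.
have aE : form (invmx A) v v = (v^T *m x) 0 0 by rewrite /form -mulmxA.
have bE : form (invmx B) v v = (v^T *m y) 0 0 by rewrite /form -mulmxA.
rewrite aE bE; set a := (v^T *m x) 0 0; set b := (v^T *m y) 0 0.
have Axx : form A x x = a by rewrite form_normal_equation.
have Axy : form A x y = b by rewrite form_normal_equation.
have Byy : form B y y = b by rewrite form_normal_equation.
have Byx : form B y x = a by rewrite form_normal_equation.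
have a0 : 0 <= a by rewrite -Axx.
have b0 : 0 <= b by rewrite -Byy.
(* b is at once v^T y, the form B at y, and the form A of x and y; similarly
   for a. The Cauchy-Schwarz inequality for A and for B then compares them. *)
have h1 : b ^+ 2 <= a * form A y y.
  by rewrite -{1}Axy -Axx; exact: form_cauchy_schwarz.
have h2 : a ^+ 2 <= b * form B x x.
  by rewrite -{1}Byx -Byy; exact: form_cauchy_schwarz.
have /andP[h3 _] := AB' y; have /andP[_ h4] := AB' x.
rewrite Axx in h4; rewrite Byy in h3.
have h5 : (1 - e) * b <= a.
  have [b00|bN0] := eqVneq b 0; first by rewrite b00 mulr0.
  have bp : 0 < b by rewrite lt_neqAle eq_sym bN0.
  rewrite -(ler_pM2r bp); nra.
have h6 : a <= (1 + e) * b.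
  have [a00|aN0] := eqVneq a 0; first by rewrite a00 mulr_ge0//; lra.
  have ap : 0 < a by rewrite lt_neqAle eq_sym aN0.
  rewrite -(ler_pM2r ap); nra.
by rewrite ler_norml; apply/andP; split; nra.
Qed.

(** An entry of x is the A-product of x with a column of the inverse of A. *)
Lemma sqr_entry_le A x i : positive_definite A ->
  x i 0 ^+ 2 <= \tr (invmx A) * form A x x.
Proof.
move=> Apd; have [AT Apos] := Apd; have Au := positive_definite_unit Apd.
have A0 y : 0 <= form A y y.
  by have [->|y0] := eqVneq y 0; [rewrite /form mulmx0 mxE|rewrite ltW// Apos].
have diag j : form (invmx A) (delta_mx j 0) (delta_mx j 0) = invmx A j j.
  by rewrite /form trmx_delta -rowE -colE !mxE.
have := form_cauchy_schwarz AT A0 (invmx A *m delta_mx i 0) x.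
rewrite form_normal_equation// trmx_delta -rowE [row _ _ _ _]mxE => h.
apply: (le_trans h); rewrite ler_wpM2r//.
rewrite form_normal_equation// mulmxA -/(form _ _ _) diag /mxtrace (bigD1 i)//=.
by rewrite lerDl sumr_ge0// => j _; rewrite -diag positive_definite_inv_ge0.
Qed.

Lemma form_entries_close A B x : positive_definite A ->
  `|form B x x - form A x x| <=
  \tr (invmx A) * (\sum_i \sum_j `|B i j - A i j|) * form A x x.
Proof.
move=> Apd.
have -> : form B x x - form A x x = \sum_i \sum_j x i 0 * (B i j - A i j) * x j 0.
  rewrite !formE -sumrB; apply: eq_bigr => i _; rewrite -sumrB.
  by apply: eq_bigr => j _; ring.
rewrite (le_trans (ler_norm_sum _ _ _))// mulrAC mulr_sumr.
apply: ler_sum => i _; rewrite mulr_sumr (le_trans (ler_norm_sum _ _ _))//.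
apply: ler_sum => j _; rewrite !normrM [leRHS]mulrC mulrAC [leLHS]mulrC.
rewrite ler_wpM2l//.
have hi := sqr_entry_le x i Apd; have hj := sqr_entry_le x j Apd.
rewrite -[_ ^+ 2](real_normK (num_real _)) in hi.
rewrite -[_ ^+ 2](real_normK (num_real _)) in hj.
have := sqr_ge0 (`|x i 0| - `|x j 0|); move: hi hj.
set u := `|x i 0|; set v := `|x j 0|; set w := \tr _ * _ => hi hj uv; nra.
Qed.

End form_perturbation.

(** With S the inverse of A and r = g + h, the quadratic statistics of r for the
    inverse of B and of g for S differ by little as soon as the entries of B are
    close to those of A and h is small compared with g. *)
Lemma quadratic_statistic_close (R : realFieldType) (n : nat) (I : finType)
    (A : 'M[R]_n) (e : R) : positive_definite A -> 0 < e -> e <= 1 / 2 ->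
  exists2 c, 0 <= c & forall (B : 'M[R]_n) (g h : I -> 'cV[R]_n), B^T = B ->
    c * (\sum_i \sum_j (B i j - A i j) ^+ 2) <= 1 ->
  B \in unitmx /\
  `| \sum_l form (invmx B) (g l + h l) (g l + h l)
     - \sum_l form (invmx A) (g l) (g l) | <=
  \sum_l (5 * e * form (invmx A) (g l) (g l)
           + (e^-1 + 3) * form (invmx A) (h l) (h l)).
Proof.
move=> Apd e0 e12; set S := invmx A; pose tau := \tr S.
have ST : S^T = S := positive_definite_inv_sym Apd.
have S0 := positive_definite_inv_ge0 Apd.
have tau0 : 0 <= tau.
  rewrite /tau /mxtrace sumr_ge0// => j _.
  have -> : S j j = form S (delta_mx j 0) (delta_mx j 0).
    by rewrite /form trmx_delta -rowE -colE !mxE.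
  exact: S0.
pose k : R := n%:R * n%:R; have k0 : 0 <= k by rewrite mulr_ge0.
have tk0 : 0 <= tau * k by exact: mulr_ge0.
(* theta splits e evenly in |x| <= theta + x ^+ 2 / theta. *)
pose theta := e / (2 * (tau * k + 1)).
have d0 : 0 < 2 * (tau * k + 1) by lra.
have theta0 : 0 < theta by rewrite divr_gt0.
exists (2 * tau / (theta * e)); first by apply: divr_ge0; [exact: mulr_ge0|apply: ltW; exact: mulr_gt0].
move=> B g h BT; set D := \sum_i _ => cD.
have D0 : 0 <= D by rewrite sumr_ge0// => i _; rewrite sumr_ge0// => j _; exact: sqr_ge0.
have tauD : tau * (\sum_i \sum_j `|B i j - A i j|) <= e.
  apply: (@le_trans _ _ (tau * (k * theta + D / theta))).
    rewrite ler_wpM2l// /k /D mulr_suml.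
    have -> : n%:R * n%:R * theta = \sum_(i < n) \sum_(j < n) theta.
      rewrite (eq_bigr (fun=> theta *+ n)) => [|i _]; last by rewrite sumr_const card_ord.
      by rewrite sumr_const card_ord -mulrnA -[RHS]mulr_natr natrM mulrC.
    rewrite -big_split/=; apply: ler_sum => i _; rewrite mulr_suml -big_split/=.
    apply: ler_sum => j _; set x := B i j - A i j.
    rewrite -(real_normK (num_real x)); set y := `|x|.
    have y0 : 0 <= y by exact: normr_ge0.
    have -> : theta + y ^+ 2 / theta = (theta ^+ 2 + y ^+ 2) / theta.
      by field; rewrite gt_eqF.
    by rewrite ler_pdivlMr//; nra.
  have h1 : tau * (k * theta) <= e / 2.
    have -> : tau * (k * theta) = e / 2 * (tau * k / (tau * k + 1)).
      by rewrite /theta; field; lra.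
    rewrite ler_piMr//; first by rewrite divr_ge0// ltW.
    by rewrite ler_pdivrMr; lra.
  have h2 : tau * (D / theta) <= e / 2.
    have -> : tau * (D / theta) = 2 * tau / (theta * e) * D * (e / 2).
      by field; rewrite !gt_eqF.
    by rewrite ler_piMl// divr_ge0// ltW.
  by rewrite mulrDr; lra.
have A0 x : 0 <= form A x x.
  have [->|x0] := eqVneq x 0; first by rewrite /form mulmx0 mxE.
  by have [_ Apos] := Apd; rewrite ltW// Apos.
have AB x : `|form B x x - form A x x| <= e * form A x x.
  by apply: le_trans (form_entries_close B x Apd) _; rewrite ler_wpM2r.
have [Bu BS] := inv_form_close Apd BT e0 e12 AB; split => //.
rewrite -sumrB (le_trans (ler_norm_sum _ _ _))//; apply: ler_sum => l _.
have hB := BS (g l + h l); have hY := form_young (g l) (h l) ST S0 e0.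
rewrite -/S (formDD (g l) (h l) ST) in hB.
move: hB hY (S0 (g l)) (S0 (h l)).
set b := form (invmx B) _ _; set x := form S (g l) (g l); set y := form S (h l) (h l).
set z := 2 * form S _ _ => hB hY x0 y0.
have i0 : 0 <= e^-1 by rewrite invr_ge0 ltW.
have zx : `|z| <= x + y.
  have := form_young (g l) (h l) ST S0 ltr01; by rewrite invr1 !mul1r.
move: hB hY zx; rewrite !ler_norml => /andP[? ?] /andP[? ?] /andP[? ?].
have ey : 0 <= e^-1 * y by exact: mulr_ge0.
have h1 : e * (x + z + y) <= e * (2 * x + 2 * y) by rewrite ler_wpM2l//; lra.
have h2 : e * y <= 1 / 2 * y by rewrite ler_wpM2r.
by apply/andP; split; lra.
Qed.

(** * The contrasts between groups *)

Section contrasts.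
Context (R : realType) (L n : nat) (b : nat -> nat).
Hypothesis L_gt0 : (0 < L)%N.
Hypothesis b0 : b 0%N = 0%N.
Hypothesis bL : b L = n.
Hypothesis b_lt : forall l, (l < L)%N -> (b l < b l.+1)%N.

Definition group_size (b : nat -> nat) l : R := (b l.+1)%:R - (b l)%:R.

Definition in_group (b : nat -> nat) l j := (b l <= j < b l.+1)%N.

(** The coefficients of the j-th observation in the standardized deviations of
    the group means from the general mean. *)
Definition contrast (L n : nat) (b : nat -> nat) j : 'cV[R]_L :=
  \col_l (((in_group b l j)%:R - group_size b l / n%:R) / Num.sqrt (group_size b l)).

Local Notation m := (group_size b).
Local Notation c := (contrast L n b).

Lemma group_bound_le l l' : (l <= l')%N -> (l' <= L)%N -> (b l <= b l')%N.
Proof.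
move=> ll'; elim: l' ll' => [|l' IH]; first by rewrite leqn0 => /eqP ->.
rewrite leq_eqVlt => /orP[/eqP -> //|ll' l'L].
by rewrite (leq_trans (IH ll' (ltnW l'L)))// ltnW// b_lt.
Qed.

Lemma group_bound_le_n l : (l <= L)%N -> (b l <= n)%N.
Proof. by move=> lL; rewrite -bL group_bound_le. Qed.

Lemma group_size_gt0 l : (l < L)%N -> 0 < m l.
Proof. by move=> lL; rewrite subr_gt0 ltr_nat b_lt. Qed.

Lemma sample_size_gt0 : 0 < n%:R :> R.
Proof.
rewrite ltr0n -bL (leq_trans _ (group_bound_le L_gt0 (leqnn L)))//.
by rewrite (leq_ltn_trans _ (b_lt L_gt0)).
Qed.

Lemma sum_group_size : \sum_(l < L) m l = n%:R.
Proof.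
rewrite -(big_mkord xpredT m) /group_size.
by rewrite telescope_sumr// b0 bL subr0.
Qed.

Lemma sum_in_group l (f : nat -> R) : (l < L)%N ->
  \sum_(j <- iota 0 n) (in_group b l j)%:R * f j = \sum_(b l <= j < b l.+1) f j.
Proof.
move=> lL; rewrite -[in LHS](subn0 n) -/(index_iota 0 n).
have h1 : (b l <= b l.+1)%N := ltnW (b_lt lL).
have h2 : (b l.+1 <= n)%N by exact: group_bound_le_n.
rewrite (@big_cat_nat _ _ _ (b l))//=; last exact: leq_trans h1 h2.
rewrite (@big_cat_nat _ _ _ (b l.+1) (b l) n)//=.
rewrite big_nat_cond big1 ?add0r; last first.
  by move=> j; rewrite andbT /in_group => /andP[_ jb]; rewrite leqNgt jb mul0r.
rewrite [X in _ + X]big_nat_cond [X in _ + X]big1 ?addr0; last first.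
  by move=> j; rewrite andbT /in_group => /andP[bj _]; rewrite [(j < _)%N]ltnNge bj andbF mul0r.
by apply: eq_big_nat => j; rewrite /in_group => ->; rewrite mul1r.
Qed.

Lemma sum_in_group1 l : (l < L)%N -> \sum_(j <- iota 0 n) (in_group b l j)%:R = m l.
Proof.
move=> lL; transitivity (\sum_(j <- iota 0 n) (in_group b l j)%:R * (1 : R)).
  by apply: eq_bigr => j _; rewrite mulr1.
rewrite sum_in_group// sumr_const_nat /group_size natrB//.
exact: ltnW (b_lt lL).
Qed.

Lemma in_group_disjoint l l' j : (l < L)%N -> (l' < L)%N -> l != l' ->
  in_group b l j && in_group b l' j = false.
Proof.
wlog ll' : l l' / (l < l')%N => [H lL l'L|_ l'L _].
  rewrite neq_ltn => /orP[ll'|ll']; first by apply: H => //; rewrite neq_ltn ll'.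
  by rewrite andbC; apply: H => //; rewrite neq_ltn ll'.
apply/negP => /andP[/andP[_ jl] /andP[l'j _]].
have := group_bound_le ll' (ltnW l'L).
by rewrite leqNgt (leq_ltn_trans l'j jl).
Qed.

Lemma sum_in_group2 l l' : (l < L)%N -> (l' < L)%N ->
  \sum_(j <- iota 0 n) (in_group b l j)%:R * (in_group b l' j)%:R =
  (l == l')%:R * m l.
Proof.
move=> lL l'L; have [<-|ll'] := eqVneq l l'.
  rewrite mul1r -(sum_in_group1 lL); apply: eq_bigr => j _.
  by rewrite -natrM mulnb andbb.
rewrite mul0r big1// => j _.
by rewrite -natrM mulnb (in_group_disjoint _ lL l'L ll').
Qed.

Definition group_direction : 'cV[R]_L := \col_l (Num.sqrt (m l) / Num.sqrt n%:R).

(** The contrasts are standardized and sum to zero after weighting by the square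
    roots of the group sizes, which is the direction removed here. *)
Lemma gram_contrast : gram [seq c j | j <- iota 0 n] =
  1%:M - group_direction *m group_direction^T.
Proof.
have n0 := sample_size_gt0.
rewrite /gram big_map; apply/matrixP => l l'; rewrite summxE !mxE big_ord1 !mxE.
have ml := group_size_gt0 (ltn_ord l); have ml' := group_size_gt0 (ltn_ord l').
have sl : 0 < Num.sqrt (m l) by rewrite sqrtr_gt0.
have sl' : 0 < Num.sqrt (m l') by rewrite sqrtr_gt0.
have sn : 0 < Num.sqrt n%:R :> R by rewrite sqrtr_gt0.
transitivity ((\sum_(j <- iota 0 n) ((in_group b l j)%:R * (in_group b l' j)%:R
    - m l' / n%:R * (in_group b l j)%:R - m l / n%:R * (in_group b l' j)%:R
    + m l * m l' / n%:R ^+ 2)) / (Num.sqrt (m l) * Num.sqrt (m l'))).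
  rewrite mulr_suml; apply: eq_bigr => j _; rewrite !mxE big_ord1 !mxE.
  by field; rewrite !gt_eqF.
rewrite !big_split/= !sumrN -!mulr_sumr !sum_in_group1// sum_in_group2//.
rewrite big_const_seq count_predT size_iota iter_addr_0 -[_^-1 *+ n]mulr_natr.
have nE : n%:R = Num.sqrt n%:R ^+ 2 :> R by rewrite sqr_sqrtr// ltW.
have mE : m l = Num.sqrt (m l) ^+ 2 by rewrite sqr_sqrtr// ltW.
have mE' : m l' = Num.sqrt (m l') ^+ 2 by rewrite sqr_sqrtr// ltW.
rewrite -(inj_eq val_inj) /=.
have [/val_inj ll'|ll'] := eqVneq (l : nat) l'.
  subst l'; move: mE nE sl sn {mE' sl'}.
  move: (Num.sqrt (m l)) (Num.sqrt n%:R) => x z -> -> x0 z0.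
  by rewrite mulr1n; field; rewrite !gt_eqF.
move: mE mE' nE sl sl' sn.
move: (Num.sqrt (m l)) (Num.sqrt (m l')) (Num.sqrt n%:R) => x y z -> -> -> x0 y0 z0.
by rewrite mulr0n; field; rewrite !gt_eqF.
Qed.

(** The projection has rank L - 1, whence the number of degrees of freedom. *)
Lemma det_gram_contrast (lambda : R) : 0 < lambda ->
  \det (1%:M + 2 * lambda *: gram [seq c j | j <- iota 0 n]) =
  (1 + 2 * lambda) ^+ (L - 1).
Proof.
move=> l0; rewrite gram_contrast; set u := group_direction.
have n0 := sample_size_gt0.
have d0 : 1 + 2 * lambda != 0 by rewrite gt_eqF//; lra.
have uu : (u^T *m u) 0 0 = 1.
  rewrite mxE; transitivity (\sum_(l < L) m l / n%:R).
    apply: eq_bigr => l _; rewrite !mxE -expr2 expr_div_n !sqr_sqrtr//.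
    by rewrite ltW// group_size_gt0.
  by rewrite -mulr_suml sum_group_size divff// gt_eqF.
have -> : 1%:M + 2 * lambda *: (1%:M - u *m u^T) =
    (1 + 2 * lambda) *: (1%:M + (- (2 * lambda / (1 + 2 * lambda)) *: u) *m u^T).
  rewrite scalerBr [in RHS]scalerDr addrA -[in LHS](scale1r 1%:M) scalerA mulr1.
  rewrite -scalerDl -scalemxAl scalerA; congr (_ + _).
  rewrite -scaleNr; congr (_ *: _).
  by field.
rewrite detZ det_1D_mulmx -scalemxAr [u^T *m u]mx11_scalar uu det_mx11 !mxE eqxx.
rewrite mulr1n mulr1.
case: L L_gt0 => // L' _; rewrite subSS subn0 exprS mulrAC -[RHS]mul1r; congr (_ * _).
by field.
Qed.

Lemma contrast_norm_le (kappa : R) j : 0 < kappa ->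
  (forall l, (l < L)%N -> kappa <= m l) -> form 1%:M (c j) (c j) <= L%:R / kappa.
Proof.
move=> k0 km; rewrite form1.
apply: (@le_trans _ _ (\sum_(l < L) kappa^-1)); last first.
  by rewrite sumr_const card_ord mulr_natl.
apply: ler_sum => l _; rewrite mxE expr_div_n sqr_sqrtr; last first.
  by rewrite ltW// group_size_gt0.
have ml := group_size_gt0 (ltn_ord l); have n0 := sample_size_gt0.
rewrite -[leRHS]mul1r; apply: ler_pM; rewrite ?sqr_ge0 ?invr_ge0 ?(ltW ml)//; last first.
  by rewrite lef_pV2 ?posrE// km.
have mn1 : m l / n%:R <= 1.
  rewrite ler_pdivrMr// mul1r -sum_group_size (bigD1 l)//= lerDl sumr_ge0// => i _.
  by rewrite ltW// group_size_gt0.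
have mn0 : 0 <= m l / n%:R by rewrite divr_ge0 ?ltW.
rewrite -[leRHS](expr1n _ 2) -(real_normK (num_real _)) lerXn2r ?nnegrE//.
by rewrite ler_norml; case: (in_group b l j) => /=; apply/andP; split; lra.
Qed.

Lemma sum_sqr_contrast (l : 'I_L) : \sum_(j <- iota 0 n) c j l 0 ^+ 2 <= 1.
Proof.
have -> : \sum_(j <- iota 0 n) c j l 0 ^+ 2 = gram [seq c j | j <- iota 0 n] l l.
  rewrite /gram big_map summxE; apply: eq_bigr => j _.
  by rewrite [RHS]mxE big_ord1 [(c j)^T _ _]mxE expr2.
rewrite gram_contrast !mxE big_ord1 !mxE eqxx mulr1n gerBl -expr2.
exact: sqr_ge0.
Qed.

End contrasts.

Section decomposition.
Context d (T : measurableType d) (R : realType) (P : probability T R) (K L n : nat).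
Variable X : nat -> {RV P >-> K.-tuple R}.
Variable b : nat -> nat.
Hypothesis L_gt0 : (0 < L)%N.
Hypothesis bL : b L = n.
Hypothesis b_lt : forall l, (l < L)%N -> (b l < b l.+1)%N.

Local Notation m := (group_size R b).

Definition group_pairs l : seq (nat * nat) :=
  [seq (i, j) | j <- index_iota (b l) (b l.+1), i <- iota 0 n].

Definition linear_part (l : 'I_L) t : 'cV[R]_K :=
  \col_k \sum_(j <- iota 0 n) contrast R L n b j l 0 * score X k (X j t).

Definition remainder_part (l : 'I_L) t : 'cV[R]_K :=
  \col_k (2 / (n%:R * Num.sqrt (m l)) *
    \sum_(p <- group_pairs l) degenerate X k p.1 p.2 t).

(** The last term is the value on the diagonal, where the degenerate part is zero
    by convention. *)
Lemma compareE k i j t : compare X k i j t =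
  1 / 2 + grade X k j t - grade X k i t + degenerate X k i j t + (i == j)%:R / 2.
Proof.
rewrite /degenerate; case: eqP => [->|_]; last by rewrite mul0r; ring.
by rewrite /compare lexx /=; lra.
Qed.

Lemma rankE j k t : (j < n)%N ->
  rank n (X ^~ t) j k - (n%:R + 1) / 2 =
  n%:R / 2 * score X k (X j t) - 1 / 2 * (\sum_(i <- iota 0 n) score X k (X i t))
  + \sum_(i <- iota 0 n) degenerate X k i j t.
Proof.
move=> jn; rewrite /rank.
have -> : \sum_(i < n) (tnth (X i t) k <= tnth (X j t) k)%R%:R =
    \sum_(i <- iota 0 n) compare X k i j t.
  by rewrite -(big_mkord xpredT (fun i => compare X k i j t)) /index_iota subn0.
under eq_bigr do rewrite compareE.
rewrite !big_split/= sumrN -!mulr_suml.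
have -> : \sum_(i <- iota 0 n) (i == j)%:R = 1 :> R.
  rewrite (bigD1_seq j) ?iota_uniq ?mem_iota//= eqxx big1 ?addr0// => i /negbTE ->.
  by [].
rewrite !big_const_seq !count_predT !size_iota !iter_addr_0.
have -> : \sum_(i <- iota 0 n) score X k (X i t) =
    2 * \sum_(i <- iota 0 n) grade X k i t - n%:R.
  have -> : n%:R = \sum_(i <- iota 0 n) 1 :> R.
    by rewrite big_const_seq count_predT size_iota iter_addr_0.
  by rewrite mulr_sumr -sumrB; apply: eq_bigr => i _; rewrite /score /grade; field.
rewrite -[grade X k j t *+ n]mulr_natr /score -/(grade X k j t); set S1 := \sum_(i <- _) grade _ _ _ _.
set S2 := \sum_(i <- _) degenerate _ _ _ _ _.
by rewrite /grade; field.
Qed.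

(** Hajek decomposition: the standardized mean rank of a group is a contrast of
    scores plus a degenerate sum. *)
Lemma centered_mean_rankE (l : 'I_L) t :
  (2 * Num.sqrt (m l) / n%:R) *: centered_mean_rank n (X ^~ t) b l =
  linear_part l t + remainder_part l t.
Proof.
have n0 := sample_size_gt0 R L_gt0 bL b_lt.
have ml := group_size_gt0 R b_lt (ltn_ord l).
have sl : 0 < Num.sqrt (m l) by rewrite sqrtr_gt0.
have mE : m l = Num.sqrt (m l) ^+ 2 by rewrite sqr_sqrtr// ltW.
apply/matrixP => k i; rewrite !mxE {i} /group_mean_rank -/(m l).
pose s j := score X k (X j t); pose D j := \sum_(i <- iota 0 n) degenerate X k i j t.
have mS : \sum_(b l <= j < b l.+1) (1 : R) = m l.
  by rewrite sumr_const_nat /group_size natrB// ltnW// b_lt.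
have RE : \sum_(b l <= j < b l.+1) rank n (X ^~ t) j k =
    m l * ((n%:R + 1) / 2) + n%:R / 2 * (\sum_(b l <= j < b l.+1) s j)
    - m l / 2 * (\sum_(i <- iota 0 n) s i) + \sum_(b l <= j < b l.+1) D j.
  rewrite -mS !mulr_suml mulr_sumr -sumrN -!big_split/=; apply: eq_big_nat => j /andP[_ jb].
  have jn : (j < n)%N by rewrite (leq_trans jb)// (group_bound_le_n bL b_lt).
  by have := rankE k t jn; rewrite -/(s j) -/(D j) => /eqP; rewrite subr_eq => /eqP ->; ring.
have -> : \sum_(p <- group_pairs l) degenerate X k p.1 p.2 t = \sum_(b l <= j < b l.+1) D j.
  by rewrite /group_pairs big_allpairs_dep.
have -> : \sum_(j <- iota 0 n) contrast R L n b j l 0 * score X k (X j t) =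
    (\sum_(b l <= j < b l.+1) s j - m l / n%:R * \sum_(i <- iota 0 n) s i) / Num.sqrt (m l).
  rewrite -(sum_in_group bL b_lt) ?ltn_ord// mulr_sumr -sumrB mulr_suml.
  by apply: eq_bigr => j _; rewrite mxE -/(s j); field; rewrite !gt_eqF.
rewrite RE; set S1 := \sum_(b l <= j < b l.+1) s j.
set S2 := \sum_(i <- iota 0 n) s i; set S3 := \sum_(b l <= j < b l.+1) D j.
move: mE sl; move: (Num.sqrt (m l)) => x -> x0; field.
by rewrite !gt_eqF.
Qed.

End decomposition.

(** * Convergence of the rank statistic *)

Section moment_bounds.
Context d (T : measurableType d) (R : realType) (P : probability T R) (K : nat).
Variable X : nat -> {RV P >-> K.-tuple R}.
Hypothesis X_iid : iid P X.
Hypothesis F_continuous : forall k : 'I_K, continuous (marginal_cdf P (X 0%N) k).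
Local Notation Sigma := (grade_cov P (X 0%N)).
Hypothesis Sigma_pd : positive_definite Sigma.

Local Notation E := (mean P).
Local Notation S := (invmx Sigma).
Local Notation score := (score X).

Lemma mean_sqr_sum_uniform (n : nat) (F : nat -> T -> R) v :
  (forall i, bounded_measurable (F i)) -> (forall i, E (fun t => F i t ^+ 2) <= v) ->
  E (fun t => (\sum_(i <- iota 0 n) F i t) ^+ 2) <= v * n%:R ^+ 2.
Proof.
move=> hF Fv.
apply: (@le_trans _ _ (\sum_(i <- iota 0 n) \sum_(j <- iota 0 n) v)); last first.
  rewrite !big_const_seq !count_predT !size_iota !iter_addr_0.
  by rewrite -mulrnA -[leLHS]mulr_natr natrM expr2.
apply: mean_sqr_sum_le => // i j.
have hX k := bounded_measurableX 2 (hF k).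
apply: (@le_trans _ _ (E (fun t => 1 / 2 * (F i t ^+ 2 + F j t ^+ 2)))).
  apply: le_mean => [||t]; first exact: bounded_measurableM.
    by apply: bounded_measurableZ; exact: bounded_measurableD.
  have := sqr_ge0 (F i t - F j t); nra.
rewrite meanZ ?meanD//; last exact: bounded_measurableD.
by have := Fv i; have := Fv j; lra.
Qed.

Lemma mean_form_le (f : T -> 'cV[R]_K) v : bounded_measurable_mx f ->
  (forall k, E (fun t => f t k 0 ^+ 2) <= v) ->
  E (fun t => form S (f t) (f t)) <= score_bound X * v.
Proof.
move=> hf fv; have hk k : bounded_measurable (fun t => f t k 0) by exact: hf.
have hX k := bounded_measurableX 2 (hk k).
have hb k k' : bounded_measurable
    (fun t => `|S k k'| * (1 / 2 * (f t k 0 ^+ 2 + f t k' 0 ^+ 2))).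
  by do 2 apply: bounded_measurableZ; exact: bounded_measurableD.
apply: (@le_trans _ _ (E (fun t => \sum_k \sum_k'
    `|S k k'| * (1 / 2 * (f t k 0 ^+ 2 + f t k' 0 ^+ 2))))).
  apply: le_mean => [||t]; first exact: bounded_measurable_form.
    by apply: bounded_measurable_sum => k _; apply: bounded_measurable_sum.
  rewrite formE; apply: ler_sum => k _; apply: ler_sum => k' _.
  rewrite mulrAC mulrC (le_trans (ler_norm _))// normrM ler_wpM2l// normrM.
  have := sqr_ge0 (`|f t k 0| - `|f t k' 0|).
  rewrite -[f t k 0 ^+ 2](real_normK (num_real _)) -[f t k' 0 ^+ 2](real_normK (num_real _)).
  by move: `|f t k 0| `|f t k' 0| => x y xy; nra.
rewrite mean_sum => [|k _]; last by apply: bounded_measurable_sum.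
rewrite /score_bound mulr_suml; apply: ler_sum => k _.
rewrite mean_sum// mulr_suml; apply: ler_sum => k' _.
rewrite meanZ; last by apply: bounded_measurableZ; exact: bounded_measurableD.
rewrite ler_wpM2l// meanZ ?meanD//; last exact: bounded_measurableD.
by have := fv k; have := fv k'; lra.
Qed.

Section empirical.
Variable n : nat.
Hypothesis n_gt0 : 0 < n%:R :> R.

(** The counterpart of the score for the empirical distribution functions. *)
Definition empirical_score k i t : R :=
  2 * (empirical_cdf n (X ^~ t) k (tnth (X i t) k) - 1 / 2).

Lemma empirical_scoreE k i t : empirical_score k i t - score k (X i t) =
  2 / n%:R * \sum_(j <- iota 0 n) (compare X k j i t - grade X k i t).
Proof.
rewrite /empirical_score /score -/(grade X k i t) /empirical_cdf sumrB.
rewrite big_const_seq count_predT size_iota iter_addr_0 -[grade _ _ _ _ *+ n]mulr_natr.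
have -> : \sum_(j < n) (tnth (X j t) k <= tnth (X i t) k)%R%:R =
    \sum_(j <- iota 0 n) compare X k j i t.
  by rewrite -(big_mkord xpredT (fun j => compare X k j i t)) /index_iota subn0.
by field; rewrite gt_eqF.
Qed.

Lemma normr_empirical_score k i t : `|empirical_score k i t| <= 1.
Proof.
have h0 : 0 <= empirical_cdf n (X ^~ t) k (tnth (X i t) k).
  by rewrite mulr_ge0 ?invr_ge0 ?ler0n// sumr_ge0.
have h1 : empirical_cdf n (X ^~ t) k (tnth (X i t) k) <= 1.
  rewrite /empirical_cdf mulrC ler_pdivrMr// mul1r.
  apply: (@le_trans _ _ (\sum_(j < n) 1)); last by rewrite sumr_const card_ord.
  by apply: ler_sum => j _; case: (tnth _ _ <= _)%R.
by rewrite /empirical_score ler_norml; apply/andP; split; lra.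
Qed.

Lemma bounded_measurable_empirical_score k i : bounded_measurable (empirical_score k i).
Proof.
have -> : empirical_score k i = (fun t => score k (X i t) +
    2 / n%:R * \sum_(j <- iota 0 n) (compare X k j i t - grade X k i t)).
  by apply/funext => t; rewrite -empirical_scoreE addrC subrK.
apply: bounded_measurableD; first exact: bounded_measurable_score.
apply: bounded_measurableZ; apply: bounded_measurable_sum => j _.
by apply: bounded_measurableB;
  [exact: bounded_measurable_compare|exact: bounded_measurable_grade].
Qed.

Lemma empirical_covE k k' t : empirical_cov n (X ^~ t) k k' =
  n%:R^-1 * \sum_(i <- iota 0 n) empirical_score k i t * empirical_score k' i t.
Proof.
rewrite mxE -[X in iota 0 X]subn0 -/(index_iota 0 n) big_mkord !mulr_sumr; apply: eq_bigr => i _.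
by rewrite /empirical_score; field; rewrite gt_eqF.
Qed.

Lemma empirical_cov_sym t : (empirical_cov n (X ^~ t))^T = empirical_cov n (X ^~ t).
Proof.
apply/matrixP => k k'; rewrite mxE !empirical_covE; congr (_ * _).
by apply: eq_bigr => i _; rewrite mulrC.
Qed.

Lemma bounded_measurable_empirical_cov :
  bounded_measurable_mx (fun t => empirical_cov n (X ^~ t)).
Proof.
move=> k k'; under eq_fun do rewrite empirical_covE.
apply: bounded_measurableZ; apply: bounded_measurable_sum => i _.
by apply: bounded_measurableM; exact: bounded_measurable_empirical_score.
Qed.

Lemma mean_sqr_empirical_score k i :
  E (fun t => (empirical_score k i t - score k (X i t)) ^+ 2) <= 4 / n%:R.
Proof.
under eq_mean do rewrite empirical_scoreE exprMn.
rewrite meanZ; last first.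
  apply: bounded_measurableX; apply: bounded_measurable_sum => j _.
  by apply: bounded_measurableB;
    [exact: bounded_measurable_compare|exact: bounded_measurable_grade].
have -> : 4 / n%:R = (2 / n%:R) ^+ 2 * n%:R :> R by field; rewrite gt_eqF.
by rewrite ler_wpM2l ?sqr_ge0//; exact: mean_sqr_compare.
Qed.

(** Consistency of the empirical covariance matrix: the ranks may be replaced by
    the grades, to which the law of large numbers applies. *)
Lemma mean_sqr_empirical_cov k k' :
  E (fun t => (empirical_cov n (X ^~ t) k k' - Sigma k k') ^+ 2) <= 40 / n%:R.
Proof.
pose F i t := empirical_score k i t * empirical_score k' i t
  - score k (X i t) * score k' (X i t).
pose G i t := score k (X i t) * score k' (X i t) - Sigma k k'.
have hs k0 i := bounded_measurable_score X k0 i.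
have he k0 i := bounded_measurable_empirical_score k0 i.
have hF i : bounded_measurable (F i).
  by apply: bounded_measurableB; exact: bounded_measurableM.
have hG i : bounded_measurable (G i).
  by apply: bounded_measurableB; [exact: bounded_measurableM|exact: bounded_measurable_cst].
have hd k0 i : bounded_measurable (fun t => (empirical_score k0 i t - score k0 (X i t)) ^+ 2).
  by apply: bounded_measurableX; exact: bounded_measurableB.
have FE i : E (fun t => F i t ^+ 2) <= 16 / n%:R.
  apply: (@le_trans _ _ (E (fun t =>
      2 * (empirical_score k i t - score k (X i t)) ^+ 2 +
      2 * (empirical_score k' i t - score k' (X i t)) ^+ 2))).
    apply: le_mean => [||t]; first exact: bounded_measurableX.
      by apply: bounded_measurableD; exact: bounded_measurableZ.
    have := normr_empirical_score k' i t; have := normr_score X k (X i t).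
    rewrite /F; move: (empirical_score k i t) (empirical_score k' i t).
    move: (score k _) (score k' _) => x y u v x1 v1.
    have -> : u * v - x * y = (u - x) * v + x * (v - y) by ring.
    have v2 : v ^+ 2 <= 1 by rewrite -(real_normK (num_real v)) exprn_ile1.
    have x2 : x ^+ 2 <= 1 by rewrite -(real_normK (num_real x)) exprn_ile1.
    apply: (@le_trans _ _ (2 * ((u - x) * v) ^+ 2 + 2 * (x * (v - y)) ^+ 2)).
      have := sqr_ge0 ((u - x) * v - x * (v - y)).
      by move: ((u - x) * v) (x * (v - y)) => p q pq; nra.
    by rewrite lerD// ler_wpM2l// exprMn; [rewrite ler_piMr// sqr_ge0|rewrite ler_piMl// sqr_ge0].
  rewrite meanD ?meanZ//; try exact: bounded_measurableZ.
  by have := mean_sqr_empirical_score k i; have := mean_sqr_empirical_score k' i; lra.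
have hSF : bounded_measurable (fun t => \sum_(i <- iota 0 n) F i t).
  by apply: bounded_measurable_sum.
have hSG : bounded_measurable (fun t => \sum_(i <- iota 0 n) G i t).
  by apply: bounded_measurable_sum.
apply: (@le_trans _ _ (E (fun t => 2 / n%:R ^+ 2 * (\sum_(i <- iota 0 n) F i t) ^+ 2 +
    2 / n%:R ^+ 2 * (\sum_(i <- iota 0 n) G i t) ^+ 2))).
  apply: le_mean => [||t].
  - apply: bounded_measurableX; apply: bounded_measurableB; last exact: bounded_measurable_cst.
    exact: bounded_measurable_empirical_cov.
  - by apply: bounded_measurableD; apply: bounded_measurableZ; exact: bounded_measurableX.
  - have -> : empirical_cov n (X ^~ t) k k' - Sigma k k' =
        n%:R^-1 * (\sum_(i <- iota 0 n) F i t + \sum_(i <- iota 0 n) G i t).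
      rewrite empirical_covE -big_split/=.
      rewrite [in RHS](eq_bigr (fun i => empirical_score k i t * empirical_score k' i t - Sigma k k')).
        rewrite sumrB big_const_seq count_predT size_iota iter_addr_0 -[Sigma k k' *+ n]mulr_natr.
        by field; rewrite gt_eqF.
      by move=> i _; rewrite /F /G; ring.
    move: (\sum_(i <- _) F _ _) (\sum_(i <- _) G _ _) => p q.
    rewrite exprMn exprVn -mulrDr [2 / _]mulrC -mulrA ler_wpM2l ?invr_ge0 ?sqr_ge0//.
    have := sqr_ge0 (p - q); nra.
rewrite meanD ?meanZ//; try by [exact: bounded_measurableX|
  apply: bounded_measurableZ; exact: bounded_measurableX].
have n2 : 0 <= 2 / n%:R ^+ 2 :> R by rewrite divr_ge0// sqr_ge0.
have h1 : 2 / n%:R ^+ 2 * E (fun t => (\sum_(i <- iota 0 n) F i t) ^+ 2) <= 32 / n%:R.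
  have -> : 32 / n%:R = 2 / n%:R ^+ 2 * (16 / n%:R * n%:R ^+ 2) :> R by field; rewrite gt_eqF.
  by rewrite ler_wpM2l//; exact: mean_sqr_sum_uniform.
have h2 : 2 / n%:R ^+ 2 * E (fun t => (\sum_(i <- iota 0 n) G i t) ^+ 2) <= 8 / n%:R.
  have -> : 8 / n%:R = 2 / n%:R ^+ 2 * (4 * n%:R) :> R by field; rewrite gt_eqF.
  by rewrite ler_wpM2l//; exact: mean_sqr_score2.
have -> : 40 / n%:R = 32 / n%:R + 8 / n%:R :> R by field; rewrite gt_eqF.
exact: lerD.
Qed.

End empirical.

Section groups.
Context (L n : nat) (b : nat -> nat).
Hypothesis L_gt0 : (0 < L)%N.
Hypothesis bL : b L = n.
Hypothesis b_lt : forall l, (l < L)%N -> (b l < b l.+1)%N.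

Local Notation m := (group_size R b).
Local Notation c := (contrast R L n b).

Lemma bounded_measurable_linear_part (l : 'I_L) : bounded_measurable_mx (linear_part n X b l).
Proof.
move=> k j; rewrite /linear_part; under eq_fun do rewrite mxE.
by apply: bounded_measurable_sum => i _; apply: bounded_measurableZ;
  exact: bounded_measurable_score.
Qed.

Lemma bounded_measurable_remainder_part (l : 'I_L) : bounded_measurable_mx (remainder_part n X b l).
Proof.
move=> k j; rewrite /remainder_part; under eq_fun do rewrite mxE.
apply: bounded_measurableZ; apply: bounded_measurable_sum => p _.
exact: bounded_measurable_degenerate.
Qed.

Lemma mean_sqr_linear_part (l : 'I_L) k :
  E (fun t => linear_part n X b l t k 0 ^+ 2) <= 1.
Proof.
rewrite /linear_part; under eq_mean do rewrite mxE.
apply: le_trans (mean_sqr_score X_iid F_continuous k _ (iota_uniq 0 n)) _.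
exact: sum_sqr_contrast.
Qed.

Lemma group_pairs_uniq l : uniq (group_pairs n b l).
Proof.
apply: allpairs_uniq; [exact: iota_uniq|exact: iota_uniq|].
by move=> [i j] [i' j'] _ _ /= [-> ->].
Qed.

(** The remainder is 2 / (n sqrt m) times a degenerate sum of m n terms. *)
Lemma mean_sqr_remainder_part (l : 'I_L) k :
  E (fun t => remainder_part n X b l t k 0 ^+ 2) <= 18 / n%:R.
Proof.
have n0 := sample_size_gt0 R L_gt0 bL b_lt.
have ml := group_size_gt0 R b_lt (ltn_ord l).
rewrite /remainder_part; under eq_mean do rewrite mxE exprMn.
rewrite meanZ; last first.
  by apply: bounded_measurableX; apply: bounded_measurable_sum => p _;
    exact: bounded_measurable_degenerate.
have -> : (2 / (n%:R * Num.sqrt (m l))) ^+ 2 = 4 / (n%:R ^+ 2 * m l).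
  by rewrite expr_div_n exprMn sqr_sqrtr ?ltW//; congr (_ / _); ring.
have -> : 18 / n%:R = 4 / (n%:R ^+ 2 * m l) * (9 / 2 * (m l * n%:R)).
  by field; rewrite !gt_eqF.
rewrite ler_wpM2l//; first by rewrite divr_ge0// mulr_ge0 ?sqr_ge0// ltW.
apply: le_trans (mean_sqr_degenerate X_iid F_continuous k (group_pairs_uniq l)) _.
rewrite size_allpairs !size_iota natrM natrB//.
exact: ltnW (b_lt (ltn_ord l)).
Qed.

(** The rank statistic with grades for ranks and the population covariance
    matrix for its estimate. *)
Definition linear_statistic t : R :=
  mxform S 1%:M (state X c n t) (state X c n t).

Lemma linear_statisticE t :
  linear_statistic t = \sum_(l < L) form S (linear_part n X b l t) (linear_part n X b l t).
Proof.
rewrite /linear_statistic mxform1E; apply: eq_bigr => l _.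
suff -> : (row l (state X c n t))^T = linear_part n X b l t by [].
apply/matrixP => k j; rewrite !mxE summxE; apply: eq_bigr => i _.
by rewrite mxE big_ord1 !mxE.
Qed.

Lemma linear_statistic_ge0 t : 0 <= linear_statistic t.
Proof.
rewrite linear_statisticE sumr_ge0// => l _.
exact: positive_definite_inv_ge0.
Qed.

Lemma bounded_measurable_linear_statistic : bounded_measurable linear_statistic.
Proof. by apply: bounded_measurable_mxform; exact: bounded_measurable_state. Qed.

Lemma rank_formulaE t : rank_formula n (X ^~ t) L b =
  \sum_(l < L) form (invmx (empirical_cov n (X ^~ t)))
    (linear_part n X b l t + remainder_part n X b l t)
    (linear_part n X b l t + remainder_part n X b l t).
Proof.
have n0 := sample_size_gt0 R L_gt0 bL b_lt.
rewrite /rank_formula mulr_sumr; apply: eq_bigr => l _.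
have ml := group_size_gt0 R b_lt (ltn_ord l).
rewrite -(centered_mean_rankE _ L_gt0 bL b_lt) formZZ.
have fZ (A : 'M[R]_K) (a : R) x y : form A x (a *: y) = a * form A x y.
  by rewrite /form -scalemxAr mxE.
rewrite fZ !mulrA /form; congr (_ * _).
rewrite -/(m l) -[in LHS](sqr_sqrtr (ltW ml)).
by field; rewrite gt_eqF.
Qed.

End groups.
End moment_bounds.

Section asymptotics.
Context d (T : measurableType d) (R : realType) (P : probability T R) (K L : nat).
Variable X : nat -> {RV P >-> K.-tuple R}.
Hypothesis L_gt0 : (0 < L)%N.
Hypothesis X_iid : iid P X.
Hypothesis F_continuous : forall k : 'I_K, continuous (marginal_cdf P (X 0%N) k).
Local Notation Sigma := (grade_cov P (X 0%N)).
Hypothesis Sigma_pd : positive_definite Sigma.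
Variable b : nat -> nat -> nat.
Hypothesis hb0 : forall n, (L <= n)%N -> b n 0%N = 0%N.
Hypothesis hbL : forall n, (L <= n)%N -> b n L = n.
Hypothesis hblt : forall n l, (L <= n)%N -> (l < L)%N -> (b n l < b n l.+1)%N.
Variable C : nat -> {RV P >-> R}.

Local Notation E := (mean P).
Local Notation S := (invmx Sigma).
Local Notation Y n := (rank_statistic X (C n) L n (b n)).
Local Notation Z n := (linear_statistic X L n (b n)).

(** On the event that the empirical covariance matrix is close to Sigma the
    difference is controlled by the linear part, times an arbitrarily small u,
    and by the remainder; the complement is controlled by Markov's inequality. *)
Lemma rank_statistic_close (e : R) : 0 < e ->
  E (fun t => (e < `|Y n t - Z n t|)%R%:R) @[n --> \oo] --> (0 : R).
Proof.
move=> e0; apply/cvgrPdist_le => r r0.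
pose sb := score_bound X; have sb0 : 0 <= sb by exact: score_bound_ge0.
have Lsb0 : 0 <= L%:R * sb by rewrite mulr_ge0.
pose u := Num.min (1 / 2) (r * e / (10 * (L%:R * sb + 1))).
have d0 : 0 < 10 * (L%:R * sb + 1) by lra.
have u0 : 0 < u by rewrite lt_min divr_gt0//= divr_gt0// mulr_gt0.
have u12 : u <= 1 / 2 by rewrite ge_min lexx.
have ur : L%:R / e * (5 * u * sb) <= r / 2.
  have h : u <= r * e / (10 * (L%:R * sb + 1)) by rewrite ge_min lexx orbT.
  rewrite ler_pdivlMr// in h.
  rewrite mulrAC ler_pdivrMr//; nra.
have [a a0 close] := quadratic_statistic_close 'I_L Sigma_pd u0 u12.
pose A := a * (K%:R * K%:R * 40) + L%:R / e * ((u^-1 + 3) * (sb * 18)).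
have ui : 0 <= u^-1 + 3 by rewrite addr_ge0// invr_ge0 ltW.
have A0 : 0 <= A.
  by rewrite addr_ge0// !mulr_ge0// invr_ge0 ltW.
exists (maxn L (Num.truncn (2 * A / r)).+1) => // n /=; rewrite geq_max => /andP[Ln An].
have n0 : 0 < n%:R :> R := sample_size_gt0 R L_gt0 (hbL Ln) (fun l => hblt Ln).
pose g (l : 'I_L) t := linear_part n X (b n) l t : 'cV[R]_K.
pose h (l : 'I_L) t := remainder_part n X (b n) l t : 'cV[R]_K.
pose Shat t := empirical_cov n (X ^~ t).
pose D t := \sum_i \sum_j (Shat t i j - Sigma i j) ^+ 2.
pose W t := \sum_(l < L) (5 * u * form S (g l t) (g l t) + (u^-1 + 3) * form S (h l t) (h l t)).
have hg l : bounded_measurable_mx (g l) by exact: bounded_measurable_linear_part.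
have hh l : bounded_measurable_mx (h l) by exact: bounded_measurable_remainder_part.
have bSg l : bounded_measurable (fun t => form S (g l t) (g l t)).
  exact: bounded_measurable_form.
have bSh l : bounded_measurable (fun t => form S (h l t) (h l t)).
  exact: bounded_measurable_form.
have bWl l : bounded_measurable (fun t =>
    5 * u * form S (g l t) (g l t) + (u^-1 + 3) * form S (h l t) (h l t)).
  by apply: bounded_measurableD; exact: bounded_measurableZ.
have bW : bounded_measurable W by apply: bounded_measurable_sum.
have bDij i j : bounded_measurable (fun t => (Shat t i j - Sigma i j) ^+ 2).
  apply: bounded_measurableX; apply: bounded_measurableB; last exact: bounded_measurable_cst.
  exact: bounded_measurable_empirical_cov.
have bD : bounded_measurable D.
  by apply: bounded_measurable_sum => i _; apply: bounded_measurable_sum.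
have S0 := positive_definite_inv_ge0 Sigma_pd.
have W0 t : 0 <= W t.
  by rewrite sumr_ge0// => l _; rewrite addr_ge0// mulr_ge0// mulr_ge0// ltW.
have D0 t : 0 <= D t.
  by rewrite sumr_ge0// => i _; rewrite sumr_ge0// => j _; exact: sqr_ge0.
have pointwise t : (e < `|Y n t - Z n t|)%R%:R <= a * D t + e^-1 * W t.
  have [aD|aD] := leP (a * D t) 1; last first.
    apply: (@le_trans _ _ 1); first by case: (_ < _)%R.
    by rewrite (le_trans (ltW aD))// lerDl mulr_ge0// invr_ge0 ltW.
  have [Bu YZ] := close (Shat t) (g ^~ t) (h ^~ t) (empirical_cov_sym X n0 t) aD.
  have {}YZ : `|Y n t - Z n t| <= W t.
    rewrite /rank_statistic Bu (rank_formulaE X L_gt0 (hbL Ln) (fun l => hblt Ln)).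
    by rewrite linear_statisticE; exact: YZ.
  have [_|eYZ] := leP `|Y n t - Z n t| e.
    by rewrite addr_ge0 ?mulr_ge0// invr_ge0 ltW.
  apply: (@le_trans _ _ (e^-1 * W t)); last by rewrite lerDr mulr_ge0.
  by rewrite mulrC ler_pdivlMr// mul1r ltW// (lt_le_trans eYZ).
have mY : measurable_fun [set: T] (Y n) by exact: measurable_rank_statistic.
have mZ : measurable_fun [set: T] (Z n).
  by case: (bounded_measurable_linear_statistic X L n (b n)).
have bI : bounded_measurable (fun t => (e < `|Y n t - Z n t|)%R%:R : R).
  apply: bounded_measurable_bool; apply: measurable_fun_ltr; first exact: measurable_cst.
  by apply: measurableT_comp => //; exact: measurable_funB.
have ED : E D <= K%:R * K%:R * 40 / n%:R.
  rewrite mean_sum => [|i _]; last by apply: bounded_measurable_sum.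
  apply: (@le_trans _ _ (\sum_(i < K) \sum_(j < K) (40 / n%:R))).
    apply: ler_sum => i _; rewrite mean_sum//; apply: ler_sum => j _.
    exact: mean_sqr_empirical_cov.
  rewrite (eq_bigr (fun=> 40 / n%:R *+ K)) => [|i _]; last by rewrite sumr_const card_ord.
  by rewrite sumr_const card_ord -mulrnA -[leLHS]mulr_natr natrM; lra.
have EW : E W <= L%:R * (5 * u * sb + (u^-1 + 3) * (sb * (18 / n%:R))).
  rewrite mean_sum//.
  apply: (@le_trans _ _ (\sum_(l < L) (5 * u * sb + (u^-1 + 3) * (sb * (18 / n%:R))))).
    apply: ler_sum => l _; rewrite meanD ?meanZ//; try exact: bounded_measurableZ.
    have h1 : E (fun t => form S (g l t) (g l t)) <= sb.
      rewrite -[leRHS]mulr1; apply: mean_form_le => // k.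
      exact: (mean_sqr_linear_part X_iid F_continuous L_gt0 (hbL Ln) (fun l => hblt Ln)).
    have h2 : E (fun t => form S (h l t) (h l t)) <= sb * (18 / n%:R).
      apply: mean_form_le => // k.
      exact: (mean_sqr_remainder_part X_iid F_continuous L_gt0 (hbL Ln) (fun l => hblt Ln)).
    by apply: lerD; rewrite ler_wpM2l// mulr_ge0// ltW.
  by rewrite sumr_const card_ord -[leLHS]mulr_natl.
rewrite sub0r normrN ger0_norm; last by apply: mean_ge0 => t; rewrite ler0n.
have bDW : bounded_measurable (fun t => a * D t + e^-1 * W t).
  by apply: bounded_measurableD; exact: bounded_measurableZ.
apply: (le_trans (le_mean P bI bDW pointwise)).
rewrite meanD ?meanZ//; try exact: bounded_measurableZ.
have An' : A / n%:R <= r / 2.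
  rewrite ler_pdivrMr//; have : 2 * A / r < n%:R.
    by apply: lt_le_trans (truncnS_gt _) _; rewrite ler_nat.
  by rewrite ltr_pdivrMr//; lra.
have i0 : 0 <= e^-1 by rewrite invr_ge0 ltW.
apply: (@le_trans _ _ (L%:R / e * (5 * u * sb) + A / n%:R)); last by lra.
apply: le_trans (lerD (ler_wpM2l a0 ED) (ler_wpM2l i0 EW)) _.
rewrite le_eqVlt; apply/orP; left; apply/eqP; rewrite /A.
by field; rewrite !gt_eqF.
Qed.

Hypothesis hbt : forall l, (l < L)%N -> exists2 t : R, 0 < t < 1 &
  ((b n l.+1)%:R - (b n l)%:R) / n%:R @[n --> \oo] --> t.

Lemma group_size_lower_bound : exists2 kappa : R, 0 < kappa &
  \forall n \near \oo, forall l, (l < L)%N -> kappa * n%:R <= group_size R (b n) l.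
Proof.
suff : forall L', (L' <= L)%N -> exists2 kappa : R, 0 < kappa &
    \forall n \near \oo, forall l, (l < L')%N -> kappa * n%:R <= group_size R (b n) l.
  by apply.
elim=> [_|L' IH L'L]; first by exists 1 => //; exact: nearW.
have [kappa k0 kn] := IH (ltnW L'L).
have [t /andP[t0 _] tn] := hbt L'L.
have t2 : t / 2 < t by rewrite ltr_pdivrMr// ltr_pMr// ltr1n.
move: tn => /cvgr_gt /(_ _ t2) tn'.
exists (Num.min kappa (t / 2)); first by rewrite lt_min k0 divr_gt0.
near=> n => l; rewrite ltnS leq_eqVlt => /orP[/eqP ->|lL'].
  apply: (@le_trans _ _ (t / 2 * n%:R)).
    by rewrite ler_wpM2r// ge_min lexx orbT.
  have n0 : 0 < n%:R :> R by rewrite ltr0n; near: n; exact: nbhs_infty_gt.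
  by rewrite -ler_pdivlMr// ltW//; near: n.
apply: (@le_trans _ _ (kappa * n%:R)); first by rewrite ler_wpM2r// ge_min lexx.
by move: l lL'; near: n.
Unshelve. all: by end_near.
Qed.

(** The contrasts have length at most r = sqrt(A / n), so that the error of the
    heat flow, of order n r ^+ 3 = A r, vanishes in the limit. *)
Lemma linear_statistic_laplace (i : nat) :
  E (fun t => expR (- (i%:R * Z n t))) @[n --> \oo] -->
  mean (std_normal R ((L - 1) * K)) (fun w => expR (- (i%:R * sum_squares w))).
Proof.
case: i => [|i].
  rewrite (_ : mean _ _ = 1); last first.
    by rewrite -[RHS](mean_cst (std_normal R ((L - 1) * K))); apply: eq_mean => w;
      rewrite mul0r oppr0 expR0.
  rewrite (_ : (fun n => E _) = (fun=> 1)); first exact: cvg_cst.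
  apply/funext => n; rewrite -[RHS](mean_cst P); apply: eq_mean => t.
  by rewrite mul0r oppr0 expR0.
pose lambda : R := i.+1%:R; have l0 : 0 < lambda by rewrite ltr0n.
rewrite -/lambda mean_std_normal_laplace ?ltW//.
have [C0 C00 H] := @mean_heat_state _ _ _ P K L X X_iid F_continuous Sigma_pd lambda l0.
have [kappa k0 kn] := group_size_lower_bound.
apply/cvgrPdist_le => e e0.
have L0 : 0 < L%:R :> R by rewrite ltr0n.
have l40 : 0 < 4 * lambda by rewrite mulr_gt0.
pose A := L%:R / kappa; have A0 : 0 < A by rewrite divr_gt0.
have CA : 0 < C0 * A + 1 by rewrite ltr_wpDl// mulr_ge0// ltW.
pose rho := Num.min 1 (Num.min (4 * lambda)^-1 (e / (C0 * A + 1))).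
have rho0 : 0 < rho by rewrite !lt_min ltr01 invr_gt0 l40 divr_gt0.
near=> n.
have Ln : (L <= n)%N by near: n; exact: nbhs_infty_ge.
have n0 : 0 < n%:R :> R := sample_size_gt0 R L_gt0 (hbL Ln) (fun l => hblt Ln).
have nk : forall l, (l < L)%N -> kappa * n%:R <= group_size R (b n) l by near: n.
have An : A / rho ^+ 2 <= n%:R by near: n; exact: nbhs_infty_ger.
pose r := Num.sqrt (A / n%:R).
have An0 : 0 <= A / n%:R by rewrite divr_ge0// ltW.
have r2 : r ^+ 2 = A / n%:R by rewrite sqr_sqrtr.
have r0 : 0 <= r by exact: sqrtr_ge0.
have rrho : r <= rho.
  rewrite -ler_sqr ?nnegrE ?(ltW rho0)// r2 ler_pdivrMr// mulrC.
  by rewrite -ler_pdivrMr// exprn_gt0.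
have r1 : r <= 1 by rewrite (le_trans rrho)// ge_min lexx.
have r4 : 4 * lambda * r <= 1.
  by rewrite mulrC -ler_pdivlMr// mul1r (le_trans rrho)// !ge_min lexx !orbT.
have lr : 4 * lambda * r ^+ 2 <= 1.
  by rewrite expr2 mulrA mulr_ile1// mulr_ge0// ltW.
have re : C0 * A * r <= e.
  apply: (@le_trans _ _ ((C0 * A + 1) * r)); first by rewrite ler_wpM2r// lerDl.
  by rewrite mulrC -ler_pdivlMr// (le_trans rrho)// !ge_min lexx !orbT.
pose c := contrast R L n (b n).
have cr j : (j < n)%N -> form 1%:M (c j) (c j) <= r ^+ 2.
  move=> _; rewrite r2 /A.
  have -> : L%:R / kappa / n%:R = L%:R / (kappa * n%:R) by rewrite invfM mulrA.
  apply: (contrast_norm_le L_gt0 (hb0 Ln) (hbL Ln) (fun l => hblt Ln)) => //.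
  exact: mulr_gt0.
have := H c n r r0 r1 lr cr.
have -> : E (fun t => heat lambda S [::] (state X c n t)) =
    E (fun t => expR (- (lambda * Z n t))).
  by apply: eq_mean => t; rewrite /heat /= mulr0 sub0r.
have -> : heat lambda S [seq c j | j <- iota 0 n] 0 =
    expR (- (((L - 1) * K)%:R / 2) * ln (1 + 2 * lambda)).
  rewrite /heat /mxform trmx0 !mul0mx mxtrace0 mulr0 subr0; congr expR.
  have -> : logdet lambda [seq c j | j <- iota 0 n] = (L - 1)%:R * ln (1 + 2 * lambda).
    apply: expR_inj; have STS := positive_definite_inv_sym Sigma_pd.
    rewrite (expR_logdet l0 STS (positive_definite_inv_ge0 Sigma_pd)).
    rewrite (det_gram_contrast L_gt0 (hb0 Ln) (hbL Ln) (fun l => hblt Ln))//.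
    by rewrite expRM_natl lnK// posrE addr_gt0// mulr_gt0.
  by rewrite natrM; field.
rewrite distrC => h; apply: (le_trans h).
have -> : n%:R * (C0 * r ^+ 3) = C0 * A * r.
  by rewrite exprSr r2; field; rewrite gt_eqF.
exact: re.
Unshelve. all: by end_near.
Qed.

End asymptotics.

Theorem theorem2 (d : measure_display) (T : measurableType d) (R : realType)
    (P : probability T R) (K L : nat) (hK : (1 <= K)%N) (hL : (2 <= L)%N)
    (X : nat -> {RV P >-> K.-tuple R}) (hX : iid P X)
    (hF : forall k : 'I_K, continuous (marginal_cdf P (X 0%N) k))
    (hSigma : positive_definite (grade_cov P (X 0%N)))
    (b : nat -> nat -> nat)
    (hb0 : forall n, (L <= n)%N -> b n 0%N = 0%N)
    (hbL : forall n, (L <= n)%N -> b n L = n)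
    (hblt : forall n l, (L <= n)%N -> (l < L)%N -> (b n l < b n l.+1)%N)
    (hbt : forall l, (l < L)%N -> exists2 t : R, 0 < t < 1 &
       ((b n l.+1)%:R - (b n l)%:R) / n%:R @[n --> \oo] --> t)
    (C : nat -> {RV P >-> R}) :
  cvg_in_distribution P (fun n => rank_statistic X (C n) L n (b n))
    (chi_square R ((L - 1) * K)).
Proof.
have L_gt0 : (0 < L)%N by exact: leq_trans hL.
apply: (@laplace_cvg_in_distribution _ _ _ _ R P (std_normal R ((L - 1) * K))
  (@sum_squares R ((L - 1) * K)) _ (fun n => linear_statistic X L n (b n))).
- by move=> n; case: (bounded_measurable_linear_statistic X L n (b n)).
- by move=> n t; exact: linear_statistic_ge0.
- exact: sum_squares_ge0.
- exact: (linear_statistic_laplace L_gt0).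
- exact: (rank_statistic_close L_gt0).
Qed.
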